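(* Let $\boldsymbol\mu(u)=(\mu_i(u))_{1\le i\le\kappa}$ with $\mu_i(u)\in\varepsilon_i+u^{-1}\mathbb C[[u^{-1}]]$. The Verma module $M(\boldsymbol\mu(u))$ over $\mathscr B_{\mathbf s,\boldsymbol\varepsilon}$ is nontrivial if and only if $\mu_\kappa(u)\mu_\kappa(-u)=1$ and, for every $1\le i<\kappa$, $$\tilde\mu_i(u)\,\tilde\mu_i(-u+\rho_{i+1})=\tilde\mu_{i+1}(u)\,\tilde\mu_{i+1}(-u+\rho_{i+1}),$$ where $\tilde\mu_i(u)=(2u-\rho_{i+1})\mu_i(u)+\sum_{a=i+1}^\kappa s_a\mu_a(u)$.
   Context: Fix integers $m,n\ge0$, $\kappa=m+n$, a parity sequence $\mathbf s=(s_1,\dots,s_\kappa)\in\{\pm1\}^\kappa$ with exactly $m$ entries $1$, $s_i=(-1)^{|i|}$; $\rho_k=\sum_{a=k}^\kappa s_a$ ($1\le k\le\kappa$), $\rho_{\kappa+1}=0$. $V=\mathbb C^{m|n}$ with basis $v_i$ of parity $|i|$, matrix units $E_{ij}$, $R(u)=1-\frac1u\sum_{i,j}s_jE_{ij}\otimes E_{ji}$. Fix $\boldsymbol\varepsilon\in\{\pm1\}^\kappa$. The twisted super Yangian $\mathscr B_{\mathbf s,\boldsymbol\varepsilon}$ is generated by $b_{ij}^{(r)}$ ($r\ge1$) of parity $|i|+|j|$, with $b_{ij}(u)=\delta_{ij}\varepsilon_i+\sum_{r\ge1}b_{ij}^{(r)}u^{-r}$, $B(u)=\sum(-1)^{|i||j|+|j|}b_{ij}(u)\otimes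 E_{ij}$, and relations $R(u-v)B_1(u)R(u+v)B_2(v)=B_2(v)R(u+v)B_1(u)R(u-v)$, $B(u)B(-u)=1$. The Verma module $M(\boldsymbol\mu(u))$ is the quotient of $\mathscr B_{\mathbf s,\boldsymbol\varepsilon}$ by the left ideal generated by all coefficients of $b_{ij}(u)$ for $1\le i<j\le\kappa$ and of $b_{ii}(u)-\mu_i(u)$ for $1\le i\le\kappa$. *)

(* Defs.v *)
From HB Require Import structures.
From mathcomp Require Import all_boot all_order all_algebra.
From mathcomp Require Import reals.
From mathcomp Require Import complex.
From mathcomp Require Import monalg.

Set Implicit Arguments.
Unset Strict Implicit.
Unset Printing Implicit Defensive.

Import GRing.Theory Num.Theory.
Local Open Scope ring_scope.

(* Indices are 0-based: i : 'I_kappa stands for the paper's i+1.       *)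
(* par i = |i| (parity of v_i); s_i = (-1)^|i|.                         *)

Section Parity.
Variable kappa : nat.
Variable par : 'I_kappa -> bool.

Definition sgn {A : pzRingType} (i : 'I_kappa) : A := (-1) ^+ par i.

(* rho k (0-based) = sum_{a >= k} s_a ; the paper's rho_{k+1}.  rho kappa = 0 *)
Definition rho {A : pzRingType} (k : nat) : A :=
  \sum_(a < kappa | (k <= a)%N) sgn a.
End Parity.

(* Even elements of  A (x) End(V) (x) End(V)  (super tensor product),  *)
(* written as coefficient families: X i j k l is the coefficient of    *)
(* E_ij (x) E_kl.  All elements involved are even, so the coefficient  *)
(* at (i,j,k,l) has parity |i|+|j|+|k|+|l|; the super product is then  *)
(* (x (x) E_ij (x) E_kl)(y (x) E_jq (x) E_ls)                           *)
(*   = (-1)^((|E_ij|+|E_kl|)|y| + |E_kl||E_jq|) xy (x) E_iq (x) E_ks.  *)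

Section SuperMatrices.
Variable A : pzRingType.
Variable kappa : nat.
Variable par : 'I_kappa -> bool.

Definition smx := 'I_kappa -> 'I_kappa -> 'I_kappa -> 'I_kappa -> A.

Definition smx0 : smx := fun _ _ _ _ => 0.
Definition smx1 : smx := fun i j k l => ((i == j) && (k == l))%:R.
Definition smxD (X Y : smx) : smx := fun i j k l => X i j k l + Y i j k l.
Definition smxN (X : smx) : smx := fun i j k l => - X i j k l.

Definition smxM (X Y : smx) : smx := fun i q k s =>
  \sum_(j < kappa) \sum_(l < kappa)
    (-1) ^+ ((par i + par j + par k + par l) * (par j + par q + par l + par s)
             + (par k + par l) * (par j + par q))%N
    * X i j k l * Y j q l s.

(* P = sum_{i,j} s_j E_ij (x) E_ji, acting in the two copies of End V *)
Definition smxP : smx := fun i j k l => ((k == j) && (l == i))%:R * sgn par j.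

(* Series  u^sh1 v^sh2 sum_{k,l>=0} cf k l u^-k v^-l  with smx coefficients *)
Record ser2 := Ser2 { sh1 : nat; sh2 : nat; cf : nat -> nat -> smx }.

Definition coef2 (X : ser2) (a b : int) : smx :=
  if (a <= (sh1 X)%:Z) && (b <= (sh2 X)%:Z)
  then cf X `|(sh1 X)%:Z - a|%N `|(sh2 X)%:Z - b|%N else smx0.

Definition lift2 (X : ser2) (e1 e2 : nat) : ser2 :=
  Ser2 (sh1 X + e1) (sh2 X + e2)
    (fun k l => if (e1 <= k)%N && (e2 <= l)%N then cf X (k - e1) (l - e2)
                else smx0).

Definition ser2D (X Y : ser2) : ser2 :=
  let d1 := maxn (sh1 X) (sh1 Y) in let d2 := maxn (sh2 X) (sh2 Y) in
  let X' := lift2 X (d1 - sh1 X) (d2 - sh2 X) in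
  let Y' := lift2 Y (d1 - sh1 Y) (d2 - sh2 Y) in
  Ser2 d1 d2 (fun k l => smxD (cf X' k l) (cf Y' k l)).

Definition ser2N (X : ser2) : ser2 :=
  Ser2 (sh1 X) (sh2 X) (fun k l => smxN (cf X k l)).

Definition smx_sum (F : nat -> smx) (N : nat) : smx :=
  \big[smxD/smx0]_(r < N) F r.

Definition ser2M (X Y : ser2) : ser2 :=
  Ser2 (sh1 X + sh1 Y) (sh2 X + sh2 Y)
    (fun k l => smx_sum (fun k1 => smx_sum (fun l1 =>
        smxM (cf X k1 l1) (cf Y (k - k1) (l - l1))) l.+1) k.+1).

Definition ser2C (M : smx) : ser2 :=
  Ser2 0 0 (fun k l => if (k == 0%N) && (l == 0%N) then M else smx0).
Definition ser2U : ser2 :=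
  Ser2 1 0 (fun k l => if (k == 0%N) && (l == 0%N) then smx1 else smx0).
Definition ser2V : ser2 :=
  Ser2 0 1 (fun k l => if (k == 0%N) && (l == 0%N) then smx1 else smx0).
Definition ser2u (f : nat -> smx) : ser2 :=
  Ser2 0 0 (fun k l => if l == 0%N then f k else smx0).
Definition ser2v (f : nat -> smx) : ser2 :=
  Ser2 0 0 (fun k l => if k == 0%N then f l else smx0).

Definition ser2_eq (X Y : ser2) : Prop :=
  forall (a b : int) i j k l, coef2 X a b i j k l = coef2 Y a b i j k l.

Variable eps : 'I_kappa -> bool.        (* eps_i = (-1)^(eps i) *)
Variable b : 'I_kappa -> 'I_kappa -> nat -> A.

(* coefficient of u^-r in b_ij(u) = delta_ij eps_i + sum_{r>=1} b_ij^(r) u^-r *)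
Definition bser (i j : 'I_kappa) (r : nat) : A :=
  if r == 0%N then ((i == j)%:R * (-1) ^+ eps i) else b i j r.

(* coefficient of E_ij in B(u): (-1)^(|i||j|+|j|) b_ij(u) *)
Definition Bcoef (r : nat) (i j : 'I_kappa) : A :=
  (-1) ^+ (par i * par j + par j)%N * bser i j r.

Definition B1 : ser2 := ser2u (fun r i j k l => (k == l)%:R * Bcoef r i j).
Definition B2 : ser2 := ser2v (fun t i j k l => (i == j)%:R * Bcoef t k l).

(* (u-v) R(u-v) = (u - v) - P  and  (u+v) R(u+v) = (u + v) - P *)
Definition Rminus : ser2 := ser2D (ser2D ser2U (ser2N ser2V)) (ser2N (ser2C smxP)).
Definition Rplus  : ser2 := ser2D (ser2D ser2U ser2V) (ser2N (ser2C smxP)).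

(* reflection equation R(u-v)B1(u)R(u+v)B2(v) = B2(v)R(u+v)B1(u)R(u-v),
   multiplied by the central non-zero-divisor (u-v)(u+v) *)
Definition reflection_rel : Prop :=
  ser2_eq (ser2M (ser2M (ser2M Rminus B1) Rplus) B2)
          (ser2M (ser2M (ser2M B2 Rplus) B1) Rminus).

(* unitarity B(u)B(-u) = 1 in A (x) End V (super tensor product):
   coefficient of u^-N at E_iq *)
Definition unitary_coef (N : nat) (i q : 'I_kappa) : A :=
  \sum_(r < N.+1) \sum_(j < kappa)
     (-1) ^+ ((par i + par j) * (par j + par q))%N
     * Bcoef r i j * ((-1) ^+ (N - r) * Bcoef (N - r) j q).

Definition unitary_rel : Prop :=
  forall (N : nat) (i q : 'I_kappa),
    unitary_coef N i q = ((N == 0%N) && (i == q))%:R.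

End SuperMatrices.

Section Ideals.
Variable A : pzRingType.

Definition is_left_ideal (J : A -> Prop) : Prop :=
  [/\ J 0, (forall x y, J x -> J y -> J (x + y)) &
      (forall a x, J x -> J (a * x))].

Definition is_twosided_ideal (J : A -> Prop) : Prop :=
  is_left_ideal J /\ (forall a x, J x -> J (x * a)).

Definition gen_left_ideal (S : A -> Prop) (x : A) : Prop :=
  forall J, is_left_ideal J -> (forall y, S y -> J y) -> J x.

Definition gen_twosided_ideal (S : A -> Prop) (x : A) : Prop :=
  forall J, is_twosided_ideal J -> (forall y, S y -> J y) -> J x.
End Ideals.

(* The twisted super Yangian as a quotient of the free algebra           *)
(* K<b_ij^(r) : i,j, r>=1>; the generator index (i,j,r') stands for      *)
(* b_ij^(r'+1), so there are no spurious generators.                     *)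
Section Yangian.
Variable K : fieldType.
Variable kappa : nat.
Variable par : 'I_kappa -> bool.
Variable eps : 'I_kappa -> bool.

Definition gen_t : choiceType := ('I_kappa * 'I_kappa * nat)%type.
Definition FreeAlg : lalgType K := {malg K[{fmonom gen_t}]}.

(* bgen i j r = b_ij^(r) for r >= 1 (the value at r = 0 is never used: bser
   replaces it by delta_ij eps_i) *)
Definition bgen (i j : 'I_kappa) (r : nat) : FreeAlg := << fmu ((i, j, r.-1) : gen_t) >>.

Definition tsy_relators (x : FreeAlg) : Prop :=
  (exists (a b : int) i j k l,
     x = coef2 (ser2M par (ser2M par (ser2M par (Rminus FreeAlg par) (B1 par eps bgen))
                                 (Rplus FreeAlg par)) (B2 par eps bgen)) a b i j k l
       - coef2 (ser2M par (ser2M par (ser2M par (B2 par eps bgen) (Rplus FreeAlg par))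
                                 (B1 par eps bgen)) (Rminus FreeAlg par)) a b i j k l)
  \/ (exists N i q, x = unitary_coef par eps bgen N i q - ((N == 0%N) && (i == q))%:R).

Definition tsy_ideal (x : FreeAlg) : Prop := gen_twosided_ideal tsy_relators x.

(* mu : 'I_kappa -> nat -> K, mu i r = coefficient of u^-r in mu_i(u) *)
Variable mu : 'I_kappa -> nat -> K.

Definition verma_gens (x : FreeAlg) : Prop :=
  (exists (i j : 'I_kappa) r, (i < j)%N /\ x = bser eps bgen i j r)
  \/ (exists (i : 'I_kappa) r, x = bser eps bgen i i r - (mu i r)%:A).

(* preimage in the free algebra of the left ideal of B defining M(mu) *)
Definition verma_ideal (x : FreeAlg) : Prop :=
  gen_left_ideal (fun y => tsy_ideal y \/ verma_gens y) x.

(* M(mu) = B / (left ideal) is nontrivial iff 1 is not in that left ideal *)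
Definition verma_nontrivial : Prop := ~ verma_ideal 1.
End Yangian.

(* Formal Laurent series in u^-1 with finite positive part:             *)
(*   u^sh sum_{k>=0} f k u^-k                                          *)
Section Laurent.
Variable K : fieldType.

Record lser := Lser { lsh : nat; lcf : nat -> K }.

Definition lcoef (X : lser) (a : int) : K :=
  if a <= (lsh X)%:Z then lcf X `|(lsh X)%:Z - a|%N else 0.

Definition llift (X : lser) (e : nat) : lser :=
  Lser (lsh X + e) (fun k => if (e <= k)%N then lcf X (k - e) else 0).

Definition lD (X Y : lser) : lser :=
  let d := maxn (lsh X) (lsh Y) in
  Lser d (fun k => lcf (llift X (d - lsh X)) k + lcf (llift Y (d - lsh Y)) k).

Definition lZ (c : K) (X : lser) : lser := Lser (lsh X) (fun k => c * lcf X k).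

Definition lM (X Y : lser) : lser :=
  Lser (lsh X + lsh Y) (fun k => \sum_(j < k.+1) lcf X j * lcf Y (k - j)).

Definition l0 : lser := Lser 0 (fun _ => 0).
Definition l1 : lser := Lser 0 (fun k => (k == 0%N)%:R).
Definition lC (c : K) : lser := lZ c l1.
Definition lU : lser := Lser 1 (fun k => (k == 0%N)%:R).
Definition lpow (X : lser) (d : nat) : lser := iter d (lM X) l1.

Definition lps (f : nat -> K) : lser := Lser 0 f.

Definition lser_eq (X Y : lser) : Prop := forall a : int, lcoef X a = lcoef Y a.

(* (c - u)^-1 = - sum_{k>=1} c^(k-1) u^-k, a power series in u^-1 with
   vanishing constant term *)
Definition inv_c_minus_u (c : K) : nat -> K :=
  fun k => if k == 0%N then 0 else - c ^+ k.-1.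

(* substitution u |-> c - u in a power series f(u) = sum f_r u^-r :
   f(c - u) = sum_r f_r ((c - u)^-1)^r  (finite sum in each degree) *)
Definition psubst (c : K) (f : nat -> K) : nat -> K :=
  fun k => \sum_(r < k.+1) f r * lcf (lpow (lps (inv_c_minus_u c)) r) k.

Definition lsubst (c : K) (X : lser) : lser :=
  lM (lpow (lD (lC c) (lZ (-1) lU)) (lsh X)) (lps (psubst c (lcf X))).
End Laurent.

Section Conditions.
Variable K : fieldType.
Variable kappa : nat.
Variable par : 'I_kappa -> bool.
Variable mu : 'I_kappa -> nat -> K.

Definition mu_ser (i : 'I_kappa) : lser K := lps (mu i).

(* tilde mu_i(u) = (2u - rho_{i+1}) mu_i(u) + sum_{a > i} s_a mu_a(u)
   (paper's 1-based indices; here 0-based, so rho_{i+1} is rho par i.+1) *)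
Definition mu_tilde (i : 'I_kappa) : lser K :=
  lD (lM (lD (lZ 2 (lU K)) (lC (- rho par i.+1))) (mu_ser i))
     (\big[@lD K/l0 K]_(a < kappa | (i < a)%N) lZ (sgn par a) (mu_ser a)).
End Conditions.

(* Main.v *)
(* Put x = 1/u, y = 1/v.

   Necessity.  Let N be the left ideal defining the Verma module and beta_i(x, y)
   the (i, i) entry of B(u) B(v).  For i < a the (i, a; a, i) entry of the
   reflection equation expresses s_a (u^2 - v^2) b_ia(u) b_ai(v) modulo N through
   beta_i, the transpose of beta_a and the weights.  Summing over a shows, by
   downward induction on i, that beta_i is congruent to a scalar series C_i with
     (y - x)(x + y - rho_i xy) C_i
       = (x + y) W_i - xy (y - x) sum_(a > i) s_a C_a^T,
   where W_i is an antisymmetric polynomial in the weights, and that C_i is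
   symmetric.  Subtracting two consecutive equations gives
     (x + y)(W_i - W_j) = (y - x)(x + y - rho_i xy)(C_i - C_j),   j = i + 1.
   The substitution v = rho_i - u kills the right-hand side and leaves the
   required identity; when rho_i = 0 one first cancels x + y and uses the
   unitarity C_i(x, -x) = 1.

   Sufficiency.  If E satisfies the gl(m|n) relations and supercommutes with a
   solution B of the reflection equation and unitarity, so does
     (1 + E x) B (1 - E x)^-1.
   Starting from the constant solution diag(eps_i) and taking E_ij = psi_i phi_j
   for oscillators acting on Fock space, with vacuum as highest weight vector, one
   realizes many weights.  Under one such dressing the series
     F_i = (2 - rho_i x) mu_i + x sum_(a > i) s_a mu_a
   are multiplied by explicit rational factors.  By Hilbert 90 for x -> -x/(1 - c x)
   and since C is algebraically closed, every weight satisfying the conditions is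
   reached modulo an arbitrary power of x by finitely many dressings; this is
   enough, because membership of 1 in the left ideal involves only finitely many
   coefficients of the weight. *)
Require Import Defs.
From Stdlib Require Import Ncring Ncring_tac.
From HB Require Import structures.
From mathcomp Require Import all_boot all_order all_algebra.
From mathcomp Require Import reals.
From mathcomp Require Import complex.
From mathcomp Require Import monalg.
From mathcomp Require Import boolp ring zify.

Set Implicit Arguments.
Unset Strict Implicit.
Unset Printing Implicit Defensive.

Import GRing.Theory Num.Theory.
Local Open Scope ring_scope.

(** * Formal power series *)

(** Dressing is the action of a Yangian on reflection algebras: [1 + E x] solves the RTT relation,
    and [B] is multiplied on the left by this factor and on the right by its inverse at [-x]. One
    dressing multiplies F_i by (1 + l_i x) phi_i, where the l_i are the weights of [E]. Write sig
    for the substitution u -> rho_i - u. The product phi_i sig(1 + l_i x) is the same for i and i +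
    1, with rho_i kept fixed, and it is 1 at the last index. This is where Hilbert 90 comes from:
    once the phi_i are eliminated, reaching a weight means solving q g = p sig(g) for g, and the
    solvability condition p sig(p) = q sig(q) is the condition on the weight.

    The two implications meet in one expression. With t the sum of s_a mu_a over a > i, both F_i and
    F_(i+1) have the form (2 - rho_i x) m + x t, for m = mu_i and m = mu_(i+1). Hence the condition
    compares (2 - rho_i x) m sig(m) + x (t sig(m) - m sig(t)) for these two m, and up to a unit and
    a factor x this is the value of W at v = rho_i - u. *)

Definition ser (R : Type) := nat -> R.

Section SerZmod.
Variable V : zmodType.

HB.instance Definition _ := gen_eqMixin (ser V).
HB.instance Definition _ := gen_choiceMixin (ser V).

Definition ser_zero : ser V := fun=> 0.
Definition ser_add (f g : ser V) : ser V := fun n => f n + g n.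
Definition ser_opp (f : ser V) : ser V := fun n => - f n.

Lemma ser_addA : associative ser_add.
Proof. by move=> f g h; apply: funext => n; exact: addrA. Qed.
Lemma ser_addC : commutative ser_add.
Proof. by move=> f g; apply: funext => n; exact: addrC. Qed.
Lemma ser_add0 : left_id ser_zero ser_add.
Proof. by move=> f; apply: funext => n; exact: add0r. Qed.
Lemma ser_addN : left_inverse ser_zero ser_opp ser_add.
Proof. by move=> f; apply: funext => n; exact: addNr. Qed.

HB.instance Definition _ :=
  GRing.isZmodule.Build (ser V) ser_addA ser_addC ser_add0 ser_addN.

Lemma ser_addE (f g : ser V) n : (f + g) n = f n + g n. Proof. by []. Qed.
Lemma ser_oppE (f : ser V) n : (- f) n = - f n. Proof. by []. Qed.
Lemma ser_subE (f g : ser V) n : (f - g) n = f n - g n. Proof. by []. Qed.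
Lemma ser_zeroE n : (0 : ser V) n = 0. Proof. by []. Qed.
Lemma ser_sumE I (r : seq I) (P : pred I) (F : I -> ser V) n :
  (\sum_(i <- r | P i) F i) n = \sum_(i <- r | P i) F i n.
Proof. by elim/big_rec2: _ => // i x y _ <-. Qed.
End SerZmod.

Section TriangularSums.
Variable V : zmodType.
Lemma sum_triangle (F : nat -> nat -> V) n :
  \sum_(k < n.+1) \sum_(i < k.+1) F i (k - i)%N =
  \sum_(i < n.+1) \sum_(j < (n - i).+1) F i j.
Proof.
elim: n => [|n IH]; first by rewrite !big_ord1.
rewrite big_ord_recr IH /= [RHS]big_ord_recr /= subnn big_ord1.
rewrite [X in _ + X]big_ord_recr /= subnn addrA; congr (_ + _).
rewrite -big_split /=; apply: eq_bigr => i _.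
have le_in : (i <= n)%N := ltn_ord i; by rewrite subSn // [RHS]big_ord_recr.
Qed.
End TriangularSums.

Section SerRing.
Variable R : pzRingType.
Implicit Types f g h : ser R.

Definition ser_one : ser R := fun n => (n == 0%N)%:R.
Definition ser_mul f g : ser R := fun n => \sum_(i < n.+1) f i * g (n - i)%N.

Lemma ser_mulA : associative ser_mul.
Proof.
move=> f g h; apply: funext => n; rewrite /ser_mul.
pose F i j := f i * g j * h (n - (i + j))%N.
transitivity (\sum_(i < n.+1) \sum_(j < (n - i).+1) F i j).
  by apply: eq_bigr => i _; rewrite big_distrr /=; apply: eq_bigr => j _;
    rewrite /F subnDA mulrA.
rewrite -(sum_triangle F); apply: eq_bigr => k _; rewrite big_distrl /=.
by apply: eq_bigr => i _; rewrite /F subnKC // -ltnS.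
Qed.
Lemma ser_mul1 : left_id ser_one ser_mul.
Proof.
move=> f; apply: funext => n; rewrite /ser_mul big_ord_recl /= mul1r subn0.
by rewrite big1 ?addr0 // => i _; rewrite mul0r.
Qed.
Lemma ser_mulr1 : right_id ser_one ser_mul.
Proof.
move=> f; apply: funext => n; rewrite /ser_mul big_ord_recr /= subnn mulr1.
rewrite big1 ?add0r // => i _; rewrite /ser_one subn_eq0 leqNgt ltn_ord.
by rewrite mulr0.
Qed.
Lemma ser_mulDl : left_distributive ser_mul +%R.
Proof.
move=> f g h; apply: funext => n; rewrite /ser_mul /= ser_addE -big_split.
by apply: eq_bigr => i _; rewrite ser_addE mulrDl.
Qed.
Lemma ser_mulDr : right_distributive ser_mul +%R.
Proof.
move=> f g h; apply: funext => n; rewrite /ser_mul /= ser_addE -big_split.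
by apply: eq_bigr => i _; rewrite ser_addE mulrDr.
Qed.

HB.instance Definition _ := GRing.Zmodule_isPzRing.Build (ser R)
  ser_mulA ser_mul1 ser_mulr1 ser_mulDl ser_mulDr.

Lemma ser_mulE f g n : (f * g) n = \sum_(i < n.+1) f i * g (n - i)%N.
Proof. by []. Qed.
Lemma ser_oneE n : (1 : ser R) n = (n == 0%N)%:R. Proof. by []. Qed.
Lemma ser_mul0E f g : (f * g) 0%N = f 0%N * g 0%N.
Proof. by rewrite ser_mulE big_ord1. Qed.

Definition serC (a : R) : ser R := fun n => if n == 0%N then a else 0.
Lemma serC_is_additive : additive serC.
Proof. by move=> a b; apply: funext => -[|n] //=; rewrite ser_subE /= subr0. Qed.
HB.instance Definition _ := GRing.isAdditive.Build R (ser R) serC serC_is_additive.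
Lemma serC_mulE a f n : (serC a * f) n = a * f n.
Proof.
rewrite ser_mulE big_ord_recl /= subn0 big1 ?addr0 // => i _.
by rewrite mul0r.
Qed.
Lemma ser_mulCE a f n : (f * serC a) n = f n * a.
Proof.
rewrite ser_mulE big_ord_recr /= subnn big1 ?add0r // => i _.
by rewrite /serC subn_eq0 leqNgt ltn_ord mulr0.
Qed.
Lemma serC_is_multiplicative : multiplicative serC.
Proof.
split => [a b|]; apply: funext => n; last by rewrite /serC ser_oneE; case: n.
by rewrite serC_mulE /serC; case: n => //= n; rewrite mulr0.
Qed.
HB.instance Definition _ :=
  GRing.isMultiplicative.Build R (ser R) serC serC_is_multiplicative.

Definition serX : ser R := fun n => (n == 1%N)%:R.
Lemma serX_mulE f n : (serX * f) n = if n is n'.+1 then f n' else 0.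
Proof.
rewrite ser_mulE; case: n => [|n]; first by rewrite big_ord1 mul0r.
rewrite big_ord_recl mul0r add0r big_ord_recl /= mul1r subSS subn0.
by rewrite big1 ?addr0 // => i _; rewrite mul0r.
Qed.
Lemma ser_mulXE f n : (f * serX) n = if n is n'.+1 then f n' else 0.
Proof.
rewrite ser_mulE; case: n => [|n]; first by rewrite big_ord1 mulr0.
rewrite big_ord_recr /= subnn mulr0 addr0 big_ord_recr /= subSnn mulr1.
rewrite big1 ?add0r // => i _; rewrite /serX.
by rewrite eqn_leq subn_gt0 leq_subLR addn1 ltnS leqNgt ltn_ord mulr0.
Qed.
Lemma serX_comm f : serX * f = f * serX.
Proof. by apply: funext => n; rewrite serX_mulE ser_mulXE. Qed.
End SerRing.
Arguments serX {R}.

Lemma ser_oner_neq0 (R : nzRingType) : (1 : ser R) != 0.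
Proof.
apply/eqP => /(congr1 (fun f : ser R => f 0%N)) /eqP.
by rewrite ser_oneE ser_zeroE oner_eq0.
Qed.
HB.instance Definition _ (R : nzRingType) :=
  GRing.PzSemiRing_isNonZero.Build (ser R) (ser_oner_neq0 R).

Lemma ser_signM (R : pzRingType) m (f : ser R) n :
  ((-1) ^+ m * f) n = (-1) ^+ m * f n.
Proof.
elim: m f => [|m IH] f; first by rewrite !mul1r.
by rewrite !exprS -!mulrA !mulN1r ser_oppE IH.
Qed.

Section SerMap.
Variables (R S : pzRingType) (phi : {rmorphism R -> S}).
Definition ser_map (f : ser R) : ser S := fun n => phi (f n).
Lemma ser_map_is_additive : additive ser_map.
Proof. by move=> f g; apply: funext => n; exact: rmorphB. Qed.
HB.instance Definition _ :=
  GRing.isAdditive.Build (ser R) (ser S) ser_map ser_map_is_additive.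
Lemma ser_map_is_multiplicative : multiplicative ser_map.
Proof.
split=> [f g|]; apply: funext => n; last exact: rmorph_nat.
by rewrite ser_mulE /ser_map rmorph_sum /=; apply: eq_bigr => i _; exact: rmorphM.
Qed.
HB.instance Definition _ := GRing.isMultiplicative.Build (ser R) (ser S) ser_map
  ser_map_is_multiplicative.
End SerMap.

Section SerCom.
Variable R : comNzRingType.
Lemma ser_mulC : @commutative (ser R) (ser R) *%R.
Proof.
move=> f g; apply: funext => n; rewrite !ser_mulE [LHS](reindex_inj rev_ord_inj) /=.
by apply: eq_bigr => i _; rewrite subSS mulrC subKn // -ltnS.
Qed.
HB.instance Definition _ := GRing.PzRing_hasCommutativeMul.Build (ser R) ser_mulC.
End SerCom.

(** * Matrices over two copies of End V *)

(** Block matrices: [X i j k l] belongs to [E_ij] in the first and [E_kl] in the second tensor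
    factor. Products are ordinary matrix products, without a sign rule. *)
Notation mm A kappa := 'M['M[A]_kappa]_kappa.

Lemma sign_odd (A : pzRingType) m n : odd m = odd n -> (-1) ^+ m = (-1) ^+ n :> A.
Proof. by move=> e; rewrite -signr_odd e signr_odd. Qed.

Section DoubleMatrices.
Variables (A : pzRingType) (kappa : nat) (par : 'I_kappa -> bool).
Local Notation M2 := (mm A kappa).
Implicit Types (X Y : M2) (M N : 'M[A]_kappa).

Lemma mmP X Y : (forall i j k l, X i j k l = Y i j k l) -> X = Y.
Proof. by move=> e; apply/matrixP=> i j; apply/matrixP=> k l. Qed.

Lemma mmM X Y i j k l :
  (X * Y) i j k l = \sum_a \sum_b X i a k b * Y a j b l.
Proof.
by rewrite mxE summxE; apply: eq_bigr => a _; rewrite mxE.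
Qed.

Lemma mmD X Y i j k l : (X + Y) i j k l = X i j k l + Y i j k l.
Proof. by rewrite !mxE. Qed.
Lemma mmB X Y i j k l : (X - Y) i j k l = X i j k l - Y i j k l.
Proof. by rewrite !mxE. Qed.

Lemma mm1E i j k l : (1 : M2) i j k l = ((i == j) && (k == l))%:R.
Proof. by rewrite mxE; case: eqP; rewrite /= ?mulr1n ?mulr0n mxE. Qed.

(** The super flip [P]. The signs of the super tensor product survive only here and, through
    conjugation by [sw], in [on1]. *)
Definition sw : M2 := \matrix_(i, j) \matrix_(k, l)
  ((-1) ^+ (par i * par k) *+ ((k == j) && (l == i))).

Definition on2 M : M2 := M%:M.
Definition on1 M : M2 := sw * on2 M * sw.

Lemma sum_swl i k (F : 'I_kappa -> 'I_kappa -> A) :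
  \sum_a \sum_b sw i a k b * F a b = (-1) ^+ (par i * par k) * F k i.
Proof.
rewrite (bigD1 k) //= (bigD1 i) //= !mxE !eqxx /= mulr1n.
rewrite !big1 ?addr0 // => [a nak|b nbi].
  by rewrite big1 // => b _; rewrite !mxE eq_sym (negPf nak) mulr0n mul0r.
by rewrite !mxE (negPf nbi) andbF mulr0n mul0r.
Qed.

Lemma sum_swr j l (F : 'I_kappa -> 'I_kappa -> A) :
  \sum_a \sum_b F a b * sw a j b l = F l j * (-1) ^+ (par l * par j).
Proof.
rewrite (bigD1 l) //= (bigD1 j) //= !mxE !eqxx /= mulr1n.
rewrite !big1 ?addr0 // => [a nal|b nbj].
  by rewrite big1 // => b _; rewrite !mxE [l == _]eq_sym (negPf nal) andbF mulr0n mulr0.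
by rewrite !mxE (negPf nbj) mulr0n mulr0.
Qed.

Lemma swMl X i j k l :
  (sw * X) i j k l = (-1) ^+ (par i * par k) * X k j i l.
Proof. by rewrite mmM (sum_swl i k (fun a b => X a j b l)). Qed.

Lemma swMr X i j k l :
  (X * sw) i j k l = X i l k j * (-1) ^+ (par l * par j).
Proof. by rewrite mmM (sum_swr j l (fun a b => X i a k b)). Qed.

Lemma on2E M i j k l : on2 M i j k l = M k l *+ (i == j).
Proof. by rewrite mxE; case: eqP; rewrite ?mxE. Qed.

Lemma on1E M i j k l :
  on1 M i j k l = (-1) ^+ (par k * (par i + par j)) * M i j *+ (k == l).
Proof.
rewrite swMr swMl on2E; case: eqP => [->|_]; last by rewrite !mulr0n mulr0 mul0r.
rewrite !mulr1n [LHS]commr_sign mulrA -exprD; congr (_ * _).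
by apply: sign_odd; case: (par i) (par j) (par l) => [] [] [].
Qed.

Lemma sw_invol : sw * sw = 1.
Proof.
apply: mmP => i j k l; rewrite swMl mm1E !mxE.
rewrite [l == k]eq_sym; case: andP => [_|_]; last by rewrite mulr0.
by rewrite [(par k * _)%N]mulnC mulr1n -expr2 sqrr_sign.
Qed.

Lemma on2_is_additive : additive on2.
Proof. by move=> M N; rewrite /on2 raddfB. Qed.
Lemma on2M M N : on2 (M * N) = on2 M * on2 N.
Proof. exact: scalar_mxM. Qed.
Lemma on21 : on2 1%:M = 1. Proof. by []. Qed.
Lemma on1M M N : on1 (M * N) = on1 M * on1 N.
Proof.
by rewrite /on1 on2M !mulrA -(mulrA _ sw sw) sw_invol mulr1.
Qed.
Lemma on11 : on1 1%:M = 1. Proof. by rewrite /on1 on21 mulr1 sw_invol. Qed.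
HB.instance Definition _ := GRing.isAdditive.Build _ M2 on2 on2_is_additive.
Lemma on1_is_additive : additive on1.
Proof. by move=> M N; rewrite /on1 raddfB /= mulrBr mulrBl. Qed.
HB.instance Definition _ := GRing.isAdditive.Build _ M2 on1 on1_is_additive.

Lemma on1D M N : on1 (M + N) = on1 M + on1 N. Proof. exact: raddfD. Qed.
Lemma on1B M N : on1 (M - N) = on1 M - on1 N. Proof. exact: raddfB. Qed.
Lemma on2D M N : on2 (M + N) = on2 M + on2 N. Proof. exact: raddfD. Qed.
Lemma on2B M N : on2 (M - N) = on2 M - on2 N. Proof. exact: raddfB. Qed.

Lemma sw_on1 M : sw * on1 M = on2 M * sw.
Proof. by rewrite /on1 !mulrA sw_invol mul1r. Qed.
Lemma sw_on2 M : sw * on2 M = on1 M * sw.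
Proof. by rewrite /on1 -mulrA sw_invol mulr1. Qed.

Lemma sw_conj12 M N : sw * (on1 M * on2 N) * sw = on2 M * on1 N.
Proof. by rewrite mulrA sw_on1 /on1 !mulrA. Qed.
Lemma sw_conj21 M N : sw * (on2 N * on1 M) * sw = on1 N * on2 M.
Proof. by rewrite mulrA sw_on2 -(mulrA (on1 N)) sw_on1 mulrA -mulrA sw_invol mulr1. Qed.
Lemma on21_comm M N : on1 M * on2 N = on2 N * on1 M -> on2 M * on1 N = on1 N * on2 M.
Proof. by move=> e; rewrite -sw_conj12 e sw_conj21. Qed.

Lemma mul_on12 M N i j k l : (on1 M * on2 N) i j k l =
    (-1) ^+ (par k * (par i + par j)) * (M i j * N k l).
Proof.
rewrite mmM (bigD1 j) //= (bigD1 k) //= on1E on2E !eqxx !mulr1n.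
rewrite !big1 ?addr0 ?mulrA // => [a naj|b nbk].
  by rewrite big1 // => b _; rewrite on2E (negPf naj) mulr0n mulr0.
by rewrite on1E eq_sym (negPf nbk) mul0r.
Qed.
Lemma mul_on21 M N i j k l : (on2 N * on1 M) i j k l =
    (-1) ^+ (par l * (par i + par j)) * (N k l * M i j).
Proof.
rewrite mmM (bigD1 i) //= (bigD1 l) //= on1E on2E !eqxx !mulr1n.
rewrite !big1 ?addr0 => [|a nai|b nbl].
- by rewrite mulrA (commr_sign (N k l)) -mulrA.
- by rewrite big1 // => b _; rewrite on2E eq_sym (negPf nai) mul0r.
by rewrite on1E (negPf nbl) mulr0n mulr0.
Qed.

(** Commutation of the two block matrices encodes supercommutation of the entries, the entry (i, j)
    having parity |i| + |j|. *)
Lemma on12_comm M N :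
  (on1 M * on2 N = on2 N * on1 M) <->
  (forall i j k l, (-1) ^+ (par k * (par i + par j)) * (M i j * N k l) =
                   (-1) ^+ (par l * (par i + par j)) * (N k l * M i j)).
Proof.
split=> [e i j k l|e]; first by rewrite -mul_on12 -mul_on21 e.
by apply: mmP => i j k l; rewrite mul_on12 mul_on21.
Qed.
End DoubleMatrices.

(** * The defining relations as matrix identities *)

Lemma exchange_big4 (V : nmodType) (I J K L : finType) (F : I -> J -> K -> L -> V) :
  \sum_i \sum_j \sum_k \sum_l F i j k l = \sum_k \sum_l \sum_i \sum_j F i j k l.
Proof.
rewrite pair_bigA [RHS]pair_bigA /=.
under eq_bigr do rewrite pair_bigA /=.
by rewrite exchange_big; apply: eq_bigr => p _ /=; rewrite [RHS]pair_bigA.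
Qed.

Section Conversion.
Variables (A : pzRingType) (kappa : nat) (par : 'I_kappa -> bool).
Local Notation SA := (ser (ser A)).
Local Notation M2 := (mm SA kappa).

(* The sign rule of the super tensor product is the coboundary of twist, so
   rescaling by it turns smxM into the ordinary product of block matrices. *)
Definition twist (i j k l : 'I_kappa) : nat :=
  ((par i + par k) * (par j + par l) + (par j + par l) + (par k + par l) * par j)%N.

(** The leading monomial u^sh1 v^sh2 is divided out. What remains is a power series whose outer
    variable is x = 1/u and whose inner variable is y = 1/v. *)
Definition mm_of (X : ser2 A kappa) : M2 := \matrix_(i, j) \matrix_(k, l)
  (fun r t => (-1) ^+ twist i j k l * cf X r t i j k l).

Lemma mm_ofE X i j k l r t :
  mm_of X i j k l r t = (-1) ^+ twist i j k l * cf X r t i j k l.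
Proof. by rewrite !mxE. Qed.

Lemma smx_sumE (F : nat -> smx A kappa) N i j k l :
  smx_sum F N i j k l = \sum_(r < N) F r i j k l.
Proof. exact: (big_morph (fun X : smx A kappa => X i j k l)). Qed.

Lemma mm_ofM (X Y : ser2 A kappa) : mm_of (ser2M par X Y) = mm_of X * mm_of Y.
Proof.
apply: mmP => i q k s; apply: funext => r; apply: funext => t.
rewrite mm_ofE /= smx_sumE.
transitivity (\sum_(r1 < r.+1) \sum_(t1 < t.+1) \sum_j \sum_l
    mm_of X i j k l r1 t1 * mm_of Y j q l s (r - r1)%N (t - t1)%N).
  rewrite big_distrr; apply: eq_bigr => r1 _ /=.
  rewrite smx_sumE big_distrr; apply: eq_bigr => t1 _ /=.
  rewrite /smxM big_distrr; apply: eq_bigr => j _ /=.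
  rewrite big_distrr; apply: eq_bigr => l _ /=.
  rewrite !mm_ofE [RHS]mulrA [X in _ = X * _]commr_sign !mulrA -!exprD.
  congr (_ * _ * _); apply: sign_odd; rewrite /twist.
  by case: (par i) (par j) (par k) (par l) (par q) (par s) =>
    [] [] [] [] [] [].
rewrite exchange_big4 mmM !ser_sumE; apply: eq_bigr => j _.
rewrite !ser_sumE; apply: eq_bigr => l _.
by rewrite ser_mulE ser_sumE; apply: eq_bigr => r1 _; rewrite ser_mulE.
Qed.

Definition vx : SA := serX.
Definition vy : SA := serC serX.
Definition cen (z : SA) : M2 := z%:M%:M.
Local Notation cx := (ser_map (@serC A)).
Local Notation cy := (@serC (ser A)).

Lemma cenE z i j k l : cen z i j k l = z *+ ((i == j) && (k == l)).
Proof. by rewrite mxE; case: eqP => _; rewrite mxE ?mulr0n ?mulr1n. Qed.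

Lemma cenM_E z X i j k l : (cen z * X) i j k l = z * X i j k l.
Proof. by rewrite /cen -[_ * X]/(_ *m X) mul_scalar_mx mxE -[_ * X i j]/(_ *m X i j) mul_scalar_mx mxE. Qed.

Lemma vxy_coef r t : (vx * vy) r t = ((r == 1%N) && (t == 1%N))%:R.
Proof.
by rewrite serX_mulE; case: r => [|[|r]] //=.
Qed.

(** This is (u - v) - P divided by u v; similarly [Rplus_mx] is (u + v) - P divided by u v. *)
Definition Rminus_mx : M2 := cen (vy - vx) - cen (vx * vy) * sw SA par.
Definition Rplus_mx : M2 := cen (vx + vy) - cen (vx * vy) * sw SA par.

Lemma sw_const i j k l :
  sw SA par i j k l = serC (serC ((-1) ^+ twist i j k l * smxP A par i j k l)).
Proof.
rewrite !mxE /smxP /sgn; case: andP => [[/eqP-> /eqP->]|_]; last first.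
  by rewrite mul0r mulr0 !raddf0.
rewrite mul1r mulr1n -exprD !rmorph_sign; apply: sign_odd; rewrite /twist.
by case: (par i) (par j) => [] [].
Qed.

Lemma twist_diag i j k l : (i == j) && (k == l) ->
  (-1) ^+ twist i j k l = 1 :> A.
Proof.
case/andP => /eqP<- /eqP<-; apply: (@sign_odd A _ 0); rewrite /twist.
by case: (par i) (par k) => [] [].
Qed.

Lemma mm_of_Rminus : mm_of (Rminus A par) = Rminus_mx.
Proof.
apply: mmP => i j k l; apply: funext => r; apply: funext => t.
rewrite mm_ofE.
have -> : Rminus_mx i j k l = (vy - vx) *+ ((i == j) && (k == l)) - vx * vy * sw SA par i j k l.
  by rewrite mmB cenE cenM_E.
rewrite sw_const !ser_subE (ser_mulCE _ (vx * vy)) (ser_mulCE _ ((vx * vy) r)) vxy_coef.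
set p := smxP _ _ _ _ _ _; rewrite /vx /vy.
case: (boolP ((i == j) && (k == l))) => [e|/negPf e].
  rewrite (twist_diag e) mulr1n !ser_subE.
  by case: r t => [|[|r]] [|[|t]];
    rewrite /= /smxD /smxN /smx0 /smx1 ?e /serC /serX /= -/p
      ?(mul0r, mul1r, subr0, sub0r, addr0, add0r, mulr0, mulrN, oppr0, mulr1).
rewrite mulr0n !ser_zeroE sub0r.
by case: r t => [|[|r]] [|[|t]];
  rewrite /= /smxD /smxN /smx0 /smx1 ?e /= -/p
    ?(mul0r, mul1r, subr0, sub0r, addr0, add0r, mulr0, mulrN, oppr0, mulr1).
Qed.

Lemma mm_of_Rplus : mm_of (Rplus A par) = Rplus_mx.
Proof.
apply: mmP => i j k l; apply: funext => r; apply: funext => t.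
rewrite mm_ofE.
have -> : Rplus_mx i j k l = (vx + vy) *+ ((i == j) && (k == l)) - vx * vy * sw SA par i j k l.
  by rewrite mmB cenE cenM_E.
rewrite sw_const !ser_subE (ser_mulCE _ (vx * vy)) (ser_mulCE _ ((vx * vy) r)) vxy_coef.
set p := smxP _ _ _ _ _ _; rewrite /vx /vy.
case: (boolP ((i == j) && (k == l))) => [e|/negPf e].
  rewrite (twist_diag e) mulr1n !ser_addE.
  by case: r t => [|[|r]] [|[|t]];
    rewrite /= /smxD /smxN /smx0 /smx1 ?e /serC /serX /= -/p
      ?(mul0r, mul1r, subr0, sub0r, addr0, add0r, mulr0, mulrN, oppr0, mulr1).
rewrite mulr0n !ser_zeroE sub0r.
by case: r t => [|[|r]] [|[|t]];
  rewrite /= /smxD /smxN /smx0 /smx1 ?e /= -/p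
    ?(mul0r, mul1r, subr0, sub0r, addr0, add0r, mulr0, mulrN, oppr0, mulr1).
Qed.

Variables (eps : 'I_kappa -> bool) (b : 'I_kappa -> 'I_kappa -> nat -> A).
Definition bmat : 'M[ser A]_kappa := \matrix_(i, j) (bser eps b i j : ser A).

Lemma mm_of_B2 : mm_of (B2 par eps b) = on2 (map_mx cy bmat).
Proof.
apply: mmP => i j k l; apply: funext => r; apply: funext => t.
rewrite mm_ofE on2E !mxE /=.
case: r => [|r] /=; last by rewrite /smx0 mulr0; case: eqP => _; rewrite ?mulr1n ?mulr0n.
case: eqP => [->|_]; last by rewrite mulr0n mul0r mulr0.
rewrite mulr1n mul1r /Bcoef mulrA -exprD -[RHS]mul1r; congr (_ * _).
by apply: (@sign_odd A _ 0); rewrite /twist; case: (par k) (par l) (par j) => [] [] [].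
Qed.

Lemma mm_of_B1 : mm_of (B1 par eps b) = on1 par (map_mx cx bmat).
Proof.
apply: mmP => i j k l; apply: funext => r; apply: funext => t.
rewrite mm_ofE on1E !mxE mulrb /= /ser_map.
case: t => [|t] /=; last first.
  by rewrite /smx0 mulr0; case: eqP => _ //; rewrite !ser_signM mulr0.
case: eqP => [->|_]; last by rewrite mul0r mulr0.
rewrite !ser_signM.
rewrite mul1r /Bcoef mulrA -exprD; congr (_ * _).
by apply: sign_odd; rewrite /twist; case: (par i) (par l) (par j) => [] [] [].
Qed.

Definition refl_lhs (B : 'M[ser A]_kappa) :=
  Rminus_mx * on1 par (map_mx cx B) * Rplus_mx * on2 (map_mx cy B).
Definition refl_rhs (B : 'M[ser A]_kappa) :=
  on2 (map_mx cy B) * Rplus_mx * on1 par (map_mx cx B) * Rminus_mx.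

Definition reflection_relator (a c : int) i j k l : A :=
  coef2 (ser2M par (ser2M par (ser2M par (Rminus A par) (B1 par eps b))
                               (Rplus A par)) (B2 par eps b)) a c i j k l
  - coef2 (ser2M par (ser2M par (ser2M par (B2 par eps b) (Rplus A par))
                               (B1 par eps b)) (Rminus A par)) a c i j k l.

(** Each side of the reflection equation has two R-factors, each of degree 1 in u and in v; this is
    the origin of the shift by 2. *)
Lemma coef2_shift (X : ser2 A kappa) r t : sh1 X = 2 -> sh2 X = 2 ->
  coef2 X (2%:Z - r%:Z) (2%:Z - t%:Z) = cf X r t.
Proof.
by move=> e1 e2; rewrite /coef2 e1 e2 !lerBlDr !lerDl /= !subKr.
Qed.

Lemma coef2_out (X : ser2 A kappa) a c : sh1 X = 2 -> sh2 X = 2 ->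
  ~~ ((a <= 2%:Z) && (c <= 2%:Z)) -> coef2 X a c = smx0 A (kappa:=kappa).
Proof. by move=> e1 e2 /negPf h; rewrite /coef2 e1 e2 h. Qed.

Lemma refl_coefE i j k l r t : (refl_lhs bmat - refl_rhs bmat) i j k l r t =
  (-1) ^+ twist i j k l * reflection_relator (2%:Z - r%:Z) (2%:Z - t%:Z) i j k l.
Proof.
rewrite /refl_lhs /refl_rhs -mm_of_Rminus -mm_of_Rplus -mm_of_B1 -mm_of_B2 -!mm_ofM.
rewrite mmB !ser_subE !mm_ofE -mulrBr /reflection_relator.
by rewrite !coef2_shift.
Qed.

Lemma reflection_relator0 : refl_lhs bmat = refl_rhs bmat ->
  forall a c i j k l, reflection_relator a c i j k l = 0.
Proof.
move=> e a c i j k l.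
have [/andP[ha hc]|h] := boolP ((a <= 2%:Z) && (c <= 2%:Z)); last first.
  by rewrite /reflection_relator !coef2_out // subrr.
have [r er] : exists r : nat, a = 2%:Z - r%:Z.
  by exists `|2%:Z - a|%N; rewrite gez0_abs ?subr_ge0 // opprB addrC subrK.
have [t et] : exists t : nat, c = 2%:Z - t%:Z.
  by exists `|2%:Z - c|%N; rewrite gez0_abs ?subr_ge0 // opprB addrC subrK.
have := refl_coefE i j k l r t; rewrite e subrr -er -et => /(congr1 (fun x => (-1) ^+ twist i j k l * x)).
by rewrite mulrA -expr2 sqrr_sign mul1r => <-; rewrite !mxE mulr0.
Qed.

(** The signs of the super product depend on the inner index j only in appearance: they combine into
    one sign determined by i and q. *)
Lemma unitary_coefE N i q : unitary_coef par eps b N i q =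
  (-1) ^+ (par i * par q + par q) *
  \sum_(r < N.+1) \sum_j bser eps b i j r * ((-1) ^+ (N - r) * bser eps b j q (N - r)).
Proof.
rewrite /unitary_coef big_distrr; apply: eq_bigr => r _ /=.
rewrite big_distrr; apply: eq_bigr => j _ /=.
rewrite /Bcoef !mulrA; congr (_ * _).
rewrite [LHS]commr_sign !mulrA -!exprD; congr (_ * _ * _).
by apply: sign_odd; case: (par i) (par j) (par q) => [] [] [].
Qed.
End Conversion.

(** * Transport of the defining relations along ring homomorphisms *)

Section Naturality.
Variables (A A' : pzRingType) (phi : {rmorphism A -> A'}).
Variables (kappa : nat) (par : 'I_kappa -> bool).

Definition ser2_map (X : ser2 A kappa) : ser2 A' kappa :=
  Ser2 (sh1 X) (sh2 X) (fun r t i j k l => phi (cf X r t i j k l)).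

Lemma ser2_eqP (X Y : ser2 A' kappa) : sh1 X = sh1 Y -> sh2 X = sh2 Y ->
  (forall r t i j k l, cf X r t i j k l = cf Y r t i j k l) -> X = Y.
Proof.
case: X Y => [a c F] [a' c' F'] /= -> -> e; congr Ser2.
by do 6 (apply: funext => ?).
Qed.

Lemma ser2_mapM X Y :
  ser2_map (ser2M par X Y) = ser2M par (ser2_map X) (ser2_map Y).
Proof.
apply: ser2_eqP => // r t i j k l /=.
rewrite !smx_sumE rmorph_sum; apply: eq_bigr => r1 _.
rewrite !smx_sumE rmorph_sum; apply: eq_bigr => t1 _.
rewrite /smxM rmorph_sum; apply: eq_bigr => j1 _.
rewrite rmorph_sum; apply: eq_bigr => l1 _.
by rewrite !rmorphM rmorph_sign.
Qed.

Lemma ser2_mapD X Y : ser2_map (ser2D X Y) = ser2D (ser2_map X) (ser2_map Y).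
Proof.
apply: ser2_eqP => // r t i j k l /=; rewrite /smxD rmorphD.
by congr (_ + _); case: ifP => // _; rewrite /smx0 rmorph0.
Qed.

Lemma ser2_mapN X : ser2_map (ser2N X) = ser2N (ser2_map X).
Proof. by apply: ser2_eqP => // r t i j k l /=; rewrite /smxN rmorphN. Qed.

Lemma ser2_mapU : ser2_map (ser2U A kappa) = ser2U A' kappa.
Proof.
by apply: ser2_eqP => // r t i j k l /=; case: ifP => _; rewrite /smx0 /smx1 ?rmorph0 ?rmorph_nat.
Qed.

Lemma ser2_mapV : ser2_map (ser2V A kappa) = ser2V A' kappa.
Proof.
by apply: ser2_eqP => // r t i j k l /=; case: ifP => _; rewrite /smx0 /smx1 ?rmorph0 ?rmorph_nat.
Qed.

Lemma ser2_mapP : ser2_map (ser2C (smxP A par)) = ser2C (smxP A' par).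
Proof.
apply: ser2_eqP => // r t i j k l /=; case: ifP => _; rewrite /smx0 ?rmorph0 //.
by rewrite /smxP /sgn rmorphM rmorph_nat rmorph_sign.
Qed.

Variables (eps : 'I_kappa -> bool) (b : 'I_kappa -> 'I_kappa -> nat -> A).
Let b' i j r := phi (b i j r).

Lemma bser_map i j r : phi (bser eps b i j r) = bser eps b' i j r.
Proof. by rewrite /bser; case: eqP => //; rewrite rmorphM rmorph_nat rmorph_sign. Qed.

Lemma Bcoef_map r i j : phi (Bcoef par eps b r i j) = Bcoef par eps b' r i j.
Proof. by rewrite /Bcoef rmorphM rmorph_sign bser_map. Qed.

Lemma ser2_mapB1 : ser2_map (B1 par eps b) = B1 par eps b'.
Proof.
apply: ser2_eqP => // r t i j k l /=; case: ifP => _; rewrite /smx0 ?rmorph0 //.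
by rewrite rmorphM rmorph_nat Bcoef_map.
Qed.

Lemma ser2_mapB2 : ser2_map (B2 par eps b) = B2 par eps b'.
Proof.
apply: ser2_eqP => // r t i j k l /=; case: ifP => _; rewrite /smx0 ?rmorph0 //.
by rewrite rmorphM rmorph_nat Bcoef_map.
Qed.

Lemma coef2_map X a c i j k l :
  phi (coef2 X a c i j k l) = coef2 (ser2_map X) a c i j k l.
Proof. by rewrite /coef2 /=; case: ifP; rewrite // /smx0 rmorph0. Qed.

Lemma reflection_relator_map a c i j k l :
  phi (reflection_relator par eps b a c i j k l) =
  reflection_relator par eps b' a c i j k l.
Proof.
rewrite /reflection_relator rmorphB !coef2_map !ser2_mapM ser2_mapB1 ser2_mapB2.
by rewrite /Rminus /Rplus !ser2_mapD !ser2_mapN ser2_mapU ser2_mapV ser2_mapP.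
Qed.

Lemma unitary_coef_map N i q :
  phi (unitary_coef par eps b N i q) = unitary_coef par eps b' N i q.
Proof.
rewrite !unitary_coefE rmorphM rmorph_sign; congr (_ * _).
rewrite rmorph_sum; apply: eq_bigr => r _; rewrite rmorph_sum; apply: eq_bigr => j _.
by rewrite !rmorphM rmorph_sign !bser_map.
Qed.
End Naturality.

(** * Dressing in an abstract ring *)

Section NoncommutativeRing.
Variable S : pzRingType.
Instance ncring_ops : @Ring_ops S 0 1 +%R *%R (fun x y => x - y) -%R (@eq S).
Defined.
Instance ncring : Ring (Ro := ncring_ops).
Proof.
split; try by (exact: RelationClasses.eq_equivalence || (move=> ? ? -> ? ? ->) || (move=> ? ? ->)).
- exact: (@add0r S).
- exact: (@addrC S).
- exact: (@addrA S).
- exact: (@mul1r S).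
- exact: (@mulr1 S).
- exact: (@mulrA S).
- exact: (@mulrDl S).
- by move=> x y z; exact: (@mulrDr S).
- by [].
- exact: (@addrN S).
Defined.

Lemma constant_reflection (P G H x y : S) :
  P * P = 1 -> P * G = H * P -> P * H = G * P -> G * G = 1 -> H * H = 1 ->
  G * H = H * G -> (forall s, x * s = s * x) -> (forall s, y * s = s * y) ->
  (y - x - x * y * P) * G * (x + y - x * y * P) * H =
  H * (x + y - x * y * P) * G * (y - x - x * y * P).
Proof.
move=> PP PG PH GG HH GH cx cy.
have PPt t : P * (P * t) = t by rewrite mulrA PP mul1r.
have PGt t : P * (G * t) = H * (P * t) by rewrite mulrA PG mulrA.
have PHt t : P * (H * t) = G * (P * t) by rewrite mulrA PH mulrA.
have GGt t : G * (G * t) = t by rewrite mulrA GG mul1r.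
have HHt t : H * (H * t) = t by rewrite mulrA HH mul1r.
have GHt t : G * (H * t) = H * (G * t) by rewrite mulrA GH mulrA.
have Gx t : G * (x * t) = x * (G * t) by rewrite mulrA -cx mulrA.
have Hx t : H * (x * t) = x * (H * t) by rewrite mulrA -cx mulrA.
have Px t : P * (x * t) = x * (P * t) by rewrite mulrA -cx mulrA.
have Gy t : G * (y * t) = y * (G * t) by rewrite mulrA -cy mulrA.
have Hy t : H * (y * t) = y * (H * t) by rewrite mulrA -cy mulrA.
have Py t : P * (y * t) = y * (P * t) by rewrite mulrA -cy mulrA.
have yx t : y * (x * t) = x * (y * t) by rewrite mulrA -cx mulrA.
(* The factor 1 on the right puts every word into the form [w * t], so that the rules above also
   apply at its end. *)
rewrite -[LHS]mulr1 -[RHS]mulr1.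
do 4 rewrite ?(mulrDl, mulrDr, mulrBl, mulrBr, mulNr, mulrN, mul1r) -?mulrA
  ?(Gx, Hx, Px, Gy, Hy, Py, yx, PPt, PGt, PHt, GGt, HHt, GHt).
non_commutative_ring.
Qed.

(** Here [G], [H] stand for B_1(u), B_2(v), and [G'], [H'] for B_1(v), B_2(u), which appear when [P]
    passes a factor. No relation for [B] is assumed. *)
Lemma reflection_expand (P G G' H H' x y : S) :
  P * P = 1 -> P * G = H' * P -> P * H = G' * P ->
  (forall s, x * s = s * x) -> (forall s, y * s = s * y) ->
  (y - x - x * y * P) * G * (x + y - x * y * P) * H
    - H * (x + y - x * y * P) * G * (y - x - x * y * P) =
  (y - x) * (x + y) * (G * H - H * G)
  - (y - x) * (x * y) * (G * G' * P - H * H' * P)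
  - (x * y) * (x + y) * (P * (G * H) - H * G * P)
  + (x * y) * (x * y) * (H' * H - H * H').
Proof.
move=> PP PG PH cx cy.
have PPt t : P * (P * t) = t by rewrite mulrA PP mul1r.
have PGt t : P * (G * t) = H' * (P * t) by rewrite mulrA PG mulrA.
have PHt t : P * (H * t) = G' * (P * t) by rewrite mulrA PH mulrA.
have Gx t : G * (x * t) = x * (G * t) by rewrite mulrA -cx mulrA.
have Hx t : H * (x * t) = x * (H * t) by rewrite mulrA -cx mulrA.
have Hx' t : H' * (x * t) = x * (H' * t) by rewrite mulrA -cx mulrA.
have Px t : P * (x * t) = x * (P * t) by rewrite mulrA -cx mulrA.
have Gy t : G * (y * t) = y * (G * t) by rewrite mulrA -cy mulrA.
have Hy t : H * (y * t) = y * (H * t) by rewrite mulrA -cy mulrA.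
have Hy' t : H' * (y * t) = y * (H' * t) by rewrite mulrA -cy mulrA.
have Py t : P * (y * t) = y * (P * t) by rewrite mulrA -cy mulrA.
have yx t : y * (x * t) = x * (y * t) by rewrite mulrA -cx mulrA.
have PGt' t : P * (G' * t) = H * (P * t).
  by rewrite -{1}[t]PPt -PHt PPt.
have Gx' t : G' * (x * t) = x * (G' * t) by rewrite mulrA -cx mulrA.
have Gy' t : G' * (y * t) = y * (G' * t) by rewrite mulrA -cy mulrA.
rewrite -[LHS]mulr1 -[RHS]mulr1.
do 4 rewrite ?(mulrDl, mulrDr, mulrBl, mulrBr, mulNr, mulrN, mul1r) -?mulrA
  ?(Gx, Hx, Px, Gy, Hy, Py, yx, Hx', Hy', Gx', Gy', PGt', PHt, PGt, PPt).
non_commutative_ring.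
Qed.

Variables (P E F : S).
Hypothesis hEF : E * F = F * E + E * P - F * P.
Hypothesis hPE : P * E = F * P.
Hypothesis hPF : P * F = E * P.

Section RTT.
Variables a b : S.
Hypothesis ca : forall s, a * s = s * a.
Hypothesis cb : forall s, b * s = s * b.

Let Ea t : E * (a * t) = a * (E * t). Proof. by rewrite mulrA -ca mulrA. Qed.
Let Fa t : F * (a * t) = a * (F * t). Proof. by rewrite mulrA -ca mulrA. Qed.
Let Pa t : P * (a * t) = a * (P * t). Proof. by rewrite mulrA -ca mulrA. Qed.
Let ba t : b * (a * t) = a * (b * t). Proof. by rewrite mulrA -ca mulrA. Qed.
Let Eb t : E * (b * t) = b * (E * t). Proof. by rewrite mulrA -cb mulrA. Qed.
Let Fb t : F * (b * t) = b * (F * t). Proof. by rewrite mulrA -cb mulrA. Qed.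
Let Pb t : P * (b * t) = b * (P * t). Proof. by rewrite mulrA -cb mulrA. Qed.
Let PE t : P * (E * t) = F * (P * t). Proof. by rewrite mulrA hPE mulrA. Qed.
Let PF t : P * (F * t) = E * (P * t). Proof. by rewrite mulrA hPF mulrA. Qed.
Let EF t : E * (F * t) = F * (E * t) + E * (P * t) - F * (P * t).
Proof. by rewrite mulrA hEF mulrBl mulrDl !mulrA. Qed.

(** The linear L-operator [1 + a E] solves the RTT relation, because [hEF] is the relation of the
    general linear superalgebra in matrix form. *)
Lemma rtt : (b - a - a * b * P) * ((1 + a * E) * (1 + b * F)) =
  ((1 + b * F) * (1 + a * E)) * (b - a - a * b * P).
Proof.
rewrite -[LHS]mulr1 -[RHS]mulr1.
do 3 rewrite ?(mulrDl, mulrDr, mulrBl, mulrBr, mulNr, mulrN, mul1r) -?mulrA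
  ?(Ea, Fa, Pa, ba, Eb, Fb, Pb, PE, PF, EF).
non_commutative_ring.
Qed.

(** The RTT relation read with the inverse R-matrix, which for an involution [P] is [b - a + a b P]
    up to a scalar. *)
Lemma rtt_rev : ((1 + a * E) * (1 + b * F)) * (b - a + a * b * P) =
  (b - a + a * b * P) * ((1 + b * F) * (1 + a * E)).
Proof.
rewrite -[LHS]mulr1 -[RHS]mulr1.
do 3 rewrite ?(mulrDl, mulrDr, mulrBl, mulrBr, mulNr, mulrN, mul1r) -?mulrA
  ?(Ea, Fa, Pa, ba, Eb, Fb, Pb, PE, PF, EF).
non_commutative_ring.
Qed.
End RTT.

Section Dressing.
Variables x y B1 B2 F1 F2 : S.
Hypothesis cx : forall s, x * s = s * x.
Hypothesis cy : forall s, y * s = s * y.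
Hypothesis EB : E * B2 = B2 * E.
Hypothesis FB : F * B1 = B1 * F.
Hypothesis invl1 : F1 * (1 - x * E) = 1.
Hypothesis invr1 : (1 - x * E) * F1 = 1.
Hypothesis invl2 : F2 * (1 - y * F) = 1.
Hypothesis invr2 : (1 - y * F) * F2 = 1.
Let Rm := y - x - x * y * P.
Let Rp := x + y - x * y * P.
Hypothesis reflB : Rm * B1 * Rp * B2 = B2 * Rp * B1 * Rm.
Let L1 := 1 + x * E.
Let L2 := 1 + y * F.
Let K1 := 1 - x * E.
Let K2 := 1 - y * F.

Let cNx s : - x * s = s * - x. Proof. by rewrite mulNr mulrN cx. Qed.
Let cNy s : - y * s = s * - y. Proof. by rewrite mulNr mulrN cy. Qed.

(** [R1] to [R4] are [rtt] or [rtt_rev] with parameters (x, y), (-x, y), (x, -y), (-x, -y); the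
    R-matrix in them is then [Rm], [Rp], [-Rp], [-Rm]. This is how R(u + v) enters. *)
Let R1 : Rm * (L1 * L2) = (L2 * L1) * Rm. Proof. exact: rtt. Qed.
Let R2 : (K1 * L2) * Rp = Rp * (L2 * K1).
Proof.
have := rtt_rev cNx cy.
by rewrite opprK !mulNr (addrC y).
Qed.
Let R3 : Rp * (L1 * K2) = (K2 * L1) * Rp.
Proof.
have := rtt cx cNy.
have -> : - y - x - x * - y * P = - Rp by rewrite /Rp mulrN mulNr opprK !opprD opprK (addrC (- y)).
by rewrite mulNr mulrN !mulNr => /oppr_inj.
Qed.
Let R4 : (K1 * K2) * Rm = Rm * (K2 * K1).
Proof.
have := rtt_rev cNx cNy.
have -> : - y - - x + - x * - y * P = - Rm.
  by rewrite /Rm mulrN !mulNr !opprK opprB opprB addrC [- y + x]addrC.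
by rewrite mulNr mulrN !mulNr => /oppr_inj.
Qed.

Let conj_inv (u v w z v' z' : S) :
  z * v = 1 -> v' * z' = 1 -> v * u = w * v' -> u * z' = z * w.
Proof.
by move=> zv vz e; rewrite -[u]mul1r -zv -(mulrA z) e -!mulrA vz mulr1.
Qed.

Let comm_aff (c s t : S) : (forall u, c * u = u * c) -> s * t = t * s ->
  (1 + c * s) * t = t * (1 + c * s).
Proof.
by move=> cc st; rewrite mulrDl mulrDr mul1r mulr1 -mulrA st mulrA cc -!mulrA cc.
Qed.

(** [S1] to [S3] are [R2] to [R4] with the [K] factors inverted. They gather the [L] factors on the
    left and the inverse factors on the right, which leaves the reflection equation of [B] in the
    middle. *)
Lemma dressing : Rm * (L1 * B1 * F1) * Rp * (L2 * B2 * F2) =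
  (L2 * B2 * F2) * Rp * (L1 * B1 * F1) * Rm.
Proof.
have F1B : B2 * F1 = F1 * B2.
  by apply: (conj_inv invl1 invr1); rewrite -mulNr; exact: comm_aff.
have F2B : B1 * F2 = F2 * B1.
  by apply: (conj_inv invl2 invr2); rewrite -mulNr; exact: comm_aff.
have L2B : L2 * B1 = B1 * L2 by exact: comm_aff.
have L1B : L1 * B2 = B2 * L1 by exact: comm_aff.
have S1 : F1 * Rp * L2 = L2 * Rp * F1.
  by rewrite -mulrA; apply/esym/(conj_inv invl1 invr1); rewrite mulrA R2 mulrA.
have S2 : F2 * Rp * L1 = L1 * Rp * F2.
  by rewrite -mulrA; apply/esym/(conj_inv invl2 invr2); rewrite mulrA -R3 mulrA.
have S3 : Rm * F1 * F2 = F2 * F1 * Rm.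
  rewrite -mulrA; apply: (conj_inv _ _ R4).
    by rewrite mulrA -(mulrA F2) invl1 mulr1 invl2.
  by rewrite mulrA -(mulrA K2) invr1 mulr1 invr2.
transitivity (Rm * (L1 * L2) * B1 * Rp * B2 * F1 * F2).
  rewrite -!mulrA [F1 * (Rp * _)]mulrA [F1 * Rp * _]mulrA S1 -!mulrA.
  by rewrite [B1 * (L2 * _)]mulrA -L2B -!mulrA [F1 * (B2 * _)]mulrA -F1B -!mulrA.
transitivity ((L2 * L1) * (B2 * Rp * B1) * (F2 * F1 * Rm)).
  rewrite R1 -S3 -!mulrA; congr (_ * (_ * _)).
  by rewrite !mulrA -reflB.
rewrite -!mulrA [L1 * (B2 * _)]mulrA L1B -!mulrA.
rewrite [B1 * (F2 * _)]mulrA F2B -!mulrA.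
by rewrite [L1 * (Rp * (F2 * _))]mulrA [L1 * Rp * _]mulrA -S2 -!mulrA.
Qed.
End Dressing.
End NoncommutativeRing.

(** * Oscillator realization of the general linear superalgebra *)

Section Gl.
Variables (S : pzRingType) (kappa : nat) (par : 'I_kappa -> bool).
Existing Instances ncring_ops ncring.

Definition gl_rel (E : 'M[S]_kappa) := forall i j k l,
  (-1) ^+ (par k * (par i + par j)) * (E i j * E k l) =
  (-1) ^+ (par l * (par i + par j)) * (E k l * E i j)
  + (-1) ^+ (par k * par i) * E i l *+ (k == j)
  - (-1) ^+ (par i * par j) * E k j *+ (l == i).

Lemma on12_gl (E : 'M[S]_kappa) : gl_rel E ->
  on1 par E * on2 E = on2 E * on1 par E + on1 par E * sw S par - on2 E * sw S par.
Proof.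
move=> h; apply: mmP => i j k l; rewrite mmB mmD mul_on12 mul_on21 h (swMr _ (on1 par E)) (swMr _ (on2 E)).
rewrite on1E on2E; congr (_ + _ - _).
  rewrite eq_sym !mulrb; case: eqP => [<-|_]; last by rewrite mul0r.
  rewrite [RHS]commr_sign mulrA -exprD; congr (_ * _); apply: sign_odd.
  by case: (par i) (par j) (par l) => [] [] [].
rewrite !mulrb [l == i]eq_sym; case: eqP => [<-|_]; last by rewrite mul0r.
by rewrite [RHS]commr_sign.
Qed.

Variables (sg : bool) (psi phi : 'I_kappa -> S).
Let q i := par i (+) sg.
Hypothesis psi_psi : forall i k, psi i * psi k = (-1) ^+ (q i * q k) * (psi k * psi i).
Hypothesis phi_phi : forall i k, phi i * phi k = (-1) ^+ (q i * q k) * (phi k * phi i).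
Hypothesis phi_psi : forall i k,
  phi i * psi k = (-1) ^+ (q i * q k) * (psi k * phi i) + (i == k)%:R.

(** The bit [sg] shifts the parities of all oscillators at once. The bilinears keep parity |i| +
    |j|, so both choices give the same superalgebra; the freedom serves to make a prescribed mode
    even. *)
Definition osc_mx : 'M[S]_kappa := \matrix_(i, j) ((-1) ^+ par j * (psi i * phi j)).

Lemma osc_mx_gl : gl_rel osc_mx.
Proof.
move=> i j k l; rewrite !mxE !mulrb.
have h1 t : psi i * (psi k * t) = (-1) ^+ (q i * q k) * (psi k * (psi i * t)).
  by rewrite mulrA psi_psi -!mulrA.
have h2 := phi_phi j l.
have h3 t : phi j * (psi k * t) = (-1) ^+ (q j * q k) * (psi k * (phi j * t)) + (j == k)%:R * t.
  by rewrite mulrA phi_psi mulrDl -!mulrA.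
have h4 t : phi l * (psi i * t) = (-1) ^+ (q l * q i) * (psi i * (phi l * t)) + (l == i)%:R * t.
  by rewrite mulrA phi_psi mulrDl -!mulrA.
rewrite [k == j]eq_sym; move: h1 h2 h3 h4; rewrite /q.
have [<-|njk] := eqVneq j k; have [<-|nli] := eqVneq l i.
all: case: (par i) (par j) (par k) (par l) sg => [] [] [] [] [].
all: rewrite /= ?expr0 ?expr1 => h1 h2 h3 h4.
all: rewrite ?(mulN1r, mul1r, mulrN, mulNr) -?mulrA ?(h3, h4).
all: rewrite ?(mulrDr, mulrN, mulNr, mulN1r, mul1r, mul0r) -?mulrA ?(h1, h2).
all: non_commutative_ring.
Qed.
End Gl.

(** * Dressing of solutions of the reflection equation *)

Section SerNeg.
Variable R : pzRingType.
Definition serN (f : ser R) : ser R := fun n => (-1) ^+ n * f n.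
Lemma serN_is_additive : additive serN.
Proof. by move=> f g; apply: funext => n; rewrite /serN !ser_subE mulrBr. Qed.
Lemma serN_is_multiplicative : multiplicative serN.
Proof.
split=> [f g|]; apply: funext => n; last first.
  by rewrite /serN !ser_oneE; case: n => [|n]; rewrite ?mul1r ?mulr0.
rewrite /serN (ser_mulE f) (ser_mulE _ (serN g)) big_distrr.
apply: eq_bigr => i _ /=; rewrite !mulrA -[X in _ = X * _]mulrA [f i * _]commr_sign.
by rewrite !mulrA -exprD subnKC // -ltnS.
Qed.
HB.instance Definition _ := GRing.isAdditive.Build (ser R) (ser R) serN serN_is_additive.
HB.instance Definition _ :=
  GRing.isMultiplicative.Build (ser R) (ser R) serN serN_is_multiplicative.
End SerNeg.

Section Dressing.
Variables (A : pzRingType) (kappa : nat) (par : 'I_kappa -> bool).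
Local Notation SA := (ser (ser A)).
Local Notation M2 := (mm SA kappa).
Local Notation cx := (ser_map (@serC A)).
Local Notation cy := (@serC (ser A)).
Local Notation MA := 'M[A]_kappa.
Local Notation MS := 'M[ser A]_kappa.
Implicit Types (E : MA) (B M : MS).

Lemma cen_comm_of z : (forall w, z * w = w * z) ->
  forall X : M2, cen kappa z * X = X * cen kappa z.
Proof.
move=> h X; apply/matrixP => i j.
rewrite /cen -[_ * X]/(_ *m X) mul_scalar_mx -[X * _]/(X *m _) !mxE.
rewrite (bigD1 j) //= mxE eqxx mulr1n big1 ?addr0 => [|a nai]; last first.
  by rewrite mxE (negPf nai) mulr0n mulr0.
apply/matrixP => k l; rewrite -[_ * X i j]/(_ *m X i j) mul_scalar_mx mxE h.
rewrite -[X i j * _]/(X i j *m _) !mxE (bigD1 l) //= mxE eqxx mulr1n.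
by rewrite big1 ?addr0 // => a nai; rewrite mxE (negPf nai) mulr0n mulr0.
Qed.

Lemma cenB z w : cen kappa (z - w) = cen kappa z - cen kappa w :> M2.
Proof. by apply: mmP => i j k l; rewrite mmB !cenE mulrnBl. Qed.
Lemma cenD z w : cen kappa (z + w) = cen kappa z + cen kappa w :> M2.
Proof. by apply: mmP => i j k l; rewrite mmD !cenE mulrnDl. Qed.
Lemma cenM z w : cen kappa (z * w) = cen kappa z * cen kappa w :> M2.
Proof. by apply: mmP => i j k l; rewrite cenM_E !cenE mulrnAr. Qed.

Lemma Rminus_mxE : Rminus_mx A par = cen kappa (vy A) - cen kappa (vx A)
    - cen kappa (vx A) * cen kappa (vy A) * sw SA par.
Proof. rewrite /Rminus_mx cenB cenM; reflexivity. Qed.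
Lemma Rplus_mxE : Rplus_mx A par = cen kappa (vx A) + cen kappa (vy A)
    - cen kappa (vx A) * cen kappa (vy A) * sw SA par.
Proof. rewrite /Rplus_mx cenD cenM; reflexivity. Qed.

Lemma on1_cen (z : SA) : (forall w, z * w = w * z) -> on1 par z%:M = cen kappa z.
Proof.
move=> h; have e : on2 z%:M = cen kappa z by [].
by rewrite /on1 e -(cen_comm_of h) -mulrA sw_invol mulr1.
Qed.

Lemma on1_scal (z : SA) (N : 'M[SA]_kappa) : (forall w, z * w = w * z) ->
  on1 par (z%:M * N) = cen kappa z * on1 par N.
Proof. by move=> h; rewrite on1M (on1_cen h). Qed.

Lemma on2_scal (z : SA) (N : 'M[SA]_kappa) : on2 (z%:M * N) = cen kappa z * on2 N.
Proof. exact: on2M. Qed.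

Lemma mx_scalE (z : SA) (N : 'M[SA]_kappa) i j : (z%:M * N) i j = z * N i j.
Proof. by rewrite -[_ * N]/(_ *m N) mul_scalar_mx mxE. Qed.

Lemma cenx_comm (X : M2) : cen kappa (vx A) * X = X * cen kappa (vx A).
Proof. exact: cen_comm_of (@serX_comm _) X. Qed.

Lemma ceny_comm (X : M2) : cen kappa (vy A) * X = X * cen kappa (vy A).
Proof.
apply: cen_comm_of => w; apply: funext => r.
by rewrite /vy serC_mulE ser_mulCE serX_comm.
Qed.

Definition xmx E : MS := \matrix_(i, j) (serX * serC (E i j)).
Definition fmx E : MS := \matrix_(i, j) ((fun r => (E ^+ r) i j) : ser A).
Definition dress E B : MS := (1 + xmx E) * B * fmx E.

Lemma mxM (R : pzRingType) (X Y : 'M[R]_kappa) i j : (X * Y) i j = \sum_c X i c * Y c j.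
Proof. by rewrite mxE. Qed.

Lemma mxB (R : pzRingType) (X Y : 'M[R]_kappa) i j : (X - Y) i j = X i j - Y i j.
Proof. by rewrite !mxE. Qed.

Lemma map_mxMr (R S : pzRingType) (f : {rmorphism R -> S}) (X Y : 'M[R]_kappa) :
  map_mx f (X * Y) = map_mx f X * map_mx f Y.
Proof. exact: map_mxM. Qed.

Lemma mxone (R : pzRingType) i j : (1 : 'M[R]_kappa) i j = (i == j)%:R.
Proof. by rewrite mxE. Qed.

Lemma fmx_mulr E : fmx E * (1 - xmx E) = 1.
Proof.
apply/matrixP=> i j; apply: funext => r.
rewrite mulrBr mulr1 mxB mxM mxone ser_subE ser_sumE [fmx E i j]mxE.
under eq_bigr => c _ do rewrite !mxE mulrA ser_mulCE ser_mulXE.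
case: r => [|r].
  rewrite big1 ?subr0 => [|c _]; last by rewrite mul0r.
  by rewrite expr0 mxone; case: eqP.
rewrite exprSr mxM subrr; case: eqP => _; by [].
Qed.

Lemma fmx_mull E : (1 - xmx E) * fmx E = 1.
Proof.
apply/matrixP=> i j; apply: funext => r.
rewrite mulrBl mul1r mxB mxM mxone ser_subE ser_sumE [fmx E i j]mxE.
under eq_bigr => c _ do rewrite !mxE -mulrA serX_mulE.
case: r => [|r].
  rewrite big1 ?subr0 // expr0 mxone; by case: eqP.
rewrite exprS mxM; under [X in _ - X]eq_bigr => c _ do rewrite serC_mulE.
rewrite subrr; case: eqP => _; by [].
Qed.

Definition scomm E M := on1 par (map_mx (@serC A) E) * on2 M =
  on2 M * on1 par (map_mx (@serC A) E).

Lemma scommP E M : scomm E M <-> (forall i j k l r,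
  (-1) ^+ (par k * (par i + par j)) * (E i j * M k l r) =
  (-1) ^+ (par l * (par i + par j)) * (M k l r * E i j)).
Proof.
rewrite /scomm on12_comm; split=> e i j k l => [r|].
  have /(congr1 (fun f : ser A => f r)) := e i j k l.
  by rewrite !ser_signM mxE serC_mulE ser_mulCE.
by apply: funext => r; rewrite !ser_signM mxE serC_mulE ser_mulCE.
Qed.

Lemma scommM E M N : scomm E M -> scomm E N -> scomm E (M * N).
Proof. by move=> eM eN; rewrite /scomm on2M mulrA eM -mulrA eN mulrA. Qed.
Lemma scommD E M N : scomm E M -> scomm E N -> scomm E (M + N).
Proof. by move=> eM eN; rewrite /scomm raddfD /= mulrDl mulrDr eM eN. Qed.
Lemma scomm1 E : scomm E 1.
Proof. by rewrite /scomm on21 mulr1 mul1r. Qed.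

Definition scomm0 E E' := on1 par E * on2 E' = on2 E' * on1 par E.

Lemma scomm_xmx E E' : scomm0 E E' -> scomm E (xmx E').
Proof.
move/on12_comm => e; apply/scommP => i j k l r; rewrite !mxE serX_mulE.
by case: r => [|[|r]]; rewrite ?mulr0 ?mul0r ?mulr0 ?e.
Qed.

Lemma scomm_fmx E E' : scomm0 E E' -> scomm E (fmx E').
Proof.
move=> e; apply/scommP => i j k l r; rewrite !mxE; move: i j k l.
apply/on12_comm; elim: r => [|r IH]; first by rewrite expr0 mulr1 mul1r.
by rewrite exprS on2M mulrA e -mulrA IH mulrA.
Qed.

Lemma scomm_dress E E' B : scomm0 E E' -> scomm E B -> scomm E (dress E' B).
Proof.
move=> e eB; apply: scommM; last exact: scomm_fmx.
by apply: scommM => //; apply: scommD; [exact: scomm1 | exact: scomm_xmx].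
Qed.

Definition reflection_eq B := refl_lhs par B = refl_rhs par B.
Definition unitarity B := B * map_mx (@serN A) B = 1.

Lemma serN_xmx E : map_mx (@serN A) (xmx E) = - xmx E.
Proof.
apply/matrixP=> i j; apply: funext => r.
rewrite !mxE ser_oppE -[LHS]/((-1) ^+ r * (serX * serC (E i j)) r) serX_mulE.
by case: r => [|[|r]]; rewrite /= ?mulr0 ?oppr0 ?mulN1r.
Qed.

(** Under x -> -x the factor 1 + E x becomes 1 - E x, which cancels against the inverse factor in
    the middle of B(u) B(-u). *)
Lemma dress_unit E B : unitarity B -> unitarity (dress E B).
Proof.
move=> hB; rewrite /unitarity /dress !map_mxMr.
rewrite map_mxD map_mx1 serN_xmx.
rewrite -!mulrA [fmx E * _]mulrA fmx_mulr mul1r [B * _]mulrA hB mul1r.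
have := fmx_mull E => /(congr1 (map_mx (@serN A))).
by rewrite map_mxMr map_mxB map_mx1 serN_xmx opprK.
Qed.

Lemma dress_refl E B : gl_rel par E -> scomm E B -> reflection_eq B -> reflection_eq (dress E B).
Proof.
move=> gE cE rB.
have cxC a : cx (serC a) = serC (serC a).
  by apply: funext => -[|r] //=; rewrite /ser_map /= raddf0.
have [Ec EcE] : {Ec : 'M[SA]_kappa | forall i j, Ec i j = serC (serC (E i j))}.
  by exists (map_mx (@serC (ser A)) (map_mx (@serC A) E)) => i j; rewrite !mxE.
have gEc : gl_rel par Ec.
  move=> i j k l; have := congr1 (fun a => serC (serC a)) (gE i j k l).
  by rewrite /= !(rmorphB, rmorphD, rmorphMn, rmorphM, rmorph_sign) /= -!EcE.
have Ecx : map_mx cx (map_mx (@serC A) E) = Ec.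
  by apply/matrixP=> i j; rewrite !mxE cxC EcE.
have Ecy : map_mx cy (map_mx (@serC A) E) = Ec.
  by apply/matrixP=> i j; rewrite !mxE EcE.
have xE : on1 par (map_mx cx (xmx E)) = cen kappa (vx A) * on1 par Ec.
  rewrite -on1_scal; last exact: serX_comm.
  congr on1; apply/matrixP => i j; rewrite mx_scalE !mxE rmorphM EcE /= cxC.
  by congr (_ * _); apply: funext => -[|[|r]] /=;
    rewrite /ser_map /serX /= ?raddf0 ?rmorph1.
have yE : on2 (map_mx cy (xmx E)) = cen kappa (vy A) * on2 Ec.
  rewrite -on2_scal; congr on2.
  by apply/matrixP => i j; rewrite mx_scalE !mxE rmorphM EcE.
have o1 : on1 par (map_mx cx (1 + xmx E)) = 1 + cen kappa (vx A) * on1 par Ec.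
  rewrite map_mxD map_mx1 on1D on11 xE; congr (_ + _).
have o2 : on2 (map_mx cy (1 + xmx E)) = 1 + cen kappa (vy A) * on2 Ec.
  rewrite map_mxD map_mx1 on2D on21 yE; congr (_ + _).
have n1 : on1 par (map_mx cx (1 - xmx E)) = 1 - cen kappa (vx A) * on1 par Ec.
  rewrite map_mxB map_mx1 on1B on11 xE; congr (_ - _).
have n2 : on2 (map_mx cy (1 - xmx E)) = 1 - cen kappa (vy A) * on2 Ec.
  rewrite map_mxB map_mx1 on2B on21 yE; congr (_ - _).
rewrite /reflection_eq /refl_lhs /refl_rhs /dress.
have cB : on1 par Ec * on2 (map_mx cy B) = on2 (map_mx cy B) * on1 par Ec.
  apply/on12_comm => i j k l; have := (on12_comm _ _ _).1 cE i j k l.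
  by move=> /(congr1 cy); rewrite !rmorphM !rmorph_sign /= [in X in X -> _]mxE -EcE [map_mx _ _ _ _]mxE.
have cBx : on1 par Ec * on2 (map_mx cx B) = on2 (map_mx cx B) * on1 par Ec.
  apply/on12_comm => i j k l; have := (on12_comm _ _ _).1 cE i j k l.
  by move=> /(congr1 cx); rewrite !rmorphM !rmorph_sign /= [in X in X -> _]mxE cxC -EcE [map_mx _ _ _ _]mxE.
have cB1 := on21_comm cBx.
rewrite !map_mxMr !on1M !on2M o1 o2.
rewrite Rminus_mxE Rplus_mxE.
apply: dressing.
- exact: on12_gl gEc.
- exact: sw_on1.
- exact: sw_on2.
- exact: cenx_comm.
- exact: ceny_comm.
- exact: cB.
- exact: cB1.
- rewrite -n1 -on1M -map_mxMr fmx_mulr map_mx1 on11; reflexivity.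
- rewrite -n1 -on1M -map_mxMr fmx_mull map_mx1 on11; reflexivity.
- rewrite -n2 -on2M -map_mxMr fmx_mulr map_mx1 on21; reflexivity.
- rewrite -n2 -on2M -map_mxMr fmx_mull map_mx1 on21; reflexivity.
- rewrite -Rminus_mxE -Rplus_mxE; exact: rB.
Qed.
End Dressing.

(** * Highest weight of a dressed solution *)

(** The commutator with [E] is a derivation, and [P F = E P] makes the cross terms cancel. Hence the
    matrix powers of [E] obey the same commutation relation as [E] itself. *)
Lemma ad_mul (S : pzRingType) (P E F Z : S) :
  E * F = F * E + E * P - F * P -> E * Z = Z * E + P * Z - Z * P ->
  P * F = E * P -> E * (F * Z) = (F * Z) * E + P * (F * Z) - (F * Z) * P.
Proof.
move=> hF hZ hP; rewrite mulrA hF mulrBl mulrDl -!mulrA hZ mulrBr mulrDr.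
rewrite [P * (F * Z)]mulrA hP -!mulrA -!addrA; congr (_ + _).
by rewrite addrC -[LHS]addrA subrK addrC.
Qed.

Section LeftIdeal.
Variables (K : comNzRingType) (A : pzRingType) (iota : {rmorphism K -> A}).
Hypothesis iota_central : forall c a, iota c * a = a * iota c.
Variable N : A -> Prop.
Hypothesis N_ideal : is_left_ideal N.

Lemma N0 : N 0. Proof. by case: N_ideal. Qed.
Lemma ND a b : N a -> N b -> N (a + b). Proof. by case: N_ideal => _ + _; apply. Qed.
Lemma NM a b : N b -> N (a * b). Proof. by case: N_ideal => _ _; apply. Qed.
Lemma NN a : N a -> N (- a). Proof. by rewrite -mulN1r; exact: NM. Qed.
Lemma NB a b : N a -> N b -> N (a - b). Proof. by move=> ha /NN; exact: ND. Qed.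
Lemma Nsum I (r : seq I) (P : pred I) (F : I -> A) :
  (forall i, P i -> N (F i)) -> N (\sum_(i <- r | P i) F i).
Proof. by move=> h; elim/big_ind: _ => //; [exact: N0 | exact: ND]. Qed.
Lemma N_sign m a : N ((-1) ^+ m * a) -> N a.
Proof.
move=> /(NM ((-1) ^+ m)); rewrite mulrA -exprD addnn -mul2n exprM sqrrN !expr1n.
by rewrite mul1r.
Qed.

Definition eqN a c := N (a - iota c).
Lemma eqND a b c d : eqN a c -> eqN b d -> eqN (a + b) (c + d).
Proof. by move=> h1 h2; rewrite /eqN rmorphD opprD addrACA; exact: ND. Qed.
Lemma eqNN a c : eqN a c -> eqN (- a) (- c).
Proof. by move=> h; rewrite /eqN rmorphN -opprD; exact: NN. Qed.
Lemma eqNB a b c d : eqN a c -> eqN b d -> eqN (a - b) (c - d).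
Proof. by move=> h1 /eqNN; exact: eqND. Qed.
Lemma eqN_sum I (r : seq I) (P : pred I) (F : I -> A) (c : I -> K) :
  (forall i, P i -> eqN (F i) (c i)) ->
  eqN (\sum_(i <- r | P i) F i) (\sum_(i <- r | P i) c i).
Proof.
move=> h; rewrite /eqN rmorph_sum -sumrB; exact: Nsum.
Qed.
(** [N] is only a left ideal; congruences can be multiplied because their right-hand sides are
    central. *)
Lemma eqNM a b c d : eqN a c -> eqN b d -> eqN (a * b) (c * d).
Proof.
move=> h1 h2; rewrite /eqN mulrC.
have -> : a * b - iota (d * c) = a * (b - iota d) + iota d * (a - iota c).
  by rewrite !mulrBr rmorphM -(iota_central d a) addrA subrK.
by apply: ND; exact: NM.
Qed.
Lemma N_mulr x b c : N x -> eqN b c -> N (x * b).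
Proof.
move=> hx hb; have -> : x * b = x * (b - iota c) + iota c * x.
  by rewrite mulrBr iota_central subrK.
by apply: ND; exact: NM.
Qed.
Lemma eqN_iota c : eqN (iota c) c. Proof. by rewrite /eqN subrr; exact: N0. Qed.
Lemma eqN_sign m a c : eqN a c -> eqN ((-1) ^+ m * a) ((-1) ^+ m * c).
Proof.
move=> h; apply: eqNM => //; rewrite -(rmorph_sign iota); exact: eqN_iota.
Qed.
Lemma eqN0 a : eqN a 0 <-> N a. Proof. by rewrite /eqN rmorph0 subr0. Qed.
Lemma eqN_cong a b c : N (a - b) -> eqN b c -> eqN a c.
Proof. by move=> h1 h2; have := ND h1 h2; rewrite addrA subrK. Qed.

Variables (kappa : nat) (par : 'I_kappa -> bool).

Definition highest_weight (B : 'M[ser A]_kappa) (mu : 'I_kappa -> ser K) :=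
  (forall (i j : 'I_kappa) r, (i < j)%N -> N (B i j r)) /\ (forall i r, eqN (B i i r) (mu i r)).

Section Gl.
Variables (E : 'M[A]_kappa) (l : 'I_kappa -> K).
Hypothesis gE : gl_rel par E.
Hypothesis E_up : forall i j : 'I_kappa, (i < j)%N -> N (E i j).
Hypothesis E_diag : forall i, eqN (E i i) (l i).

(** The eigenvalue of the i-th diagonal entry of [E ^+ r] on the highest weight vector. The sum over
    a > i comes from [pow_diag_up]. *)
Fixpoint phi_coef r (i : 'I_kappa) : K :=
  if r is r'.+1 then l i * phi_coef r' i
    + \sum_(a : 'I_kappa | (i < a)%N) sgn par a * (phi_coef r' i - phi_coef r' a)
  else 1.

Lemma gl_pow r : on1 par E * on2 (E ^+ r) =
  on2 (E ^+ r) * on1 par E + sw A par * on2 (E ^+ r) - on2 (E ^+ r) * sw A par.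
Proof.
elim: r => [|r IH].
  by rewrite expr0 -[1]/(1%:M) on21 !mulr1 !mul1r addrK.
rewrite exprS on2M; exact: (ad_mul (on12_gl gE) IH (sw_on2 par E)).
Qed.

Local Notation Z r := (E ^+ r).

Lemma gl_pow_entry r i j k m :
  (-1) ^+ (par k * (par i + par j)) * (E i j * Z r k m) =
  (-1) ^+ (par m * (par i + par j)) * (Z r k m * E i j)
  + (-1) ^+ (par i * par k) * (Z r i m *+ (k == j))
  - Z r k j *+ (i == m) * (-1) ^+ (par m * par j).
Proof.
have /(congr1 (fun X : mm A kappa => X i j k m)) := gl_pow r.
rewrite mmB mmD mul_on12 mul_on21 (swMl _ (on2 (Z r))) (swMr _ (on2 (Z r))) => ->.
by rewrite (on2E (Z r)) (on2E (Z r)).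
Qed.

Lemma pow_up r (i j : 'I_kappa) : (i < j)%N -> N (Z r i j).
Proof.
elim: r i j => [|r IH] i j ij.
  by rewrite expr0 mxE; case: eqP ij => [->|_ _]; rewrite ?ltnn //; exact: N0.
rewrite exprSr mxE; apply: Nsum => c _.
have [cj|jc|/val_inj ->] := ltngtP c j; first by apply: NM; exact: E_up.
  (* For j < c the lowering entry [E c j] is moved to the left of [Z r i c]. The commutator
     contributes [Z r i j], so every resulting term ends in an upper entry of [Z r]. *)
  have := gl_pow_entry r c j i c.
  rewrite (_ : (i == j) = false) ?mulr0n ?mulr0 ?addr0; last first.
    by apply/eqP => e; rewrite e ltnn in ij.
  rewrite eqxx mulr1n => /eqP; rewrite eq_sym subr_eq => /eqP e.
  apply: (@N_sign (par c * (par c + par j))); rewrite e; apply: ND.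
    by apply: NM; apply: NM; apply: IH; exact: ltn_trans jc.
  by rewrite commr_sign; apply: NM; exact: IH.
by apply: N_mulr (E_diag j); exact: IH.
Qed.

Lemma up_mul r (i j k m : 'I_kappa) : (i < j)%N -> k != j -> i != m -> N (E i j * Z r k m).
Proof.
move=> ij kj im; apply: (@N_sign (par k * (par i + par j))).
rewrite gl_pow_entry (negPf kj) (negPf im) !mulr0n mulr0 mul0r addr0 subr0.
by apply: NM; apply: NM; exact: E_up.
Qed.

Lemma up_mul2 r (i j m : 'I_kappa) : (i < j)%N -> (i < m)%N -> N (E i j * Z r j m).
Proof.
move=> ij im; apply: (@N_sign (par j * (par i + par j))).
rewrite gl_pow_entry eqxx (_ : (i == m) = false) ?mulr0n ?mul0r ?subr0; last first.
  by apply/eqP => e; rewrite e ltnn in im.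
by apply: ND; apply: NM; [apply: NM; exact: E_up | exact: pow_up].
Qed.

(** Since [E i a] lies in [N], only its commutator with [Z r a i] survives. *)
Lemma pow_diag_up r (i a : 'I_kappa) : (i < a)%N ->
  N (E i a * Z r a i - sgn par a * (Z r i i - Z r a a)).
Proof.
move=> ia; apply: (@N_sign (par a * (par i + par a))).
rewrite mulrBr gl_pow_entry !eqxx !mulr1n commr_sign /sgn mulrA -exprD.
have -> : (-1) ^+ (par a * (par i + par a) + par a) = (-1) ^+ (par i * par a) :> A.
  by apply: sign_odd; case: (par i) (par a) => [] [].
rewrite mulrBr -!addrA [X in _ + X](_ : _ = 0) ?addr0.
  by apply: NM; apply: NM; exact: E_up.
by rewrite opprB addKr subrr.
Qed.

Lemma pow_diag r i : eqN (Z r i i) (phi_coef r i).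
Proof.
elim: r i => [|r IH] i.
  by rewrite expr0 mxE eqxx /eqN /= rmorph1 mulr1n subrr; exact: N0.
rewrite exprS mxE (bigD1 i) //= (bigID (fun a : 'I_kappa => (i < a)%N)) /=.
apply: eqND; first exact: eqNM.
rewrite -[X in eqN _ X]addr0; apply: eqND; last first.
  apply/eqN0; apply: Nsum => c /andP[ci ic]; apply: NM; apply: pow_up.
  by rewrite ltn_neqAle ci leqNgt.
rewrite (eq_bigl (fun a : 'I_kappa => (i < a)%N)) => [|a]; last first.
  by rewrite -val_eqE /= eq_sym neq_ltn; case: ltngtP.
apply: eqN_sum => a ia; apply: eqN_cong (pow_diag_up r ia) _.
by apply: eqN_sign; apply: eqNB.
Qed.

Section Dressed.
Variables (B : 'M[ser A]_kappa) (mu : 'I_kappa -> ser K).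
Hypothesis hB : highest_weight B mu.
Hypothesis cB : scomm par E B.

Definition phi_ser (i : 'I_kappa) : ser K := fun r => phi_coef r i.

(** The sum over a > i is the contribution of the entries [E i a], which do not annihilate the
    vector once lowering entries stand to their right. *)
Definition dress_weight (i : 'I_kappa) : ser K :=
  (1 + serX * serC (l i)) * (phi_ser i * mu i)
  + serX * \sum_(a : 'I_kappa | (i < a)%N)
      serC (sgn par a) * ((phi_ser i - phi_ser a) * mu a).

Lemma pow_comm t i j k m r :
  (-1) ^+ (par k * (par i + par j)) * (Z t i j * B k m r) =
  (-1) ^+ (par m * (par i + par j)) * (B k m r * Z t i j).
Proof.
pose Br : 'M[A]_kappa := \matrix_(k, m) B k m r.
have e : on1 par E * on2 Br = on2 Br * on1 par E.
  by apply/on12_comm => i' j' k' m'; rewrite !mxE; exact: (scommP par E B).1.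
have : on1 par (Z t) * on2 Br = on2 Br * on1 par (Z t).
  elim: t => [|t IH]; first by rewrite expr0 -[1]/(1%:M) on11 mulr1 mul1r.
  by rewrite exprS on1M -mulrA IH mulrA e mulrA.
by move/on12_comm => /(_ i j k m); rewrite !mxE.
Qed.

Let G := B * fmx E.
Lemma BF_coef a j r : G a j r = \sum_c \sum_(s < r.+1) B a c s * Z (r - s) c j.
Proof.
rewrite /G mxE ser_sumE; apply: eq_bigr => c _; rewrite ser_mulE.
by apply: eq_bigr => s _; rewrite mxE.
Qed.

Lemma BZ_lt (a c j : 'I_kappa) s t : (c < j)%N || (a < c)%N -> N (B a c s * Z t c j).
Proof.
case/orP => [cj|ac]; first by apply: NM; exact: pow_up.
apply: (@N_sign (par c * (par c + par j))); rewrite -pow_comm.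
by apply: NM; apply: NM; case: hB => + _; apply.
Qed.

(** Diagonal entries are even, so supercommutation is plain commutation. *)
Lemma BZ_diag (a j : 'I_kappa) s t : B a a s * Z t a j = Z t a j * B a a s.
Proof.
have := pow_comm t a j a a s => /(congr1 (fun z => (-1) ^+ (par a * (par a + par j)) * z)).
by rewrite /= !mulrA -!expr2 !sqrr_sign !mul1r.
Qed.

Lemma BF_up (a j : 'I_kappa) r : (a < j)%N -> N (G a j r).
Proof.
move=> aj; rewrite BF_coef; apply: Nsum => c _; apply: Nsum => s _.
apply: BZ_lt; case: ltnP => //= jc; exact: leq_trans jc.
Qed.

Lemma BF_diag (j : 'I_kappa) r : eqN (G j j r) ((phi_ser j * mu j) r).
Proof.
rewrite BF_coef (bigD1 j) //= -[X in eqN _ X]addr0; apply: eqND; last first.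
  apply/eqN0; apply: Nsum => c cj; apply: Nsum => s _; apply: BZ_lt.
  by rewrite -neq_ltn.
rewrite mulrC ser_mulE; apply: eqN_sum => s _.
by rewrite BZ_diag mulrC; apply: eqNM; [exact: pow_diag | exact: hB.2].
Qed.

(** In the range j <= c < a the factor [B a c s] is brought to the front by supercommutation, and
    then [E i a * Z t c j] is already in [N]. *)
Lemma EBF_off (i j a c : 'I_kappa) s t : (i <= j)%N -> (j < a)%N -> c != a ->
  N (E i a * (B a c s * Z t c j)).
Proof.
move=> ij ja ca; have ia := leq_ltn_trans ij ja.
have [h|] := boolP ((c < j)%N || (a < c)%N); first by apply: NM; exact: BZ_lt.
rewrite negb_or -!leqNgt => /andP[jc cla].
have {}ca : (c < a)%N by rewrite ltn_neqAle ca.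
have /(_ _ _ _ _ s) e := (scommP par E B).1 cB.
apply: (@N_sign (par a * (par i + par a))).
rewrite !mulrA -[_ * _ * B a c s]mulrA e -!mulrA; do 2 apply: NM.
have [eij|nij] := eqVneq i j; last first.
  apply: up_mul => //; first by rewrite neq_ltn ca.
rewrite -eij; apply: (@N_sign (par c * (par i + par a))).
rewrite gl_pow_entry eqxx mulr1n (_ : (c == a) = false) ?mulr0n ?mulr0 ?addr0; last first.
  by apply/eqP => e'; rewrite e' ltnn in ca.
apply: NB; first by apply: NM; apply: NM; exact: E_up.
by rewrite commr_sign; apply: NM; exact: pow_up.
Qed.

Lemma EBF_up (i j a : 'I_kappa) r : (i < j)%N -> (j < a)%N -> N (E i a * G a j r).
Proof.
move=> ij ja; rewrite BF_coef big_distrr; apply: Nsum => c _ /=.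
rewrite big_distrr; apply: Nsum => s _ /=.
have [->|ca] := eqVneq c a; last by apply: EBF_off => //; exact: ltnW.
by rewrite BZ_diag mulrA; apply: N_mulr (hB.2 _ _); exact: up_mul2 (ltn_trans ij ja) ij.
Qed.

Lemma EBF_diag (i a : 'I_kappa) r : (i < a)%N ->
  eqN (E i a * G a i r) ((serC (sgn par a) * ((phi_ser i - phi_ser a) * mu a)) r).
Proof.
move=> ia; rewrite BF_coef big_distrr (bigD1 a) //= -[X in eqN _ X]addr0.
apply: eqND; last first.
  apply/eqN0; apply: Nsum => c ca; rewrite big_distrr; apply: Nsum => s _ /=.
  exact: EBF_off.
rewrite serC_mulE [(_ - _) * _]mulrC ser_mulE !big_distrr /=.
apply: eqN_sum => s _; rewrite BZ_diag mulrA [mu a s * _]mulrC mulrA.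
apply: eqNM; last exact: hB.2.
apply: eqN_cong (pow_diag_up _ ia) _.
by apply: eqN_sign; apply: eqNB; exact: pow_diag.
Qed.

Lemma dress_highest : highest_weight (dress E B) dress_weight.
Proof.
have e i j r : dress E B i j r = G i j r +
    if r is r'.+1 then \sum_a E i a * G a j r' else 0.
  rewrite /dress -mulrA mulrDl mul1r -/G.
  have -> : (G + xmx E * G) i j = G i j + (xmx E * G) i j by rewrite mxE.
  rewrite ser_addE (mxM (xmx E)) ser_sumE; congr (_ + _); case: r => [|r].
    by rewrite big1 // => c _; rewrite mxE -mulrA serX_mulE.
  by apply: eq_bigr => c _; rewrite mxE -mulrA serX_mulE serC_mulE.
split=> [i j r ij|i r].
  rewrite e; apply: ND; first exact: BF_up.
  case: r => [|r]; first exact: N0.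
  apply: Nsum => a _; have [aj|ja|/val_inj ->] := ltngtP a j.
  - by apply: NM; exact: BF_up.
  - exact: EBF_up.
  by apply: N_mulr (BF_diag j r); exact: E_up.
rewrite e /dress_weight mulrDl mul1r -addrA ser_addE; apply: eqND; first exact: BF_diag.
rewrite ser_addE -mulrA !serX_mulE; case: r => [|r].
  by rewrite addr0; apply/eqN0; exact: N0.
rewrite serC_mulE ser_sumE (bigD1 i) //= (bigID (fun a : 'I_kappa => (i < a)%N)) /=.
apply: eqND; first by apply: eqNM; [exact: E_diag | exact: BF_diag].
rewrite -[X in eqN _ X]addr0; apply: eqND; last first.
  apply/eqN0; apply: Nsum => c /andP[ci ic]; apply: NM; apply: BF_up.
  by rewrite ltn_neqAle ci leqNgt.
rewrite (eq_bigl (fun a : 'I_kappa => (i < a)%N)) => [|a]; last first.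
  by rewrite -val_eqE /= eq_sym neq_ltn; case: ltngtP.
by apply: eqN_sum => a ia; exact: EBF_diag.
Qed.
End Dressed.
End Gl.
End LeftIdeal.

(** * Substitutions and the conditions on the weight *)

Lemma sum_triangle_swap (V : zmodType) (F : nat -> nat -> V) n :
  \sum_(i < n.+1) \sum_(j < (n - i).+1) F i j =
  \sum_(j < n.+1) \sum_(i < (n - j).+1) F i j.
Proof.
rewrite -(sum_triangle F) -(sum_triangle (fun j i => F i j)).
apply: eq_bigr => k _; rewrite [LHS](reindex_inj rev_ord_inj) /=.
by apply: eq_bigr => i _; rewrite subSS subKn // -ltnS.
Qed.

Section Substitution.
Variable (K : comNzRingType) (iota : ser K).
Hypothesis iota0 : iota 0%N = 0.

Lemma iota_exp_small t n : (n < t)%N -> (iota ^+ t) n = 0.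
Proof.
elim: t n => // t IH n; rewrite ltnS => nt; rewrite exprS ser_mulE.
rewrite big_ord_recl iota0 mul0r add0r big1 // => i _.
rewrite IH ?mulr0 //= /bump add1n.
case: n i nt => [[] //|n] i nt.
by rewrite subSS (leq_ltn_trans (leq_subr _ _)).
Qed.

(** Composition of [f] with [iota]; the sum may stop at n because [iota] has no constant term. *)
Definition subst (f : ser K) : ser K := fun n => \sum_(t < n.+1) f t * (iota ^+ t) n.

Lemma subst_widen f n N : (n <= N)%N ->
  subst f n = \sum_(t < N.+1) f t * (iota ^+ t) n.
Proof.
move=> nN; rewrite /subst (big_ord_widen N.+1 (fun t => f t * (iota ^+ t) n)) //.
rewrite [RHS](bigID (fun t : 'I_N.+1 => (t < n.+1)%N)) /= [X in _ = _ + X]big1 ?addr0 //.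
by move=> t; rewrite -leqNgt => nt; rewrite iota_exp_small ?mulr0.
Qed.

Lemma subst_is_additive : additive subst.
Proof.
move=> f g; apply: funext => n; rewrite ser_subE /subst -sumrB.
by apply: eq_bigr => t _; rewrite ser_subE mulrBl.
Qed.

Lemma subst_is_multiplicative : multiplicative subst.
Proof.
split=> [f g|]; apply: funext => n; last first.
  rewrite /subst big_ord_recl expr0 big1 ?addr0 => [|t _].
    by rewrite mul1r.
  by rewrite mul0r.
rewrite [RHS]ser_mulE.
transitivity (\sum_(t < n.+1) \sum_(i < t.+1) f i * g (t - i)%N * (iota ^+ (i + (t - i))) n).
  apply: eq_bigr => t _; rewrite ser_mulE big_distrl /=; apply: eq_bigr => i _.
  by rewrite subnKC // -ltnS.
rewrite (sum_triangle (fun i j => f i * g j * (iota ^+ (i + j)) n)).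
transitivity (\sum_(i < n.+1) \sum_(j < n.+1) f i * g j * (iota ^+ (i + j)) n).
  apply: eq_bigr => i _.
  rewrite (big_ord_widen n.+1 (fun j => f i * g j * (iota ^+ (i + j)) n)); last first.
    by rewrite ltnS leq_subr.
  rewrite [RHS](bigID (fun j : 'I_n.+1 => (j < (n - i).+1)%N)) /=.
  rewrite [X in _ = _ + X]big1 ?addr0 // => j; rewrite -leqNgt => h.
  by rewrite iota_exp_small ?mulr0 // -ltn_subLR // -ltnS.
transitivity (\sum_(m < n.+1) \sum_(i < n.+1) \sum_(j < n.+1)
    (f i * (iota ^+ i) m) * (g j * (iota ^+ j) (n - m)%N)); last first.
  apply: eq_bigr => m _; rewrite (@subst_widen f m n) -1?ltnS //.
  rewrite (@subst_widen g (n - m) n) ?leq_subr // big_distrl.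
  by apply: eq_bigr => i _; rewrite big_distrr.
rewrite [RHS]exchange_big; apply: eq_bigr => i _; rewrite [RHS]exchange_big; apply: eq_bigr => j _ /=.
rewrite exprD ser_mulE big_distrr /=; apply: eq_bigr => m _.
by rewrite mulrACA.
Qed.
HB.instance Definition _ := GRing.isAdditive.Build (ser K) (ser K) subst subst_is_additive.
HB.instance Definition _ := GRing.isMultiplicative.Build (ser K) (ser K) subst subst_is_multiplicative.

Lemma subst_X : subst serX = iota.
Proof.
apply: funext => n; rewrite /subst; case: n => [|n].
  by rewrite big_ord1 mul0r iota0.
rewrite big_ord_recl mul0r add0r big_ord_recl expr1 mul1r big1 ?addr0 // => i _.
by rewrite mul0r.
Qed.

Lemma subst_C c : subst (serC c) = serC c.
Proof.
apply: funext => n; rewrite /subst big_ord_recl expr0 big1 ?addr0 => [|t _].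
  by rewrite /= ser_oneE /serC; case: n => [|n]; rewrite ?mulr1 ?mulr0.
by rewrite mul0r.
Qed.

Lemma subst_0 f : subst f 0%N = f 0%N.
Proof. by rewrite /subst big_ord1 expr0 mulr1. Qed.
End Substitution.

(** * Restriction of a series F(x, y) to y = x *)

Section Diagonal.
Variable K : comNzRingType.
Definition diag (F : ser (ser K)) : ser K := fun n => \sum_(r < n.+1) F r (n - r)%N.
Lemma diag_is_additive : additive diag.
Proof.
by move=> f g; apply: funext => n; rewrite ser_subE /diag -sumrB; apply: eq_bigr.
Qed.
Lemma diag_is_multiplicative : multiplicative diag.
Proof.
split=> [F G|]; apply: funext => n; last first.
  rewrite /diag big_ord_recl subn0 big1 ?addr0 //.
pose H r1 t1 r2 t2 := F r1 t1 * G r2 t2.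
transitivity (\sum_(r1 < n.+1) \sum_(r2 < (n - r1).+1) \sum_(t1 < (n - r1 - r2).+1)
    H r1 t1 r2 (n - r1 - r2 - t1)%N).
  rewrite -(sum_triangle (fun r1 r2 => \sum_(t1 < (n - r1 - r2).+1) H r1 t1 r2 (n - r1 - r2 - t1)%N)).
  apply: eq_bigr => r _; rewrite ser_mulE ser_sumE; apply: eq_bigr => r1 _.
  by rewrite -subnDA subnKC -1?ltnS // ser_mulE.
rewrite [RHS]ser_mulE.
transitivity (\sum_(m < n.+1) \sum_(r1 < m.+1) \sum_(r2 < (n - (r1 + (m - r1))).+1)
    H r1 (m - r1)%N r2 (n - (r1 + (m - r1)) - r2)%N); last first.
  apply: eq_bigr => m _; rewrite big_distrl; apply: eq_bigr => r1 _ /=.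
  by rewrite subnKC -1?ltnS // big_distrr.
rewrite (sum_triangle (fun r1 t1 => \sum_(r2 < (n - (r1 + t1)).+1) H r1 t1 r2 (n - (r1 + t1) - r2)%N)).
apply: eq_bigr => r1 _.
rewrite (sum_triangle_swap (fun r2 t1 => H r1 t1 r2 (n - r1 - r2 - t1)%N)).
apply: eq_bigr => t1 _; rewrite -subnDA; apply: eq_bigr => r2 _.
by rewrite -!subnDA; congr (H _ _ _ (_ - _)%N); rewrite -!addnA [(r2 + _)%N]addnC.
Qed.
HB.instance Definition _ := GRing.isAdditive.Build (ser (ser K)) (ser K) diag diag_is_additive.
HB.instance Definition _ := GRing.isMultiplicative.Build (ser (ser K)) (ser K) diag diag_is_multiplicative.
End Diagonal.

(** * The substitution u -> c - u *)

Section Sigma.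
Variable K : fieldType.
Implicit Types (c : K) (f g : ser K).

Lemma inv_c_minus_u0 c : (inv_c_minus_u c : ser K) 0%N = 0. Proof. by []. Qed.
Definition sig c : ser K -> ser K := subst (inv_c_minus_u c).
HB.instance Definition _ c := GRing.isAdditive.Build (ser K) (ser K) (sig c)
  (@subst_is_additive K (inv_c_minus_u c)).
HB.instance Definition _ c := GRing.isMultiplicative.Build (ser K) (ser K) (sig c)
  (subst_is_multiplicative (inv_c_minus_u0 c)).

(** The form x -> -x / (1 - c x) of the substitution, without denominators; it reduces later
    computations with [sig] to ring identities. *)
Lemma sig_X c : (1 - serC c * serX) * sig c serX = - serX.
Proof.
rewrite /sig subst_X //; apply: funext => n.
rewrite mulrBl mul1r ser_subE -mulrA serC_mulE serX_mulE ser_oppE /serX.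
case: n => [|[|n]]; first by rewrite mulr0 subrr oppr0.
  by rewrite /inv_c_minus_u /= expr0 mulr0 subr0.
by rewrite /inv_c_minus_u /= exprS mulrN opprK addNr oppr0.
Qed.
Lemma sig_C c d : sig c (serC d) = serC d. Proof. exact: subst_C. Qed.
Lemma sig_0 c f : sig c f 0%N = f 0%N. Proof. exact: subst_0. Qed.

Lemma lcf_lpow (f : nat -> K) r :
  lcf (lpow (lps f) r) = (f : ser K) ^+ r.
Proof.
elim: r => [|r IH] //.
by rewrite exprS; apply: funext => k; rewrite /lpow iterS /= -/(lpow _ _) IH.
Qed.
Lemma psubstE c f : psubst c f = sig c f.
Proof. by apply: funext => k; apply: eq_bigr => r _; rewrite lcf_lpow. Qed.

(** The restriction of F to the curve v = c - u: the inner variable y is replaced by the image of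
    x. *)
Definition evc c (F : ser (ser K)) : ser K := diag (ser_map (sig c) F).
Lemma evc_is_additive c : additive (evc c).
Proof. by move=> F G; rewrite /evc !rmorphB. Qed.
Lemma evc_is_multiplicative c : multiplicative (evc c).
Proof. by split=> [F G|]; rewrite /evc ?rmorphM ?rmorph1. Qed.
HB.instance Definition _ c := GRing.isAdditive.Build _ _ (evc c) (evc_is_additive c).
HB.instance Definition _ c :=
  GRing.isMultiplicative.Build _ _ (evc c) (evc_is_multiplicative c).

Lemma diag_serC f : diag (serC f) = f.
Proof.
apply: funext => n; rewrite /diag big_ord_recl subn0 big1 ?addr0 //.
Qed.
Lemma diag_map_serC f : diag (ser_map (@serC K) f) = f.
Proof.
apply: funext => n; rewrite /diag big_ord_recr /= subnn big1 ?add0r // => i _.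
by rewrite /ser_map /serC subn_eq0 leqNgt ltn_ord.
Qed.
Lemma evc_x c f : evc c (ser_map (@serC K) f) = f.
Proof.
rewrite -[RHS]diag_map_serC /evc; congr diag; apply: funext => r.
by rewrite /ser_map /= sig_C.
Qed.
Lemma evc_y c f : evc c (serC f) = sig c f.
Proof.
rewrite -[RHS]diag_serC /evc; congr diag; apply: funext => -[|r] //=.
by rewrite /ser_map /= raddf0.
Qed.

Lemma ser_unit f : f 0%N != 0 -> exists g, f * g = 1.
Proof.
move=> f0.
(* [s n] lists the first n coefficients of the inverse; the next entry is forced by the coefficient
   of degree n of the product. *)
pose step (s : seq K) := rcons s (((size s == 0%N)%:R
   - \sum_(i < size s) f (size s - i)%N * s`_i) / f 0%N).
pose s n := iter n step [::].
have size_s n : size (s n) = n by elim: n => //= n IH; rewrite size_rcons IH.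
have nth_s n m i : (i < n)%N -> (n <= m)%N -> (s m)`_i = (s n)`_i.
  move=> i_n /subnK <-; elim: (m - n)%N => // k IH.
  by rewrite addSn /= nth_rcons size_s ifT // ltn_addl.
exists (fun n => (s n.+1)`_n); apply: funext => n; rewrite mulrC ser_mulE.
rewrite big_ord_recr /= subnn nth_rcons size_s ltnn eqxx mulfVK // addrC.
rewrite ser_oneE; apply/eqP; rewrite -addrA -[X in _ == X]addr0 (inj_eq (addrI _)) addrC subr_eq0.
apply/eqP; apply: eq_bigr => i _; rewrite mulrC; congr (_ * _).
by rewrite (nth_s i.+1 n).
Qed.

Lemma ser_cancel f g h : f 0%N != 0 -> f * g = f * h -> g = h.
Proof.
move=> /ser_unit [f' ff'] e.
by rewrite -[g]mul1r -[h]mul1r -ff' [f * f']mulrC -!mulrA e.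
Qed.

Lemma serX_cancel f g : serX * f = serX * g -> f = g.
Proof.
move=> e; apply: funext => n; have := congr1 (fun h : ser K => h n.+1) e.
by rewrite !serX_mulE.
Qed.

Lemma lser_eqP (X Y : lser K) : lsh X = lsh Y -> lser_eq X Y <-> lcf X = lcf Y.
Proof.
move=> e; split=> [h|h a]; last by rewrite /lcoef e h.
apply: funext => k; have := h ((lsh X)%:Z - k%:Z).
by rewrite /lcoef -e lerBlDr lerDl /= subKr.
Qed.

Lemma lcfM (X Y : lser K) : lcf (lM X Y) = (lcf X : ser K) * lcf Y.
Proof. by []. Qed.

(** The positive power of u contributes c - u = u (c x - 1). *)
Lemma lcf_lsubst1 c X : lsh X = 1%N ->
  lcf (lsubst c X) = (serC c * serX - 1) * sig c (lcf X).
Proof.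
move=> e; rewrite /lsubst lcfM psubstE e.
suff -> : lcf (lpow (lD (lC c) (lZ (-1) (lU K))) 1) = (serC c * serX - 1 : ser K) by [].
rewrite -[lpow _ 1]/(lM _ _) lcfM -[lcf (l1 K)]/(1 : ser K) mulr1; apply: funext => k.
rewrite ser_subE serC_mulE /serX /= ser_oneE.
by case: k => [|[|k]]; rewrite /= ?(mulr0, mulr1, add0r, sub0r, addr0, subr0) ?oppr0.
Qed.

Lemma lsh_lsubst1 c (X : lser K) : lsh X = 1%N -> lsh (lsubst c X) = 1%N.
Proof. by move=> e; rewrite /lsubst e. Qed.

Lemma lcf_lsubst0 c X : lsh X = 0%N -> lcf (lsubst c X) = sig c (lcf X).
Proof.
by move=> e; rewrite /lsubst lcfM psubstE e -[lcf (lpow _ 0)]/(1 : ser K) mul1r.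
Qed.
End Sigma.

(** * The conditions on the weight in terms of power series *)

Section Conditions.
Variables (K : fieldType) (kappa : nat) (par : 'I_kappa -> bool).
Implicit Type mu : 'I_kappa -> ser K.

Definition tail mu (i : 'I_kappa) : ser K :=
  \sum_(a : 'I_kappa | (i < a)%N) serC (sgn par a) * mu a.
Definition rho1 (i : 'I_kappa) : K := rho par i.+1.
(** The series [mu_tilde] divided by u. *)
Definition Fser mu (i : 'I_kappa) : ser K :=
  (2%:R - serC (rho1 i) * serX) * mu i + serX * tail mu i.

Lemma big_lD (I : Type) (r : seq I) (P : pred I) (F : I -> nat -> K) :
  \big[@lD K/l0 K]_(i <- r | P i) Lser 0 (F i) =
  Lser 0 (\sum_(i <- r | P i) (F i : ser K)).
Proof.
elim/big_rec2: _ => // i y _ _ ->; rewrite /lD /=; congr Lser.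
by apply: funext => k; rewrite !subn0.
Qed.

Lemma lsh_mu_tilde mu i : lsh (mu_tilde par mu i) = 1%N.
Proof.
rewrite /mu_tilde (eq_bigr (fun a => Lser 0 (fun k => sgn par a * mu a k))) //.
by rewrite big_lD.
Qed.

Lemma lcf_mu_tilde mu i : lcf (mu_tilde par mu i) = Fser mu i.
Proof.
rewrite /mu_tilde (eq_bigr (fun a => Lser 0 (fun k => sgn par a * mu a k))) //.
rewrite big_lD; apply: funext => k.
pose X := lM (lD (lZ 2 (lU K)) (lC (- rho par i.+1))) (mu_ser mu i).
pose T : ser K := \sum_(a : 'I_kappa | (i < a)%N) ((fun k => sgn par a * mu a k) : ser K).
have eX : lcf X = (2%:R - serC (rho1 i) * serX : ser K) * mu i.
  rewrite /X lcfM; congr ((_ : ser K) * _).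
  apply: funext => j; rewrite ser_subE serC_mulE /=.
  have -> : (2%:R : ser K) j = if j == 0%N then 2%:R else 0.
    by rewrite -[2%:R]/(1 + 1 : ser K) ser_addE ser_oneE; case: eqP; rewrite ?addr0.
  rewrite /serX; case: j => [|[|j]];
  by rewrite /= ?(mulr0, mulr1, add0r, sub0r, addr0, subr0, mulN1r) ?oppr0.
have eT : T = tail mu i.
  by apply: eq_bigr => a _; apply: funext => j; rewrite serC_mulE.
rewrite -/X -/T /Fser -eX -eT ser_addE serX_mulE.
rewrite -[lcf _ k]/((if (0 <= k)%N then lcf X (k - 0)%N else 0) +
   (if (1 <= k)%N then T (k - 1)%N else 0)) /= subn0; congr (_ + _).
by case: k => // k; rewrite /= subn1.
Qed.

Lemma cond_last mu i : lser_eq (lM (mu_ser mu i) (lsubst 0 (mu_ser mu i))) (l1 K)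
  <-> mu i * sig 0 (mu i) = 1.
Proof.
rewrite lser_eqP // lcfM lcf_lsubst0 //; by split.
Qed.

Lemma cond_step mu i j c :
  lser_eq (lM (mu_tilde par mu i) (lsubst c (mu_tilde par mu i)))
          (lM (mu_tilde par mu j) (lsubst c (mu_tilde par mu j)))
  <-> Fser mu i * sig c (Fser mu i) = Fser mu j * sig c (Fser mu j).
Proof.
rewrite lser_eqP; last first.
  have lshM (X Y : lser K) : lsh (lM X Y) = (lsh X + lsh Y)%N by [].
  rewrite (lshM _ (lsubst c (mu_tilde par mu i))) (lshM _ (lsubst c (mu_tilde par mu j))).
  by rewrite !lsh_lsubst1 !lsh_mu_tilde.
rewrite (lcfM _ (lsubst c (mu_tilde par mu i))) (lcfM _ (lsubst c (mu_tilde par mu j))).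
rewrite !lcf_lsubst1 ?lsh_mu_tilde // !lcf_mu_tilde.
rewrite (mulrCA (Fser mu i)) (mulrCA (Fser mu j)).
(* Both sides carry the factor c x - 1 produced by the substitution in u, and it is a unit. *)
split=> [|-> //]; apply: ser_cancel.
by rewrite ser_subE serC_mulE mulr0 sub0r oppr_eq0 oner_eq0.
Qed.
End Conditions.

Section DownwardInduction.
Variable kappa : nat.

Lemma big_gt_last (V : nmodType) (G : 'I_kappa -> V) (i : 'I_kappa) :
  i.+1 = kappa -> \sum_(a : 'I_kappa | (i < a)%N) G a = 0.
Proof.
move=> e; rewrite big_pred0 // => a; apply/negbTE; rewrite -leqNgt -ltnS e.
exact: ltn_ord.
Qed.

Lemma big_gt_step (V : nmodType) (G : 'I_kappa -> V) (i j : 'I_kappa) :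
  nat_of_ord j = i.+1 ->
  \sum_(a : 'I_kappa | (i < a)%N) G a = G j + \sum_(a : 'I_kappa | (j < a)%N) G a.
Proof.
move=> e; rewrite (bigD1 j) ?e //=; congr (_ + _); apply: eq_bigl => a.
by rewrite -val_eqE /= e [in RHS]ltn_neqAle eq_sym andbC.
Qed.

Lemma ord_down_ind (P : 'I_kappa -> Prop) :
  (forall i : 'I_kappa, i.+1 = kappa -> P i) ->
  (forall i j : 'I_kappa, nat_of_ord j = i.+1 -> P j -> P i) -> forall i, P i.
Proof.
move=> h0 hS i; have [n] : exists n, (i + n.+1 = kappa)%N.
  by exists (kappa - i.+1)%N; rewrite addnS -addSn subnKC.
elim: n i => [|n IH] i e; first by apply: h0; move: e; rewrite addn1.
have ij : (i.+1 < kappa)%N.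
  by move: (leq_addr n i); rewrite -ltnS -ltnS -addnS -addnS e.
by apply: (hS i (Ordinal ij)) => //; apply: IH; move: e; rewrite /= addSnnS.
Qed.
End DownwardInduction.

(** * Effect of a dressing on the weight *)

Section DressedScalars.
Variables (K : fieldType) (kappa : nat) (par : 'I_kappa -> bool).
Variables (l : 'I_kappa -> K) (mu : 'I_kappa -> ser K).
Local Notation X := (serX : ser K).
Local Notation phi := (phi_ser par l).
Local Notation mu' := (dress_weight par l mu).
Local Notation s a := (serC (sgn par a) : ser K).
Local Notation rh i := (serC (rho1 K par i)).

Lemma rho1_sum (i : 'I_kappa) :
  rh i = \sum_(a : 'I_kappa | (i < a)%N) s a.
Proof. by rewrite /rho1 /rho rmorph_sum. Qed.

Lemma phi_ser_eq i : phi i = 1 + X * (serC (l i) * phi i +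
  \sum_(a : 'I_kappa | (i < a)%N) s a * (phi i - phi a)).
Proof.
apply: funext => -[|r]; rewrite ser_addE serX_mulE ser_oneE /= ?addr0 // add0r.
rewrite ser_addE serC_mulE ser_sumE {1}/phi_ser /=; congr (_ + _).
by apply: eq_bigr => a _; rewrite serC_mulE.
Qed.

Lemma phi_ser_tail i : phi i * (1 - (serC (l i) + rh i) * X) = 1 - X * tail par phi i.
Proof.
rewrite rho1_sum /tail.
have e : \sum_(a : 'I_kappa | (i < a)%N) s a * (phi i - phi a) =
   (\sum_(a : 'I_kappa | (i < a)%N) s a) * phi i - \sum_(a : 'I_kappa | (i < a)%N) s a * phi a.
  by rewrite big_distrl -sumrB; apply: eq_bigr => a _; rewrite mulrBr.
have := phi_ser_eq i; rewrite e.
set S := \sum_(a : _ | _) s a; set T := \sum_(a : _ | _) _ => h.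
have -> : phi i * (1 - (serC (l i) + S) * X) = phi i - X * (serC (l i) * phi i + (S * phi i - T)) - X * T by ring.
by rewrite {1}h; ring.
Qed.

Lemma tail_step nu (i j : 'I_kappa) : nat_of_ord j = i.+1 ->
  tail par nu i = s j * nu j + tail par nu j :> ser K.
Proof. exact: (big_gt_step (fun a => s a * nu a)). Qed.

Lemma tail_last nu (i : 'I_kappa) : i.+1 = kappa -> tail par nu i = 0 :> ser K.
Proof. exact: (big_gt_last (fun a => s a * nu a)). Qed.

Lemma rho1_step (i j : 'I_kappa) : nat_of_ord j = i.+1 -> rh i = s j + rh j.
Proof. by move=> e; rewrite !rho1_sum (big_gt_step _ e). Qed.

Lemma rho1_last (i : 'I_kappa) : i.+1 = kappa -> rh i = 0.
Proof. by move=> e; rewrite rho1_sum big_gt_last. Qed.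

Lemma phi_ser_step (i j : 'I_kappa) : nat_of_ord j = i.+1 ->
  phi i * (1 - (serC (l i) + rh i) * X) = phi j * (1 - (serC (l j) + rh i) * X).
Proof.
move=> e; rewrite phi_ser_tail (tail_step _ e) (rho1_step e).
have -> : phi j * (1 - (serC (l j) + (s j + rh j)) * X) =
  phi j * (1 - (serC (l j) + rh j) * X) - X * (s j * phi j) by ring.
by rewrite phi_ser_tail; ring.
Qed.

Lemma sig_linear c d :
  (1 - serC c * X) * sig c (1 + serC d * X) = 1 - (serC d + serC c) * X.
Proof.
rewrite rmorphD rmorph1 rmorphM /= sig_C mulrDr mulr1.
have -> : (1 - serC c * X) * (serC d * sig c X) = serC d * ((1 - serC c * X) * sig c X) by ring.
by rewrite sig_X; ring.
Qed.

Lemma unit_linear (c : K) : (1 - serC c * X : ser K) 0%N != 0.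
Proof. by rewrite ser_subE serC_mulE mulr0 subr0 oner_neq0. Qed.

(** Up to the unit 1 - c x, the linear factors in [phi_ser_step] are images under [sig] of 1 + l x.
    This ties [phi] to the freely chosen factors 1 + l x. *)
Lemma phi_sig_step (i j : 'I_kappa) : nat_of_ord j = i.+1 ->
  phi i * sig (rho1 K par i) (1 + serC (l i) * X) =
  phi j * sig (rho1 K par i) (1 + serC (l j) * X).
Proof.
move=> e; apply: (ser_cancel (unit_linear (rho1 K par i))).
rewrite !(mulrCA (1 - _)) !sig_linear; exact: phi_ser_step.
Qed.

Lemma phi_sig_last (i : 'I_kappa) : i.+1 = kappa ->
  phi i * sig 0 (1 + serC (l i) * X) = 1.
Proof.
move=> e; apply: (ser_cancel (unit_linear 0)).
rewrite (mulrCA (1 - _)) sig_linear.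
have -> : serC 0 = rh i by rewrite (rho1_last e) raddf0.
rewrite phi_ser_tail tail_last // mulr0 subr0 mulr1 (rho1_last e); ring.
Qed.

Lemma dress_weightE i : mu' i = (1 + serC (l i) * X) * phi i * mu i
  + X * (phi i * tail par mu i - tail par (fun a => phi a * mu a) i).
Proof.
rewrite /dress_weight [X * serC _]mulrC mulrA; congr (_ + X * _).
rewrite /tail big_distrr -sumrB; apply: eq_bigr => a _ /=; ring.
Qed.

(** A closed form is needed because [Fser] involves the whole tail. In the downward induction
    [phi_ser_tail] trades the tail of [phi] for a single [phi j]. *)
Lemma tail_dress i : tail par mu' i =
  - (1 - X * tail par phi i) * tail par mu i
  + (2%:R - X * rh i) * tail par (fun a => phi a * mu a) i.
Proof.
elim/ord_down_ind: i => [i e|i j e IH]; first by rewrite !tail_last //; ring.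
rewrite !(tail_step _ e) IH dress_weightE (rho1_step e).
have h := phi_ser_tail j.
have -> : 1 - X * (s j * phi j + tail par phi j) =
    phi j * (1 - (serC (l j) + rh j) * X) - X * (s j * phi j) by rewrite h; ring.
rewrite -h; ring.
Qed.

(** A dressing mixes [mu i] with all later weights, but these combinations are only rescaled. *)
Lemma Fser_dress i : Fser par mu' i = (1 + serC (l i) * X) * phi i * Fser par mu i.
Proof.
rewrite /Fser tail_dress -phi_ser_tail dress_weightE; ring.
Qed.
End DressedScalars.

(** * Fock space *)

(* Operators act on all functions on occupation numbers, so that no finiteness
   of support has to be maintained. *)
Definition config := nat -> int.

Section Operators.
Variable K : fieldType.
Definition state := config -> K.

Record operator := Operator {
  op_fun :> state -> state;
  op_linear : forall c f g,
    op_fun (fun n => c * f n + g n) = (fun n => c * op_fun f n + op_fun g n) }.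

HB.instance Definition _ := gen_eqMixin operator.
HB.instance Definition _ := gen_choiceMixin operator.

Lemma operatorP (A B : operator) : (forall f n, A f n = B f n) -> A = B.
Proof.
case: A B => [A hA] [B hB] /= e.
have {}e : A = B by apply: funext => f; apply: funext => n.
by case: _ / e hB => hB; congr Operator; exact: Prop_irrelevance.
Qed.

Program Definition op0 := @Operator (fun _ _ => 0) _.
Next Obligation. by apply: funext => n; rewrite mulr0 addr0. Qed.
Definition op1 := @Operator (fun f => f) (fun c f g => erefl).
Program Definition opD (A B : operator) := @Operator (fun f n => A f n + B f n) _.
Next Obligation. by apply: funext => n; rewrite !op_linear mulrDr addrACA. Qed.
Program Definition opN (A : operator) := @Operator (fun f n => - A f n) _.
Next Obligation. by apply: funext => n; rewrite op_linear opprD mulrN. Qed.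
Program Definition opM (A B : operator) := @Operator (fun f => A (B f)) _.
Next Obligation. by rewrite !op_linear. Qed.

Lemma opDA : associative opD.
Proof. by move=> A B C; apply: operatorP => f n; exact: addrA. Qed.
Lemma opDC : commutative opD.
Proof. by move=> A B; apply: operatorP => f n; exact: addrC. Qed.
Lemma op0D : left_id op0 opD.
Proof. by move=> A; apply: operatorP => f n; exact: add0r. Qed.
Lemma opND : left_inverse op0 opN opD.
Proof. by move=> A; apply: operatorP => f n; exact: addNr. Qed.
HB.instance Definition _ := GRing.isZmodule.Build operator opDA opDC op0D opND.

Lemma opMA : associative opM. Proof. by move=> A B C; exact: operatorP. Qed.
Lemma op1M : left_id op1 opM. Proof. by move=> A; exact: operatorP. Qed.
Lemma opM1 : right_id op1 opM. Proof. by move=> A; exact: operatorP. Qed.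
Lemma opMDl : left_distributive opM +%R.
Proof. by move=> A B C; exact: operatorP. Qed.
Lemma opMDr : right_distributive opM +%R.
Proof.
move=> A B C; apply: operatorP => f n /=.
have -> : (fun m => B f m + C f m) = (fun m => 1 * B f m + C f m).
  by apply: funext => m; rewrite mul1r.
by rewrite op_linear mul1r.
Qed.
Lemma op1_neq0 : op1 != 0.
Proof.
by apply/eqP => /(congr1 (fun A : operator => A (fun=> 1) (fun=> 0)))/eqP; rewrite /= oner_eq0.
Qed.
HB.instance Definition _ := GRing.Zmodule_isNzRing.Build operator
  opMA op1M opM1 opMDl opMDr op1_neq0.

Lemma opDE (A B : operator) f n : (A + B) f n = A f n + B f n. Proof. by []. Qed.
Lemma opNE (A : operator) f n : (- A) f n = - A f n. Proof. by []. Qed.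
Lemma opME (A B : operator) f : (A * B) f = A (B f). Proof. by []. Qed.

Program Definition opC (c : K) := @Operator (fun f n => c * f n) _.
Next Obligation. by apply: funext => n; rewrite mulrDr !mulrA (mulrC c). Qed.
Lemma opC_additive : additive opC.
Proof. by move=> a b; apply: operatorP => f n; rewrite /= mulrBl. Qed.
Lemma opC_multiplicative : multiplicative opC.
Proof. by split=> [a b|]; apply: operatorP => f n; rewrite /= ?mulrA ?mul1r. Qed.
HB.instance Definition _ := GRing.isAdditive.Build K operator opC opC_additive.
HB.instance Definition _ := GRing.isMultiplicative.Build K operator opC opC_multiplicative.
Lemma opC_comm c (A : operator) : opC c * A = A * opC c.
Proof.
apply: operatorP => f n; rewrite !opME /=.
have := op_linear A c f (fun=> 0).
have -> : (fun n => c * f n + 0) = (fun n => c * f n) by apply: funext => m; rewrite addr0.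
have -> : A (fun=> 0) = (fun=> 0).
  have := op_linear A (-1) (fun=> 0) (fun=> 0).
  rewrite (_ : (fun n => _) = (fun=> 0)); last by apply: funext => m; rewrite mulr0 addr0.
  by move=> ->; apply: funext => m; rewrite mulN1r addNr.
by move=> ->; rewrite addr0.
Qed.
End Operators.

Lemma op_signE (K : fieldType) m (A : operator K) f n :
  ((-1) ^+ m * A) f n = (-1) ^+ m * A f n.
Proof.
elim: m f n => [|m IH] f n; first by rewrite mul1r mul1r.
by rewrite !exprS -mulrA -[RHS]mulrA !mulN1r opNE IH.
Qed.

Definition shift (n : config) p (d : int) : config :=
  fun q => if q == p then n q + d else n q.

Lemma shift_comm n p q d e : shift (shift n p d) q e = shift (shift n q e) p d.
Proof.
apply: funext => r; rewrite /shift; case: eqP => // _; case: eqP => // _.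
by rewrite addrAC.
Qed.

Lemma shift_add n p d e : shift (shift n p d) p e = shift n p (d + e).
Proof. by apply: funext => r; rewrite /shift; case: eqP => // _; rewrite addrA. Qed.

Lemma shift0 n p : shift n p 0 = n.
Proof. by apply: funext => r; rewrite /shift addr0 if_same. Qed.

Definition oddz (m : int) := odd `|m|%N.
Lemma oddzD m d : oddz (m + d) = oddz m (+) oddz d.
Proof.
rewrite /oddz. lia.
Qed.

(** * Even and odd oscillators on functions of occupation numbers *)

Section Oscillators.
Variables (K : fieldType) (pp : nat -> bool).

(** Jordan-Wigner sign: the parity of the total occupation of the odd modes below [p]. It makes
    distinct odd modes anticommute. *)
Fixpoint jw p (n : config) : bool :=
  if p is q.+1 then jw q n (+) (pp q && oddz (n q)) else false.

Lemma jw_shift q n p d : oddz d ->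
  jw q (shift n p d) = jw q n (+) ((p < q)%N && pp p).
Proof.
move=> hd; elim: q => [|q IH] //=; rewrite IH /shift ltnS.
case: (eqVneq q p) => [->|nqp].
  rewrite ltnn leqnn oddzD hd; case: (pp p) (jw p n) (oddz (n p)) => [] [] [] //.
by rewrite [(p <= q)%N]leq_eqVlt [p == q]eq_sym (negPf nqp) /= addbAC.
Qed.

Program Definition osc p (d : int) (v : int -> K) : operator K :=
  @Operator K (fun f n => (-1) ^+ (pp p && jw p n) * v (n p) * f (shift n p d)) _.
Next Obligation. by apply: funext => n; rewrite mulrDr mulrCA. Qed.

Lemma oscE p d v f n :
  osc p d v f n = (-1) ^+ (pp p && jw p n) * v (n p) * f (shift n p d).
Proof. by []. Qed.

Lemma osc_comm p q d e u v : p != q -> oddz d -> oddz e ->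
  osc p d u * osc q e v = (-1) ^+ (pp p * pp q) * (osc q e v * osc p d u).
Proof.
move=> npq hd he; apply: operatorP => f n; rewrite op_signE !opME !oscE.
rewrite !jw_shift // shift_comm.
have -> : shift n p d q = n q by rewrite /shift eq_sym (negPf npq).
have -> : shift n q e p = n p by rewrite /shift (negPf npq).
have [lt|lt|e0] := ltngtP p q; last by rewrite e0 eqxx in npq.
  rewrite /=; case: (pp p) (pp q) (jw p n) (jw q n) => [] [] [] [] /=; ring.
rewrite /=; case: (pp p) (pp q) (jw p n) (jw q n) => [] [] [] [] /=; ring.
Qed.

Lemma osc_same p d e u v f n : oddz d -> oddz e ->
  (osc p d u * osc p e v) f n = u (n p) * v (n p + d) * f (shift n p (d + e)).
Proof.
move=> hd he; rewrite opME !oscE jw_shift // ltnn addbF shift_add.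
have -> : shift n p d p = n p + d by rewrite /shift eqxx.
by case: (pp p && jw p n); rewrite ?expr0 ?expr1; ring.
Qed.

Variables (up dn : nat -> int -> K).
(** Operators act on functions, so reading the argument at occupation n - 1 raises. Occupation
    numbers run over all integers: the hypotheses on [up] and [dn] then have no boundary cases, and
    the vacuum is protected by zeros of the amplitudes. *)
Definition raise p := osc p (-1) (up p).
Definition lower p := osc p 1 (dn p).
Hypothesis ccr : forall p m,
  dn p m * up p (m + 1) - (-1) ^+ pp p * (up p m * dn p (m - 1)) = 1.
Hypothesis up_sq : forall p m, pp p -> up p m * up p (m - 1) = 0.
Hypothesis dn_sq : forall p m, pp p -> dn p m * dn p (m + 1) = 0.

Lemma raise_raise p q : raise p * raise q = (-1) ^+ (pp p * pp q) * (raise q * raise p).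
Proof.
have [<-|npq] := eqVneq p q; last exact: osc_comm.
apply: operatorP => f n; rewrite op_signE !osc_same //.
case: (boolP (pp p)) => [hp|_]; last by rewrite mul1r.
by rewrite up_sq // !mul0r mulr0.
Qed.

Lemma lower_lower p q : lower p * lower q = (-1) ^+ (pp p * pp q) * (lower q * lower p).
Proof.
have [<-|npq] := eqVneq p q; last exact: osc_comm.
apply: operatorP => f n; rewrite op_signE !osc_same //.
case: (boolP (pp p)) => [hp|_]; last by rewrite mul1r.
by rewrite dn_sq // !mul0r mulr0.
Qed.

Lemma lower_raise p q :
  lower p * raise q = (-1) ^+ (pp p * pp q) * (raise q * lower p) + (p == q)%:R.
Proof.
have [<-|npq] := eqVneq p q; last by rewrite addr0; exact: osc_comm.
apply: operatorP => f n; rewrite opDE op_signE !osc_same // ?addrN ?addNr !shift0.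
rewrite mulnb andbb mulrA -[X in _ = _ + X]mul1r -mulrDl; congr (_ * _).
by have /eqP := ccr p (n p); rewrite subr_eq => /eqP ->; rewrite [LHS]addrC.
Qed.

Definition vacuum : state K := fun n => (`[< n = (fun=> 0) >])%:R.

Lemma vacuum0 : vacuum (fun=> 0) = 1.
Proof. by rewrite /vacuum asboolT. Qed.

Lemma vacuum_shift n p d : n p + d != 0 -> vacuum (shift n p d) = 0.
Proof.
move=> h; rewrite /vacuum; case: asboolP => // /(congr1 (fun n : config => n p)).
by rewrite /shift eqxx => e; rewrite e eqxx in h.
Qed.

Lemma lower_vacuum p : dn p (-1) = 0 -> lower p vacuum = fun=> 0.
Proof.
move=> h; apply: funext => n; rewrite oscE.
have [e|ne] := eqVneq (n p) (-1); first by rewrite e h mulr0 mul0r.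
by rewrite vacuum_shift ?mulr0 // -[1]opprK subr_eq0.
Qed.

Lemma raise_vacuum p : up p 1 = 0 -> raise p vacuum = fun=> 0.
Proof.
move=> h; apply: funext => n; rewrite oscE.
have [e|ne] := eqVneq (n p) 1; first by rewrite e h mulr0 mul0r.
by rewrite vacuum_shift ?mulr0 // subr_eq0.
Qed.

Lemma raise_lower_vacuum p n :
  (raise p * lower p) vacuum n = up p 0 * dn p (-1) * vacuum n.
Proof.
rewrite osc_same // addNr shift0 /vacuum.
by case: asboolP => [->|_]; rewrite ?mulr0 // add0r.
Qed.
End Oscillators.

(** * Realizations of Verma modules *)

Section Realization.
Variables (K : fieldType) (A : nzRingType) (iota : {rmorphism K -> A}).
Hypothesis iota_central : forall c a, iota c * a = a * iota c.
Variable N : A -> Prop.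
Hypothesis N_ideal : is_left_ideal N.
Hypothesis N_proper : ~ N 1.
Variables (kappa : nat) (par eps : 'I_kappa -> bool).
Variables (B : 'M[ser A]_kappa) (mu : 'I_kappa -> ser K).
Hypothesis B_refl : reflection_eq par B.
Hypothesis B_unit : unitarity B.
Hypothesis B_const : forall i j, B i j 0%N = (i == j)%:R * (-1) ^+ eps i.
Hypothesis B_hw : highest_weight iota N B mu.

Let b i j r : A := B i j r.
Definition word_image (m : {fmonom gen_t kappa}) : A :=
  \prod_(g <- (m : seq _)) b g.1.1 g.1.2 g.2.+1.

Lemma word_image_morph : mmorphism word_image.
Proof.
split=> [m1 m2|]; first by rewrite /word_image fmM big_cat.
by rewrite /word_image fm1 big_nil.
Qed.
HB.instance Definition _ := monalg.isMultiplicative.Build _ A word_image word_image_morph.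

Definition represent : FreeAlg K kappa -> A := mmap iota word_image.
Lemma represent_is_additive : additive represent.
Proof. exact: raddfB. Qed.
Lemma represent_is_multiplicative : multiplicative represent.
Proof. by apply: commr_mmap_is_multiplicative => g m m'; exact: iota_central. Qed.
HB.instance Definition _ := GRing.isAdditive.Build (FreeAlg K kappa) A represent represent_is_additive.
HB.instance Definition _ := GRing.isMultiplicative.Build (FreeAlg K kappa) A represent represent_is_multiplicative.

Lemma represent_gen i j r : represent (bgen K i j r.+1) = b i j r.+1.
Proof.
by rewrite /represent /bgen mmapU /= rmorph1 mul1r /= /word_image fmU big_seq1.
Qed.

Lemma represent_scal c : represent (c%:A) = iota c.
Proof. by rewrite /represent mmapZ mmap1 mulr1. Qed.

Let b' i j r : A := represent (bgen K i j r).

Lemma represent_bser i j r : bser eps b' i j r = b i j r.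
Proof.
rewrite /bser; case: r => [|r] /=; last exact: represent_gen.
by rewrite /b B_const.
Qed.

Lemma bmat_represent : bmat eps b' = B.
Proof.
by apply/matrixP => i j; rewrite mxE; apply: funext => r; exact: represent_bser.
Qed.

Lemma represent_relator x : tsy_relators par eps x -> represent x = 0.
Proof.
case=> [[a [c [i [j [k [l ->]]]]]]|[n [i [q ->]]]].
  rewrite -/(reflection_relator par eps (@bgen K kappa) a c i j k l).
  by rewrite reflection_relator_map; apply: reflection_relator0; rewrite bmat_represent.
rewrite rmorphB unitary_coef_map unitary_coefE rmorph_nat.
have e : \sum_(r < n.+1) \sum_j bser eps b' i j r * ((-1) ^+ (n - r) * bser eps b' j q (n - r)%N)
    = ((n == 0%N) && (i == q))%:R.
  have /(congr1 (fun M : 'M[ser A]_kappa => M i q n)) := B_unit.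
  rewrite mxE ser_sumE [RHS](_ : _ = ((n == 0%N) && (i == q))%:R) => [<-|]; last first.
    by rewrite mxone mulrb; case: eqP => _; rewrite ?andbF ?andbT.
  rewrite exchange_big; apply: eq_bigr => j _; rewrite ser_mulE.
  by apply: eq_bigr => r _; rewrite !represent_bser mxE.
rewrite e; case: (n == 0%N); last by rewrite mulr0 subrr.
case: eqP => [->|_]; last by rewrite mulr0 subrr.
by rewrite mulr1 (@sign_odd A _ 0) ?subrr //; case: (par q).
Qed.

(** The preimage of [N] under [represent] is a left ideal of the free algebra that contains all
    generators of the Verma ideal and misses 1. *)
Theorem realization_nontrivial : verma_nontrivial par eps mu.
Proof.
pose J x := N (represent x).
have J_ideal : is_left_ideal J.
  split=> [|x y|a x]; rewrite /J.
  - by rewrite rmorph0; exact: N0.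
  - by rewrite rmorphD; exact: ND.
  - by rewrite rmorphM; exact: NM.
have ker_ideal : is_twosided_ideal (fun x => represent x = 0).
  split=> [|a x e]; last by rewrite rmorphM /= e mul0r.
  split=> [|x y ex ey|a x e]; first exact: rmorph0.
    by rewrite rmorphD /= ex ey addr0.
  by rewrite rmorphM /= e mulr0.
move=> h; have := h J J_ideal; rewrite /J rmorph1 => /(_ _)/N_proper; apply=> y [hy|].
  rewrite /J (_ : represent y = 0); first exact: N0.
  by apply: (hy (fun x => represent x = 0)) => // x; exact: represent_relator.
have [hup hdiag] := B_hw.
case=> [[i [j [r [ij ->]]]]|[i [r ->]]]; rewrite /J.
  by rewrite bser_map represent_bser; exact: hup.
rewrite rmorphB bser_map represent_bser.
apply: (eq_ind _ N (hdiag i r)); congr (_ - _); apply/esym; exact: represent_scal.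
Qed.
End Realization.

(** * Supercommutation of independent families of oscillators *)

Section Supercommutation.
Variable S : pzRingType.
Definition superc (a b : S) (n : nat) := a * b = (-1) ^+ n * (b * a).
Lemma superc_mulr a b c n m : superc a b n -> superc a c m -> superc a (b * c) (n + m).
Proof.
rewrite /superc => h1 h2; rewrite mulrA h1 -!mulrA h2 [b * (_ ^+ m * _)]mulrA (commr_sign b) -!mulrA.
by rewrite [LHS]mulrA -exprD.
Qed.
Lemma superc_mull a b c n m : superc a c n -> superc b c m -> superc (a * b) c (n + m).
Proof.
rewrite /superc => h1 h2; rewrite -mulrA h2 [a * (_ ^+ m * _)]mulrA (commr_sign a) -!mulrA.
by rewrite [a * (c * b)]mulrA h1 -!mulrA [LHS]mulrA -exprD addnC.
Qed.
Lemma superc_signl a b n m : superc a b n -> superc ((-1) ^+ m * a) b n.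
Proof.
rewrite /superc => h; rewrite -mulrA h [b * (_ ^+ m * _)]mulrA (commr_sign b) -!mulrA.
by rewrite [LHS]mulrA [RHS]mulrA -!exprD addnC.
Qed.
Lemma superc_signr a b n m : superc a b n -> superc a ((-1) ^+ m * b) n.
Proof.
rewrite /superc => h; rewrite mulrA (commr_sign a) -!mulrA h.
by rewrite [LHS]mulrA [RHS]mulrA -!exprD addnC.
Qed.

Variables (kappa : nat) (par : 'I_kappa -> bool) (sg sg' : bool).
Variables (psi phi psi' phi' : 'I_kappa -> S).
Let sc x y := forall i k, superc (x i) (y k) ((par i (+) sg) * (par k (+) sg')).
Hypotheses (h1 : sc psi psi') (h2 : sc psi phi') (h3 : sc phi psi') (h4 : sc phi phi').

Lemma scomm0_osc : scomm0 par (osc_mx par psi phi) (osc_mx par psi' phi').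
Proof.
apply/on12_comm => i j k l; rewrite !mxE.
have := superc_signl (par j) (superc_signr (par l)
  (superc_mull (superc_mulr (h1 i k) (h2 i l)) (superc_mulr (h3 j k) (h4 j l)))).
rewrite /superc => ->; rewrite mulrA -exprD; congr (_ * _); apply: sign_odd.
by case: (par i) (par j) (par k) (par l) sg sg' => [] [] [] [] [] [].
Qed.
End Supercommutation.

(** * The constant diagonal solution *)

Section Base.
Variables (A : pzRingType) (kappa : nat) (par eps : 'I_kappa -> bool).
Local Notation SA := (ser (ser A)).

Definition base_mx : 'M[ser A]_kappa :=
  \matrix_(i, j) serC ((i == j)%:R * (-1) ^+ eps i).

Lemma base_unit : unitarity base_mx.
Proof.
apply/matrixP => i j; rewrite mxE (bigD1 i) //= big1 ?addr0 => [|k ki]; last first.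
  by rewrite !mxE eq_sym (negPf ki) mul0r raddf0 mul0r.
rewrite !mxE eqxx mul1r; apply: funext => n.
rewrite serC_mulE /serN; case: n => [|n]; last first.
  by rewrite /= !mulr0; case: (i == j).
rewrite /= mul1r; case: eqP => [->|_]; last by rewrite mul0r mulr0.
by rewrite mul1r -expr2 sqrr_sign.
Qed.

Lemma base_scomm E : scomm par E base_mx.
Proof.
apply/scommP => i j k l r; rewrite !mxE /serC; case: r => [|r] /=; last first.
  by rewrite mul0r !mulr0.
case: eqP => [->|_]; last by rewrite mul0r mul0r !mulr0.
by rewrite mul1r commr_sign.
Qed.

Lemma base_refl : reflection_eq par base_mx.
Proof.
pose G : 'M[SA]_kappa := \matrix_(i, j) serC (serC ((i == j)%:R * (-1) ^+ eps i)).
have Gx : map_mx (ser_map (@serC A)) base_mx = G.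
  apply/matrixP => i j; rewrite !mxE; apply: funext => -[|r] //=.
  by rewrite /ser_map /= raddf0.
have Gy : map_mx (@serC (ser A)) base_mx = G by apply/matrixP => i j; rewrite !mxE.
have GG : G * G = 1.
  apply/matrixP => i j; rewrite mxM (bigD1 i) //= big1 ?addr0 => [|k ki]; last first.
    by rewrite !mxE eq_sym (negPf ki) mul0r !raddf0 mul0r.
  rewrite mxone !mxE eqxx mul1r; have [_|_] := eqVneq i j; last by rewrite mul0r !raddf0 mulr0.
  by rewrite mul1r -!rmorphM -expr2 sqrr_sign !rmorph1.
have GC : on1 par G * on2 G = on2 G * on1 par G.
  apply/on12_comm => i j k l; rewrite !mxE.
  have [<-|_] := eqVneq k l; last by rewrite mul0r !raddf0 mul0r !mulr0.
  rewrite -!rmorphM; congr (_ * serC (serC _)).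
  by rewrite mul1r commr_sign.
rewrite /reflection_eq /refl_lhs /refl_rhs Gx Gy Rminus_mxE Rplus_mxE.
apply: constant_reflection.
- exact: sw_invol.
- exact: sw_on1.
- exact: sw_on2.
- rewrite -on1M GG -[1]/(1%:M) on11; reflexivity.
- rewrite -on2M GG -[1]/(1%:M) on21; reflexivity.
- exact: GC.
- exact: cenx_comm.
- exact: ceny_comm.
Qed.
End Base.

(** * Chains of dressings *)

Section Chain.
Variables (K : fieldType) (kappa : nat) (par eps : 'I_kappa -> bool).
Variables (kk : nat -> 'I_kappa) (ll : nat -> K).

(* Step t of the chain creates a highest weight vector whose weight is
   -s_k for i < k, ll t for i = k and 0 for i > k, where k = kk t.  This needs
   phi_i to kill the vacuum for i > k and psi_i to kill it for i < k, so the
   roles of creation and annihilation are exchanged for i < k.  Amplitudes of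
   the odd modes depend on the parity of the occupation number only. *)
Definition mode_par p : bool :=
  if (unpickle p : option (nat * 'I_kappa)) is Some (t, i)
  then par i (+) par (kk t) else false.

Definition mode_up p (m : int) : K :=
  if (unpickle p : option (nat * 'I_kappa)) is Some (t, i) then
    if par i (+) par (kk t) then (oddz m (+) (i < kk t)%N)%:R
    else if (i < kk t)%N then (m - 1)%:~R else 1
  else 1.

Definition mode_dn p (m : int) : K :=
  if (unpickle p : option (nat * 'I_kappa)) is Some (t, i) then
    if par i (+) par (kk t) then (~~ oddz m (+) (i < kk t)%N)%:R
    else if (i < kk t)%N then 1
    else (m + 1)%:~R + (if i == kk t then sgn par i * ll t else 0)
  else (m + 1)%:~R.

Lemma mode_ccr p m : mode_dn p m * mode_up p (m + 1)
  - (-1) ^+ mode_par p * (mode_up p m * mode_dn p (m - 1)) = 1.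
Proof.
rewrite /mode_dn /mode_up /mode_par.
case: (unpickle p) => [[t i]|]; last by rewrite !mul1r subrK intrD; ring.
case: (par i (+) par (kk t)); last first.
  case: (i < kk t)%N; first by rewrite addrK !mul1r intrB; ring.
  by rewrite subrK intrD; ring.
rewrite !oddzD -[oddz (- 1)]/true -[oddz 1]/true.
by case: (oddz m) (i < kk t)%N => [] [] /=; ring.
Qed.

Lemma mode_up_sq p m : mode_par p -> mode_up p m * mode_up p (m - 1) = 0.
Proof.
rewrite /mode_up /mode_par; case: (unpickle p) => [[t i]|] // ->.
rewrite oddzD -[oddz (- 1)]/true.
by case: (oddz m) (i < kk t)%N => [] [] /=; rewrite ?mul0r ?mulr0.
Qed.

Lemma mode_dn_sq p m : mode_par p -> mode_dn p m * mode_dn p (m + 1) = 0.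
Proof.
rewrite /mode_dn /mode_par; case: (unpickle p) => [[t i]|] // ->.
rewrite oddzD -[oddz 1]/true.
by case: (oddz m) (i < kk t)%N => [] [] /=; rewrite ?mul0r ?mulr0.
Qed.

(** All modes of all steps share one linear order, as the Jordan-Wigner signs require. *)
Definition enc t (i : 'I_kappa) : nat := pickle ((t, i) : nat * 'I_kappa).
Lemma enc_par t i : mode_par (enc t i) = par i (+) par (kk t).
Proof. by rewrite /mode_par pickleK. Qed.
Lemma enc_eq t i s j : (enc t i == enc s j) = (t == s) && (i == j).
Proof. by rewrite /enc (inj_eq (pcan_inj pickleK)). Qed.

Definition psi t i := raise mode_par mode_up (enc t i).
Definition phi t i := lower mode_par mode_dn (enc t i).
Definition Emx t : 'M[operator K]_kappa := osc_mx par (psi t) (phi t).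

(** The parity shift by [par (kk t)] makes the mode of index [kk t] even. Its lowering amplitude may
    then be shifted by any constant without harm to the commutation relation, which is why [ll t] is
    arbitrary. *)
Lemma Emx_gl t : gl_rel par (Emx t).
Proof.
apply: (@osc_mx_gl _ _ _ (par (kk t))) => i k; rewrite -!enc_par.
- exact: raise_raise mode_up_sq _ _.
- exact: lower_lower mode_dn_sq _ _.
rewrite /phi /psi (lower_raise mode_ccr) enc_eq eqxx.
by [].
Qed.

Lemma Emx_scomm0 s t : s != t -> scomm0 par (Emx s) (Emx t).
Proof.
move=> st; apply: (@scomm0_osc _ _ _ (par (kk s)) (par (kk t))) => i k;
  rewrite -!enc_par; apply: osc_comm => //; by rewrite enc_eq (negPf st).
Qed.

Definition kills (a : operator K) := forall n, a (vacuum K) n = 0.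

Lemma operator0 (a : operator K) : a (fun=> 0) = fun=> 0.
Proof.
have := op_linear a (-1) (fun=> 0) (fun=> 0).
rewrite (_ : (fun n => _) = (fun=> 0)); last by apply: funext => m; rewrite mulr0 addr0.
by move=> ->; apply: funext => m; rewrite mulN1r addNr.
Qed.

Lemma kills_fun a : kills a -> a (vacuum K) = fun=> 0.
Proof. by move=> h; apply: funext. Qed.

Lemma kills_ideal : is_left_ideal kills.
Proof.
split=> [n|a b ha hb n|a b hb n] //; first by rewrite opDE ha hb addr0.
by rewrite opME (kills_fun hb) operator0.
Qed.

Lemma kills_proper : ~ kills 1.
Proof. by move=> /(_ (fun=> 0))/eqP; rewrite /= vacuum0 oner_eq0. Qed.

Lemma psi_kills t (i : 'I_kappa) : (i < kk t)%N -> kills (psi t i).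
Proof.
move=> ik n; rewrite /psi raise_vacuum // /mode_up pickleK ik.
by case: ifP => _; rewrite ?subrr.
Qed.

Lemma phi_kills t (i : 'I_kappa) : (kk t < i)%N -> kills (phi t i).
Proof.
move=> ki n; rewrite /phi lower_vacuum // /mode_dn pickleK ltnNge ltnW //=.
case: ifP => _ //; rewrite addNr add0r; case: eqP => // e.
by rewrite e ltnn in ki.
Qed.

Definition Ewt t (i : 'I_kappa) : K :=
  if (i < kk t)%N then - sgn par (kk t) else if i == kk t then ll t else 0.

(** For i < j the two oscillators supercommute, so either may act first: [psi t i] kills the vacuum
    if i < k, and otherwise k < j and [phi t j] does. *)
Lemma Emx_up t (i j : 'I_kappa) : (i < j)%N -> kills (Emx t i j).
Proof.
move=> ij; rewrite mxE; apply: (NM kills_ideal).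
have [ik|ki] := ltnP i (kk t); last first.
  by apply: (NM kills_ideal); apply: phi_kills; exact: leq_ltn_trans ij.
have e : phi t j * psi t i = (-1) ^+ (mode_par (enc t j) * mode_par (enc t i)) * (psi t i * phi t j).
  rewrite /phi /psi (lower_raise mode_ccr) enc_eq eqxx -val_eqE eq_sym ltn_eqF //.
  by rewrite addr0.
apply: (N_sign kills_ideal (m := mode_par (enc t j) * mode_par (enc t i))).
by rewrite -e; apply: (NM kills_ideal); exact: psi_kills.
Qed.

Lemma Emx_diag t i : eqN (@opC K) kills (Emx t i i) (Ewt t i).
Proof.
rewrite /Ewt mxE; have [ik|ki|e] := ltngtP i (kk t).
(* Here [psi] must act first; the constant from the reordering produces the weight -s_k. *)
- have e : psi t i * phi t i = (-1) ^+ (par i (+) par (kk t)) * (phi t i * psi t i - 1).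
    rewrite /phi /psi (lower_raise mode_ccr) eqxx addrK enc_par mulnb andbb.
    by rewrite mulrA -expr2 sqrr_sign mul1r.
  rewrite e mulrA -exprD mulrBr mulr1.
  rewrite -[X in eqN _ _ _ X]add0r; apply: (eqND kills_ideal).
    apply/(eqN0 _ kills); apply: (NM kills_ideal); apply: (NM kills_ideal); exact: psi_kills.
  rewrite (@sign_odd _ _ (par (kk t))); last by case: (par i) (par (kk t)) => [] [].
  rewrite -(rmorph_sign (@opC K)); apply: (eqNN kills_ideal); exact: (eqN_iota _ kills_ideal).
- rewrite -val_eqE gtn_eqF //=; apply/(eqN0 _ kills).
  by apply: (NM kills_ideal); apply: (NM kills_ideal); exact: phi_kills.
move/val_inj: e => e; rewrite e eqxx => n.
(* On the vacuum the amplitudes give s_k [ll t], and the sign in [osc_mx] removes s_k. *)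
rewrite opDE opNE op_signE /psi /phi raise_lower_vacuum /mode_up /mode_dn pickleK.
rewrite addbb ltnn eqxx addNr add0r mul1r !mulrA /= /sgn -expr2 sqrr_sign mul1r.
by rewrite subrr.
Qed.

Fixpoint chain_mx t : 'M[ser (operator K)]_kappa :=
  if t is t'.+1 then dress (Emx t') (chain_mx t') else base_mx _ eps.

Fixpoint chain_weight t : 'I_kappa -> ser K :=
  if t is t'.+1 then dress_weight par (Ewt t') (chain_weight t')
  else fun i => serC ((-1) ^+ eps i).

Lemma chain_scomm t s : (t <= s)%N -> scomm par (Emx s) (chain_mx t).
Proof.
elim: t => [|t IH] ts; first exact: base_scomm.
apply: scomm_dress; last by apply: IH; exact: ltnW.
by apply: Emx_scomm0; rewrite gtn_eqF.
Qed.

Lemma chain_refl t : reflection_eq par (chain_mx t).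
Proof.
elim: t => [|t IH]; first exact: base_refl.
by apply: dress_refl; [exact: Emx_gl | exact: chain_scomm | exact: IH].
Qed.

Lemma chain_unit t : unitarity (chain_mx t).
Proof. elim: t => [|t IH]; [exact: base_unit | exact: dress_unit]. Qed.

Lemma chain_const t i j : chain_mx t i j 0%N = (i == j)%:R * (-1) ^+ eps i.
Proof.
elim: t i j => [|t IH] i j; first by rewrite mxE.
rewrite /= /dress mxM ser_sumE (bigD1 j) //= big1 ?addr0 => [|c cj]; last first.
  by rewrite ser_mul0E [fmx _ _ _]mxE expr0 mxone (negPf cj) mulr0.
rewrite ser_mul0E [fmx _ _ _]mxE expr0 mxone eqxx mulr1 mxM ser_sumE.
have e a c : (1 + xmx (Emx t) : 'M[ser (operator K)]_kappa) a c 0%N = (a == c)%:R.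
  have -> : (1 + xmx (Emx t) : 'M[ser (operator K)]_kappa) a c =
    (1 : 'M[ser (operator K)]_kappa) a c + xmx (Emx t) a c by rewrite mxE.
  rewrite ser_addE [xmx _ _ _]mxE serX_mulE addr0 mxone.
  by case: (a == c).
rewrite (bigD1 i) //= big1 ?addr0 => [|c ci]; last first.
  by rewrite ser_mul0E e eq_sym (negPf ci) mul0r.
by rewrite ser_mul0E e eqxx mul1r IH.
Qed.

Lemma chain_hw t : highest_weight (@opC K) kills (chain_mx t) (chain_weight t).
Proof.
elim: t => [|t IH].
  split=> [i j r ij|i r]; rewrite mxE /serC; case: r => [|r] /=.
  - by rewrite -val_eqE ltn_eqF // mul0r.
  - by [].
  - by rewrite eqxx mul1r -(rmorph_sign (@opC K)); exact: (eqN_iota _ kills_ideal).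
  by apply/(eqN0 _ kills); exact: (N0 kills_ideal).
apply: (dress_highest (@opC_comm K) kills_ideal (@Emx_gl t) _ _ IH).
- by move=> i j; exact: Emx_up.
- by move=> i; exact: Emx_diag.
exact: chain_scomm.
Qed.

Lemma chain_nontrivial t : verma_nontrivial par eps (chain_weight t).
Proof.
apply: (realization_nontrivial (@opC_comm K) kills_ideal (@kills_proper)
  (@chain_refl t) (@chain_unit t) (@chain_const t) (@chain_hw t)).
Qed.

Definition chain_gamma t (i : 'I_kappa) : ser K :=
  \prod_(s < t) (1 + serC (Ewt s i) * serX).
Definition chain_psi t (i : 'I_kappa) : ser K :=
  \prod_(s < t) phi_ser par (Ewt s) i.

Lemma chain_Fser t i : Fser par (chain_weight t) i =
  chain_gamma t i * chain_psi t i * Fser par (chain_weight 0) i.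
Proof.
elim: t => [|t IH]; first by rewrite /chain_gamma /chain_psi !big_ord0 !mul1r.
rewrite /= Fser_dress IH /chain_gamma /chain_psi !big_ord_recr /=; ring.
Qed.

Lemma chain_sig_step t (i j : 'I_kappa) : nat_of_ord j = i.+1 ->
  chain_psi t i * sig (rho1 K par i) (chain_gamma t i) =
  chain_psi t j * sig (rho1 K par i) (chain_gamma t j).
Proof.
move=> e; rewrite /chain_gamma /chain_psi !rmorph_prod -!big_split.
by apply: eq_bigr => s _; exact: phi_sig_step.
Qed.

Lemma chain_sig_last t (i : 'I_kappa) : i.+1 = kappa ->
  chain_psi t i * sig 0 (chain_gamma t i) = 1.
Proof.
move=> e; rewrite /chain_gamma /chain_psi !rmorph_prod -!big_split.
by rewrite big1 // => s _; exact: phi_sig_last.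
Qed.
End Chain.

(** * Approximation of weights *)

Section Symmetric.
Variables (K : fieldType) (c : K) (m t : ser K).
Local Notation X := (serX : ser K).
Let F := (2%:R - serC c * X) * m + X * t.

Definition wronsk : ser K := (2%:R - serC c * X) * (m * sig c m) + X * (t * sig c m - m * sig c t).

(** The last term does not involve [m]. For two weights with a common [t], comparing F sig(F) is
    therefore comparing [wronsk]. *)
Lemma Fser_sig : (1 - serC c * X) * (F * sig c F) =
  (2%:R - serC c * X) * wronsk - X * X * (t * sig c t).
Proof.
have e : (1 - serC c * X) * sig c F = (2%:R - serC c * X) * sig c m - X * sig c t.
  rewrite /F rmorphD !rmorphM rmorphB rmorph_nat rmorphM /= sig_C.
  transitivity ((2%:R * (1 - serC c * X) - serC c * ((1 - serC c * X) * sig c X)) * sig c m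
     + ((1 - serC c * X) * sig c X) * sig c t); first by ring.
  rewrite sig_X; ring.
rewrite mulrCA e /F /wronsk; ring.
Qed.
End Symmetric.

(** * Congruences modulo x^M *)

Section Congruence.
Variables (K : fieldType) (M : nat).
Implicit Types f g h : ser K.
Definition eqm f g := forall k, (k < M)%N -> f k = g k.
Lemma eqm_refl f : eqm f f. Proof. by []. Qed.
Lemma eqm_sym f g : eqm f g -> eqm g f. Proof. by move=> h k /h ->. Qed.
Lemma eqm_trans f g h : eqm f g -> eqm g h -> eqm f h.
Proof. by move=> h1 h2 k kM; rewrite h1 // h2. Qed.
Lemma eqmD f g f' g' : eqm f f' -> eqm g g' -> eqm (f + g) (f' + g').
Proof. by move=> h1 h2 k kM; rewrite !ser_addE h1 // h2. Qed.
Lemma eqmN f f' : eqm f f' -> eqm (- f) (- f').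
Proof. by move=> h1 k kM; rewrite !ser_oppE h1. Qed.
Lemma eqmM f g f' g' : eqm f f' -> eqm g g' -> eqm (f * g) (f' * g').
Proof.
move=> h1 h2 k kM; rewrite (ser_mulE f) (ser_mulE f'); apply: eq_bigr => i _.
rewrite h1 ?h2 //; first by rewrite (leq_ltn_trans (leq_subr _ _)).
by rewrite (leq_ltn_trans _ kM) // -ltnS.
Qed.
Lemma eqm_sum (I : Type) (r : seq I) (P : pred I) (F G : I -> ser K) :
  (forall i, P i -> eqm (F i) (G i)) ->
  eqm (\sum_(i <- r | P i) F i) (\sum_(i <- r | P i) G i).
Proof.
by move=> h k kM; rewrite !ser_sumE; apply: eq_bigr => i Pi; exact: h.
Qed.
Lemma eqm_sig c f f' : eqm f f' -> eqm (sig c f) (sig c f').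
Proof.
move=> h k kM; rewrite /sig /subst; apply: eq_bigr => i _; rewrite h //.
by rewrite (leq_ltn_trans _ kM) // -ltnS.
Qed.
Lemma eqm_cancel f f' g g' : f 0%N != 0 -> eqm f f' -> eqm (f * g) (f' * g') -> eqm g g'.
Proof.
move=> /ser_unit [h fh] e1 e2.
apply: (@eqm_trans _ (h * (f' * g'))).
  rewrite -{1}[g]mul1r -fh [f * h]mulrC -mulrA; apply: eqmM => //; exact: eqm_refl.
rewrite -{2}[g']mul1r -fh [f * h]mulrC -mulrA; apply: eqmM; first exact: eqm_refl.
by apply: eqmM; [exact: eqm_sym | exact: eqm_refl].
Qed.
End Congruence.

(** * Approximation of power series by products of linear factors *)

Section Factorization.
Variable K : closedFieldType.
Local Notation X := (serX : ser K).

Definition pser (p : {poly K}) : ser K := fun k => p`_k.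
Lemma pserM p q : pser (p * q) = pser p * pser q.
Proof. by apply: funext => k; rewrite /pser coefM. Qed.
Lemma pser1 : pser 1 = 1.
Proof. by apply: funext => k; rewrite /pser coef1. Qed.
Lemma pser_linear c : pser (1 + c *: 'X) = 1 + serC c * X.
Proof.
by apply: funext => k; rewrite ser_addE serC_mulE /pser coefD coefZ coef1 coefX.
Qed.

Lemma factor_approx M (f : ser K) : f 0%N = 1 ->
  exists s : seq K, eqm M (\prod_(c <- s) (1 + serC c * X)) f.
Proof.
(* One coefficient more than needed, so that the constant term 1 is present even for M = 0; it
   excludes the root 0. *)
move=> f0; pose p : {poly K} := \poly_(k < M.+1) f k.
have [r pr] := closed_field_poly_normal p.
have p0 : p.[0] = 1 by rewrite horner_coef0 coef_poly /= f0.
have e0 : lead_coef p * \prod_(z <- r) (- z) = 1.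
  have e := congr1 (fun q : {poly K} => q.[0]) pr.
  rewrite /= hornerZ horner_prod p0 in e; apply: etrans (esym e); congr (_ * _).
  by apply: eq_bigr => z _; rewrite hornerXsubC sub0r.
exists [seq - z^-1 | z <- r].
have -> : \prod_(c <- [seq - z^-1 | z <- r]) (1 + serC c * X) = pser p.
  have -> : p = \prod_(c <- [seq - z^-1 | z <- r]) (1 + c *: 'X).
    have zr : forall z, z \in r -> z != 0.
      move=> z zr; apply/eqP => z0; move/eqP: e0; rewrite (big_rem z) //= z0.
      by rewrite oppr0 mul0r mulr0 eq_sym oner_eq0.
    rewrite pr big_map -[RHS]scale1r -e0 -scalerA; congr (_ *: _).
    rewrite -scaler_prod !big_seq; apply: eq_bigr => z /zr z0.
    by rewrite scalerDr scalerA mulrNN mulfV // scale1r addrC -mul_polyC mulr1 polyCN.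
  by rewrite (big_morph pser pserM pser1); apply: eq_bigr => c _; rewrite pser_linear.
by move=> k kM; rewrite /pser coef_poly ltnS ltnW.
Qed.
End Factorization.

Section Approximation.
Variables (K : closedFieldType) (kappa : nat) (par eps : 'I_kappa -> bool).
Local Notation X := (serX : ser K).

Definition step_weight (d : 'I_kappa * K) (i : 'I_kappa) : K :=
  if (i < d.1)%N then - sgn par d.1 else if i == d.1 then d.2 else 0.
Definition steps_gamma (ds : seq ('I_kappa * K)) i : ser K :=
  \prod_(d <- ds) (1 + serC (step_weight d i) * X).

Lemma steps_gamma0 ds i : steps_gamma ds i 0%N = 1.
Proof.
rewrite /steps_gamma; elim: ds => [|d ds IH]; first by rewrite big_nil.
by rewrite big_cons ser_mul0E IH mulr1 ser_addE serC_mulE mulr0 addr0.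
Qed.

(** A step (k, c) multiplies the k-th product by 1 + c x, leaves the products of larger index alone
    and disturbs only those of smaller index. So the indices can be settled one at a time from the
    last to the first. *)
Lemma steps_approx M (G : 'I_kappa -> ser K) : (forall i, G i 0%N = 1) ->
  exists ds, forall i, eqm M (steps_gamma ds i) (G i).
Proof.
move=> G0; suff H n : exists ds, forall i : 'I_kappa, (kappa <= i + n)%N ->
    eqm M (steps_gamma ds i) (G i).
  by have [ds h] := H kappa; exists ds => i; apply: h; rewrite leq_addl.
elim: n => [|n [ds IH]]; first by exists [::] => i; rewrite addn0 leqNgt ltn_ord.
have [lt|ge] := ltnP n kappa; last first.
  by exists ds => i _; apply: IH; rewrite (leq_trans ge) ?leq_addl.
have lt' : (kappa - n.+1 < kappa)%N by rewrite ltn_subrL (leq_ltn_trans _ lt).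
pose i0 := Ordinal lt'.
have [g hg] : exists g, steps_gamma ds i0 * g = 1.
  by apply: ser_unit; rewrite steps_gamma0 oner_eq0.
have g0 : g 0%N = 1.
  by have := congr1 (fun f : ser K => f 0%N) hg; rewrite ser_mul0E steps_gamma0 mul1r.
have [|s hs] := @factor_approx K M (G i0 * g).
  by rewrite ser_mul0E G0 g0 mulr1.
exists (ds ++ [seq (i0, c) | c <- s]) => i hi.
rewrite /steps_gamma big_cat big_map -/(steps_gamma ds i) /=.
have [e|ne] := eqVneq i i0.
  rewrite e.
  have -> : \prod_(c <- s) (1 + serC (step_weight (i0, c) i0) * X) =
            \prod_(c <- s) (1 + serC c * X).
    by apply: eq_bigr => c _; rewrite /step_weight /= ltnn eqxx.
  have -> : G i0 = steps_gamma ds i0 * (G i0 * g) by rewrite mulrCA hg mulr1.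
  by apply: eqmM.
have gt : (i0 < i)%N.
  rewrite ltn_neqAle eq_sym val_eqE ne /= leq_subLR addnC.
  exact: hi.
rewrite big1 ?mulr1; last first.
  move=> c _; rewrite /step_weight /= ltnNge ltnW //= (negPf ne).
  by rewrite raddf0 mul0r addr0.
by apply: IH; move: gt hi => /=; lia.
Qed.

(** [J] collects what lies in the Verma ideal of every weight close enough to [mu]. It is a left
    ideal containing all generators for [mu], each of which sees at most one coefficient of the
    weight. *)
Lemma verma_nontrivial_limit (mu : 'I_kappa -> nat -> K) :
  (forall M, exists nu : 'I_kappa -> nat -> K,
     (forall i, eqm M (nu i) (mu i)) /\ verma_nontrivial par eps nu) ->
  verma_nontrivial par eps mu.
Proof.
move=> H h.
pose J x := exists M, forall nu : 'I_kappa -> nat -> K,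
  (forall i, eqm M (nu i) (mu i)) -> verma_ideal par eps nu x.
have J_ideal : is_left_ideal J.
  split=> [|x y [M hx] [M' hy]|a x [M hx]].
  - by exists 0%N => nu _ I [].
  - exists (maxn M M') => nu e I I_ideal gens; have [_ hadd _] := I_ideal.
    apply: hadd; [apply: (hx nu _ I) | apply: (hy nu _ I)] => // i k kM;
      by apply: e; rewrite leq_max kM ?orbT.
  - by exists M => nu e I I_ideal gens; have [_ _] := I_ideal; apply; exact: (hx nu e I).
have [M hM] : J 1.
  apply: (h J J_ideal) => y [hy|].
    by exists 0%N => nu _ I _; apply; left.
  case=> [[i [j [r [ij e]]]]|[i [r e]]].
    by exists 0%N => nu _ I _; apply; right; left; exists i, j, r.
  exists r.+1 => nu en I _; apply; right; right; exists i, r.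
  by rewrite e (en i r).
by have [nu [e]] := H M; apply; exact: hM.
Qed.
End Approximation.

Section Conditions.
Variables (K : fieldType) (kappa : nat) (par : 'I_kappa -> bool).
Hypothesis two_neq0 : 2%:R != 0 :> K.
Local Notation X := (serX : ser K).
Local Notation rh i := (rho1 K par i).

Lemma ser_nat0 n : (n%:R : ser K) 0%N = n%:R.
Proof. by elim: n => // n IH; rewrite !mulrS ser_addE IH. Qed.

Lemma serC_sign_sq n : serC ((-1) ^+ n) * serC ((-1) ^+ n) = 1 :> ser K.
Proof. by rewrite -rmorphM -expr2 sqrr_sign rmorph1. Qed.

Lemma Fser0 (mu : 'I_kappa -> ser K) i : Fser par mu i 0%N = 2%:R * mu i 0%N.
Proof.
by rewrite /Fser ser_addE serX_mulE addr0 ser_mul0E ser_subE serC_mulE mulr0 subr0 ser_nat0.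
Qed.

Lemma Fser_last (mu : 'I_kappa -> ser K) (i : 'I_kappa) : i.+1 = kappa ->
  Fser par mu i = 2%:R * mu i.
Proof. by move=> e; rewrite /Fser (rho1_last K par e) tail_last // mul0r subr0 mulr0 addr0. Qed.

(** The term s_j x mu_j occurs in the rho part and in the tail with opposite signs. *)
Lemma Fser_next (mu : 'I_kappa -> ser K) (i j : 'I_kappa) : nat_of_ord j = i.+1 ->
  Fser par mu j = (2%:R - serC (rh i) * X) * mu j + X * tail par mu i.
Proof.
by move=> e; rewrite /Fser (rho1_step K par e) (tail_step par mu e); ring.
Qed.

Lemma cond_wronsk (mu : 'I_kappa -> ser K) (i j : 'I_kappa) : nat_of_ord j = i.+1 ->
  (Fser par mu i * sig (rh i) (Fser par mu i) = Fser par mu j * sig (rh i) (Fser par mu j))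
  <-> wronsk (rh i) (mu i) (tail par mu i) = wronsk (rh i) (mu j) (tail par mu i).
Proof.
move=> e; rewrite (Fser_next _ e) /Fser; split=> h; last first.
  by apply: (ser_cancel (unit_linear (rh i))); rewrite !Fser_sig h.
have := congr1 (fun f => (1 - serC (rh i) * X) * f) h; rewrite !Fser_sig.
move/(addIr _); apply: ser_cancel.
by rewrite ser_subE serC_mulE mulr0 subr0 ser_nat0.
Qed.
End Conditions.

(** * Sufficiency of the conditions *)

Section Sufficiency.
Variables (K : closedFieldType) (kappa : nat) (par eps : 'I_kappa -> bool).
Hypothesis two_neq0 : 2%:R != 0 :> K.
Local Notation X := (serX : ser K).
Local Notation rh i := (rho1 K par i).
Variable mu : 'I_kappa -> ser K.
Hypothesis mu0 : forall i, mu i 0%N = (-1) ^+ eps i.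
Hypothesis cond1 : forall i : 'I_kappa, i.+1 = kappa -> mu i * sig 0 (mu i) = 1.
Hypothesis cond2 : forall i j : 'I_kappa, nat_of_ord j = i.+1 ->
  Fser par mu i * sig (rh i) (Fser par mu i) = Fser par mu j * sig (rh i) (Fser par mu j).

Let F0 i := Fser par (fun i => serC ((-1) ^+ eps i) : ser K) i.
Let F i := Fser par mu i.

Lemma F0_const i : F0 i 0%N = F i 0%N.
Proof. by rewrite /F0 /F !Fser0 mu0. Qed.
Lemma F_unit i : F i 0%N != 0.
Proof. by rewrite /F Fser0 mu0 mulf_neq0 // signr_eq0. Qed.

Lemma F0_cond (i j : 'I_kappa) : nat_of_ord j = i.+1 ->
  F0 i * sig (rh i) (F0 i) = F0 j * sig (rh i) (F0 j).
Proof.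
move=> e; apply/(cond_wronsk par two_neq0 _ e); rewrite /wronsk !sig_C.
have -> : sig (rh i) (tail par (fun i => serC ((-1) ^+ eps i)) i)
    = tail par (fun i => serC ((-1) ^+ eps i)) i.
  by rewrite /tail raddf_sum; apply: eq_bigr => a _; rewrite -rmorphM /= sig_C.
by rewrite !serC_sign_sq ![serC _ * tail _ _ _]mulrC !subrr.
Qed.

(* Hilbert 90 for the involution sig: if h * sig h = 1 then g = (1 + h) / 2
   satisfies g = h * sig g. *)
Lemma hilbert90 c (u v : ser K) : u 0%N = v 0%N -> u 0%N != 0 ->
  u * sig c u = v * sig c v -> exists g, g 0%N = 1 /\ v * g = u * sig c g.
Proof.
move=> e u0 h; have [w hw] := ser_unit (etrans (congr1 (fun x => x != 0) (esym e)) u0 : v 0%N != 0).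
have w0 : v 0%N * w 0%N = 1 by rewrite -ser_mul0E hw.
exists (serC 2%:R^-1 * (1 + u * w)); split.
  rewrite serC_mulE ser_addE ser_mul0E e w0 ser_oneE -[1 + 1]/2%:R.
  by rewrite mulVf.
rewrite rmorphM rmorphD rmorph1 rmorphM /= sig_C.
have hs : sig c v * sig c w = 1 by rewrite -rmorphM hw rmorph1.
have -> : v * (serC 2%:R^-1 * (1 + u * w)) = serC 2%:R^-1 * (v + u * (v * w)) by ring.
rewrite hw mulr1.
have -> : u * (serC 2%:R^-1 * (1 + sig c u * sig c w)) =
  serC 2%:R^-1 * (u + (u * sig c u) * sig c w) by ring.
by rewrite h -mulrA hs mulr1 addrC.
Qed.

(** The equations say F_i = gamma_i psi_i F0_i after psi has been eliminated by [chain_sig_last] and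
    [chain_sig_step] and denominators have been cleared. They constrain only the quotients of
    consecutive [G], so [G i] is the product of the Hilbert 90 solutions [g a] over a >= i. *)
Lemma exact_gamma : exists G : 'I_kappa -> ser K,
  [/\ forall i, G i 0%N = 1,
      forall i : 'I_kappa, i.+1 = kappa -> F i * sig 0 (G i) = F0 i * G i &
      forall i j : 'I_kappa, nat_of_ord j = i.+1 ->
        (F i * sig (rh i) (G i)) * (F0 j * G j) = (F j * sig (rh i) (G j)) * (F0 i * G i)].
Proof.
have hg (i : 'I_kappa) : exists g : ser K, g 0%N = 1 /\
    (i.+1 = kappa -> F0 i * g = F i * sig 0 g) /\
    (forall j : 'I_kappa, nat_of_ord j = i.+1 -> (F0 i * F j) * g = (F i * F0 j) * sig (rh i) g).
  have [e|ne] := eqVneq i.+1 kappa.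
    have [|||g [g0 hg]] := @hilbert90 0 (F i) (F0 i).
    - by rewrite F0_const.
    - exact: F_unit.
    - rewrite /F /F0 !Fser_last // !rmorphM !rmorph_nat /= sig_C.
      by rewrite mulrACA cond1 // [RHS]mulrACA serC_sign_sq.
    exists g; split=> //; split=> // j ej.
    by have := ltn_ord j; rewrite ej e ltnn.
  have lt : (i.+1 < kappa)%N by rewrite ltn_neqAle ne ltn_ord.
  pose j := Ordinal lt.
  (* The two norms agree by [cond2] for F and by [F0_cond] for the constant weight. *)
  have [|||g [g0 hg]] := @hilbert90 (rh i) (F i * F0 j) (F0 i * F j).
  - by rewrite !ser_mul0E !F0_const.
  - by rewrite ser_mul0E F0_const mulf_neq0 // F_unit.
  - rewrite !rmorphM /= mulrACA [RHS]mulrACA (cond2 (j := j)) // (@F0_cond i j) //.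
    by rewrite mulrC.
  exists g; split=> //; split=> [e|j' ej]; first by rewrite e eqxx in ne.
  by have -> : j' = j by apply: val_inj.
have [g hgg] := choice hg.
pose G (i : 'I_kappa) := g i * \prod_(a : 'I_kappa | (i < a)%N) g a.
have Gstep (i j : 'I_kappa) : nat_of_ord j = i.+1 -> G i = g i * G j.
  move=> e; rewrite /G; congr (_ * _); rewrite (bigD1 j) ?e //=; congr (_ * _).
  by apply: eq_bigl => a; rewrite -val_eqE /= e [in RHS]ltn_neqAle eq_sym andbC.
have Glast (i : 'I_kappa) : i.+1 = kappa -> G i = g i.
  move=> e; rewrite /G big_pred0 ?mulr1 // => a.
  by apply/negbTE; rewrite -leqNgt -ltnS e; exact: ltn_ord.
exists G; split=> [i|i e|i j e].
- elim/ord_down_ind: i => [i e|i j e IH]; first by rewrite Glast //; case: (hgg i).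
  by rewrite (Gstep _ _ e) ser_mul0E IH mulr1; case: (hgg i).
- by rewrite Glast //; case: (hgg i) => _ [/(_ e) -> _].
rewrite (Gstep _ _ e) rmorphM /=; case: (hgg i) => _ [_ /(_ j e) h].
transitivity (((F i * F0 j) * sig (rh i) (g i)) * (sig (rh i) (G j) * G j)); first by ring.
rewrite -h; ring.
Qed.

(** Without indices no step of a chain can be named; the constant solution suffices. *)
Lemma empty_nontrivial : (forall i : 'I_kappa, False) -> verma_nontrivial par eps mu.
Proof.
move=> no; apply: (realization_nontrivial (@opC_comm K) (kills_ideal K) (@kills_proper K)
  (base_refl _ par eps) (base_unit _ eps) (fun i => match no i with end)).
by split=> i; case: (no i).
Qed.

(** The system is triangular with unit diagonal coefficients 2 - rho_i x, so weights are recovered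
    from the last index downwards. *)
Lemma Fser_determines M (nu : 'I_kappa -> ser K) :
  (forall i, eqm M (Fser par nu i) (F i)) -> forall i, eqm M (nu i) (mu i).
Proof.
move=> h; suff H : forall i a : 'I_kappa, (i <= a)%N -> eqm M (nu a) (mu a).
  by move=> i; exact: (H i).
have key (i : 'I_kappa) : (forall a : 'I_kappa, (i < a)%N -> eqm M (nu a) (mu a)) ->
    eqm M (nu i) (mu i).
  move=> IH; pose d : ser K := 2%:R - serC (rh i) * X.
  apply: (@eqm_cancel K M d d); last 1 first.
  - have -> : d * nu i = Fser par nu i - X * tail par nu i by rewrite /Fser addrK.
    have -> : d * mu i = F i - X * tail par mu i by rewrite /F /Fser addrK.
    apply: eqmD => //; apply: eqmN; apply: eqmM; first exact: eqm_refl.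
    by apply: eqm_sum => a ia; apply: eqmM; [exact: eqm_refl | exact: IH].
  - by rewrite /d ser_subE serC_mulE mulr0 subr0 ser_nat0.
  - exact: eqm_refl.
elim/ord_down_ind => [i e|i j e IH] a ia.
  have -> : a = i by apply: val_inj; apply/eqP; rewrite eqn_leq ia -ltnS e ltn_ord.
  by apply: key => c; rewrite ltnNge -ltnS e ltn_ord.
have [lt|gt|/val_inj <-] := ltngtP i a.
- by apply: IH; rewrite e.
- by rewrite leqNgt gt in ia.
by apply: key => c ic; apply: IH; rewrite e.
Qed.

Theorem sufficiency : verma_nontrivial par eps mu.
Proof.
have [i0 _|no] := pickP (fun _ : 'I_kappa => true); last first.
  by apply: empty_nontrivial => i; have := no i.
apply: verma_nontrivial_limit => M; have [G [G0 Glast Gstep]] := exact_gamma.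
have [ds hds] := steps_approx par M G0.
pose kk t := (nth (i0, 0) ds t).1; pose ll t := (nth (i0, 0) ds t).2.
pose gm := chain_gamma par kk ll (size ds); pose ps := chain_psi par kk ll (size ds).
have gmE i : gm i = steps_gamma par ds i.
  by rewrite /steps_gamma (big_nth (i0, 0)) big_mkord.
have eg i : eqm M (gm i) (G i) by rewrite gmE; exact: hds.
have gm0 i : gm i 0%N = 1 by rewrite gmE steps_gamma0.
pose nu := chain_weight par eps kk ll (size ds).
exists nu; split; last exact: chain_nontrivial.
apply: Fser_determines; pose FC i := Fser par nu i.
have FCE i : FC i = gm i * ps i * F0 i by exact: chain_Fser.
(* Both sides are multiplied by a unit chosen so that the identities of [exact_gamma] apply to F and
   those of the chain, where psi sig(gamma) is constant from i to j, apply to [FC]. *)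
elim/ord_down_ind => [i e|i j e IH]; rewrite -/(FC i).
  apply: (@eqm_cancel K M (sig 0 (gm i)) (sig 0 (G i))).
  - by rewrite sig_0 gm0 oner_neq0.
  - exact: eqm_sig.
  rewrite [_ * F i]mulrC Glast // FCE.
  have -> : sig 0 (gm i) * (gm i * ps i * F0 i) = F0 i * (ps i * sig 0 (gm i)) * gm i by ring.
  by rewrite (chain_sig_last par kk ll _ e) mulr1; apply: eqmM; [exact: eqm_refl | exact: eg].
apply: (@eqm_cancel K M (sig (rh i) (gm i) * (F0 j * gm j)) (sig (rh i) (G i) * (F0 j * G j))).
- by rewrite !ser_mul0E sig_0 !gm0 mul1r mulr1 F0_const F_unit.
- by apply: eqmM; [exact: eqm_sig | apply: eqmM; [exact: eqm_refl | exact: eg]].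
have -> : sig (rh i) (G i) * (F0 j * G j) * F i = F i * sig (rh i) (G i) * (F0 j * G j) by ring.
rewrite (Gstep _ _ e).
have -> : sig (rh i) (gm i) * (F0 j * gm j) * FC i =
    FC j * sig (rh i) (gm j) * (F0 i * gm i).
  rewrite !FCE.
  transitivity (gm i * gm j * F0 i * F0 j * (ps i * sig (rh i) (gm i))); first by ring.
  have -> : ps i * sig (rh i) (gm i) = ps j * sig (rh i) (gm j) by exact: chain_sig_step.
  ring.
apply: eqmM; last by apply: eqmM; [exact: eqm_refl | exact: eg].
by apply: eqmM; [exact: IH | exact: eqm_sig].
Qed.
End Sufficiency.

(** * Necessity of the conditions *)

Section Relations.
Variables (A : pzRingType) (kappa : nat) (par : 'I_kappa -> bool).
Local Notation SA := (ser (ser A)).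
Local Notation M2 := (mm SA kappa).
Local Notation cx := (ser_map (@serC A)).
Local Notation cy := (@serC (ser A)).
Local Notation x := (vx A).
Local Notation y := (vy A).
Local Notation P := (sw SA par).
Variable B : 'M[ser A]_kappa.
Local Notation Bx := (map_mx cx B).
Local Notation By := (map_mx cy B).

Lemma refl_diff : refl_lhs par B - refl_rhs par B =
  cen kappa ((y - x) * (x + y)) * (on1 par Bx * on2 By - on2 By * on1 par Bx)
  - cen kappa ((y - x) * (x * y)) * (on1 par Bx * on1 par By * P - on2 By * on2 Bx * P)
  - cen kappa ((x * y) * (x + y)) * (P * (on1 par Bx * on2 By) - on2 By * on1 par Bx * P)
  + cen kappa ((x * y) * (x * y)) * (on2 Bx * on2 By - on2 By * on2 Bx).
Proof.
rewrite !cenM cenB cenD.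
have h := @reflection_expand _ P (on1 par Bx) (on1 par By) (on2 By) (on2 Bx) (cen kappa x) (cen kappa y) (sw_invol SA par) (sw_on1 par Bx) (sw_on2 par By)
  (@cenx_comm A kappa) (@ceny_comm A kappa).
rewrite /refl_lhs /refl_rhs Rminus_mxE Rplus_mxE; exact: h.
Qed.

Lemma cen_comb (c1 c2 c3 c4 : SA) (X1 Y1 X2 Y2 X3 Y3 X4 Y4 : M2) i j k l
    (x1 y1 x2 y2 x3 y3 x4 y4 : SA) :
  X1 i j k l = x1 -> Y1 i j k l = y1 -> X2 i j k l = x2 -> Y2 i j k l = y2 ->
  X3 i j k l = x3 -> Y3 i j k l = y3 -> X4 i j k l = x4 -> Y4 i j k l = y4 ->
  (cen kappa c1 * (X1 - Y1) - cen kappa c2 * (X2 - Y2) - cen kappa c3 * (X3 - Y3)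
    + cen kappa c4 * (X4 - Y4)) i j k l =
  c1 * (x1 - y1) - c2 * (x2 - y2) - c3 * (x3 - y3) + c4 * (x4 - y4).
Proof.
move=> <- <- <- <- <- <- <- <-.
have h c X Y : (cen kappa c * (X - Y)) i j k l = c * (X i j k l - Y i j k l).
  apply: etrans (cenM_E c (X - Y) i j k l) _; congr (_ * _); exact: mmB.
apply: etrans (mmD _ _ i j k l) _; congr (_ + _); last exact: h.
apply: etrans (mmB _ _ i j k l) _; congr (_ - _); last exact: h.
apply: etrans (mmB _ _ i j k l) _; congr (_ - _); exact: h.
Qed.

(** At this position multiplication by [P] picks out diagonal entries of B(u) B(v), B(v) B(u) and of
    [B]. The last summand of [refl_diff] is block diagonal and vanishes since i differs from a. *)
Lemma refl_entry (i a : 'I_kappa) : i != a ->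
  (refl_lhs par B - refl_rhs par B) i a a i =
  (-1) ^+ (par i * par a) *
  ((y - x) * (x + y) * (sgn par a * (Bx i a * By a i) - sgn par i * (By a i * Bx i a))
  - (y - x) * (x * y) * ((Bx * By) i i - (By * Bx) a a)
  - (x * y) * (x + y) * (Bx a a * By i i - By a a * Bx i i)).
Proof.
move=> nia; rewrite refl_diff.
have g1 : (on1 par Bx * on1 par By * P) i a a i = (-1) ^+ (par i * par a) * (Bx * By) i i.
  apply: etrans (congr1 (fun M : M2 => (M * P) i a a i) (esym (on1M par Bx By))) _.
  rewrite (swMr _ (on1 par (Bx * By))) on1E eqxx mulr1n commr_sign mulrA -exprD.
  congr (_ * _); apply: sign_odd; by case: (par i) (par a) => [] [].
have g2 : (on2 By * on2 Bx * P) i a a i = (-1) ^+ (par i * par a) * (By * Bx) a a.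
  have -> : on2 By * on2 Bx = on2 (By * Bx) by exact/esym/on2M.
  by rewrite (swMr _ (on2 (By * Bx))) on2E eqxx mulr1n commr_sign.
have g3 : (on2 Bx * on2 By) i a a i = 0.
  have -> : on2 Bx * on2 By = on2 (Bx * By) by exact/esym/on2M.
  by rewrite on2E (negPf nia).
have g4 : (on2 By * on2 Bx) i a a i = 0.
  have -> : on2 By * on2 Bx = on2 (By * Bx) by exact/esym/on2M.
  by rewrite on2E (negPf nia).
have g5 : (P * (on1 par Bx * on2 By)) i a a i = (-1) ^+ (par i * par a) * (Bx a a * By i i).
  rewrite (swMl _ (on1 par Bx * on2 By)) mul_on12 mulrA -exprD.
  congr (_ * _); apply: sign_odd; by case: (par i) (par a) => [] [].
have g6 : (on2 By * on1 par Bx * P) i a a i = (-1) ^+ (par i * par a) * (By a a * Bx i i).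
  rewrite (swMr _ (on2 By * on1 par Bx)) mul_on21 commr_sign mulrA -exprD.
  congr (_ * _); apply: sign_odd; by case: (par i) (par a) => [] [].
have g7 := mul_on12 par Bx By i a a i.
have g8 := mul_on21 par Bx By i a a i.
apply: etrans (cen_comb _ _ _ _ g7 g8 g1 g2 g5 g6 g3 g4) _.
clear g1 g2 g3 g4 g5 g6 g7 g8.
rewrite (subrr 0) mulr0 addr0.
rewrite -!mulrBr.
have -> : (-1) ^+ (par a * (par i + par a)) * (Bx i a * By a i) =
    (-1) ^+ (par i * par a) * (sgn par a * (Bx i a * By a i)).
  rewrite /sgn !mulrA -exprD; congr (_ * _ * _); apply: sign_odd.
  by case: (par i) (par a) => [] [].
have -> : (-1) ^+ (par i * (par i + par a)) * (By a i * Bx i a) =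
    (-1) ^+ (par i * par a) * (sgn par i * (By a i * Bx i a)).
  rewrite /sgn !mulrA -exprD; congr (_ * _ * _); apply: sign_odd.
  by case: (par i) (par a) => [] [].
have S (u v : SA) : u * ((-1) ^+ (par i * par a) * v) = (-1) ^+ (par i * par a) * (u * v).
  by rewrite mulrA commr_sign -mulrA.
rewrite -!mulrBr; rewrite !S -!mulrBr; reflexivity.
Qed.
End Relations.

(** * Series in two variables modulo the left ideal *)

Section SeriesIdeal.
Variables (K : comNzRingType) (A : pzRingType) (iota : {rmorphism K -> A}).
Hypothesis iota_central : forall c a, iota c * a = a * iota c.
Variable N : A -> Prop.
Hypothesis N_ideal : is_left_ideal N.

Definition serP (f : ser A) := forall n, N (f n).

Lemma serP_ideal : is_left_ideal serP.
Proof.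
split=> [n|f g hf hg n|f g hg n]; first exact: (N0 N_ideal).
  by rewrite ser_addE; apply: (ND N_ideal).
rewrite ser_mulE; apply: (Nsum N_ideal) => i _; exact: (NM N_ideal).
Qed.

Lemma ser_map_central c f : ser_map iota c * f = f * ser_map iota c.
Proof.
apply: funext => n; rewrite (ser_mulE _ f) (ser_mulE f) [LHS](reindex_inj rev_ord_inj) /=.
apply: eq_bigr => i _; rewrite subSS subKn -1?ltnS //.
exact: iota_central.
Qed.
End SeriesIdeal.

Section Transpose.
Variable R : pzRingType.
Definition tr (F : ser (ser R)) : ser (ser R) := fun r t => F t r.
Lemma tr_is_additive : additive tr.
Proof. by move=> F G; apply: funext => r; apply: funext => t. Qed.
Lemma tr_is_multiplicative : multiplicative tr.
Proof.
split=> [F G|]; apply: funext => r; apply: funext => t; last first.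
  by rewrite /tr; case: r t => [|r] [|t].
have -> : (tr F * tr G) r t = \sum_(i < r.+1) \sum_(j < t.+1) F j i * G (t - j)%N (r - i)%N.
  by rewrite (ser_mulE (tr F)) ser_sumE; apply: eq_bigr => i _; rewrite (ser_mulE (tr F i)).
have -> : tr (F * G) r t = \sum_(j < t.+1) \sum_(i < r.+1) F j i * G (t - j)%N (r - i)%N.
  by rewrite /tr (ser_mulE F) ser_sumE; apply: eq_bigr => j _; rewrite (ser_mulE (F j)).
exact: exchange_big.
Qed.
HB.instance Definition _ := GRing.isAdditive.Build _ _ tr tr_is_additive.
HB.instance Definition _ := GRing.isMultiplicative.Build _ _ tr tr_is_multiplicative.

Lemma tr_x f : tr (ser_map (@serC R) f) = serC f.
Proof.
apply: funext => -[|r]; apply: funext => t; rewrite /tr /ser_map /serC //=.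
Qed.
Lemma tr_y f : tr (serC f) = ser_map (@serC R) f.
Proof. by rewrite -tr_x. Qed.
End Transpose.

Lemma ser_mapC (R S : pzRingType) (f : {rmorphism R -> S}) c :
  ser_map f (serC c) = serC (f c).
Proof. by apply: funext => -[|n] //; rewrite /ser_map /= raddf0. Qed.
Lemma ser_mapX (R S : pzRingType) (f : {rmorphism R -> S}) : ser_map f serX = serX.
Proof. by apply: funext => n; rewrite /ser_map /serX rmorph_nat. Qed.

Section Linear.
Variable K : comNzRingType.
Local Notation SK := (ser (ser K)).
Definition kx : SK := serX.
Definition ky : SK := serC serX.
Definition kc (c : K) : SK := serC (serC c).

Variables (al ga : K).
(** Covers the factors y - x, x + y and x + y - r x y; the coefficient 1 of y is what makes division
    possible. *)
Definition lin : SK := ky + kc al * kx + kc ga * (kx * ky).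

Lemma lin_coef (A : pzRingType) (iota : {rmorphism K -> A}) (F : ser (ser A)) r t :
  (ser_map (ser_map iota) lin * F) r t.+1 =
  F r t + (if r is r'.+1 then iota al * F r' t.+1 + iota ga * F r' t else 0).
Proof.
have -> : ser_map (ser_map iota) lin =
   serC serX + serC (serC (iota al)) * serX + serC (serC (iota ga)) * (serX * serC serX).
  by rewrite /lin /kx /ky /kc !rmorphD !rmorphM /= !ser_mapC !ser_mapX /= !ser_mapC !ser_mapX.
rewrite !mulrDl !ser_addE serC_mulE serX_mulE -addrA; congr (_ + _).
rewrite -!mulrA !serC_mulE !serX_mulE.
case: r => [|r]; first by rewrite !mulr0 addr0.
by rewrite serC_mulE serX_mulE.
Qed.

(** The coefficient of x^r y^(t+1) in [lin * F] is [F r t] plus terms with smaller r. With [Pr]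
    being vanishing this gives cancellation of [lin]; with [Pr] being congruence to a scalar it
    gives division by [lin] modulo [N]. *)
Lemma lin_solve (A : pzRingType) (iota : {rmorphism K -> A}) (Pr : A -> Prop)
    (F : ser (ser A)) :
  (forall a b, Pr a -> Pr b -> Pr (a - b)) -> (forall c a, Pr a -> Pr (iota c * a)) ->
  (forall r t, Pr ((ser_map (ser_map iota) lin * F) r t)) -> forall r t, Pr (F r t).
Proof.
move=> PB PZ hF; elim=> [|r IH] t.
  by have := hF 0%N t.+1; rewrite lin_coef addr0.
have := hF r.+1 t.+1; rewrite lin_coef => /PB h; have {}h := h _ (PB _ _ (PZ al _ (IH t.+1)) (PZ (- ga) _ (IH t))).
by rewrite rmorphN mulNr opprK addrK in h.
Qed.

Lemma lin_cancel (F G : SK) : lin * F = lin * G -> F = G.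
Proof.
move=> e; apply/eqP; rewrite -subr_eq0; apply/eqP.
apply: funext => r; apply: funext => t.
apply: (lin_solve (iota := idfun) (Pr := fun z => z = 0)) => [a b -> ->|c a ->|{}r {}t].
- by rewrite subrr.
- by rewrite mulr0.
have -> : ser_map (ser_map idfun) lin = lin by [].
by rewrite mulrBr e subrr.
Qed.
End Linear.

Section Scalars.
Variables (K : fieldType) (A : pzRingType) (iota : {rmorphism K -> A}).
Hypothesis iota_central : forall c a, iota c * a = a * iota c.
Variable N : A -> Prop.
Hypothesis N_ideal : is_left_ideal N.
Hypothesis N_proper : ~ N 1.
Local Notation SK := (ser (ser K)).
Local Notation SA := (ser (ser A)).
Definition ser2P : SA -> Prop := serP (serP N).
Local Notation iota2 := (ser_map (ser_map iota)).
Local Notation eq2 := (eqN iota2 ser2P).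

Lemma ser2P_ideal : is_left_ideal ser2P.
Proof. exact: serP_ideal (serP_ideal N_ideal). Qed.
Lemma iota2_central c F : iota2 c * F = F * iota2 c.
Proof. exact: ser_map_central (ser_map_central iota_central) c F. Qed.

Lemma eqN_inj a c d : eqN iota N a c -> eqN iota N a d -> c = d.
Proof.
move=> h1 h2; have [/eqP|ne] := eqVneq (c - d) 0; first by rewrite subr_eq0 => /eqP.
exfalso.
have h : N (iota (c - d)).
  have := NB N_ideal h2 h1; rewrite opprB addrC addrA subrK.
  by rewrite -rmorphB.
by apply: N_proper; rewrite -(rmorph1 iota) -(mulVf ne) rmorphM; exact: (NM N_ideal).
Qed.

Lemma eq2_inj F C D : eq2 F C -> eq2 F D -> C = D.
Proof.
move=> h1 h2; apply: funext => r; apply: funext => t.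
exact: eqN_inj (h1 r t) (h2 r t).
Qed.

Lemma eq2_solve al ga (F : SA) (Z : SK) : eq2 (iota2 (lin al ga) * F) Z -> exists C, eq2 F C.
Proof.
move=> h; have H r t : exists c, eqN iota N (F r t) c.
  apply: (@lin_solve _ al ga _ iota (fun z => exists c, eqN iota N z c)).
  - by move=> a b [c hc] [d hd]; exists (c - d); exact: (eqNB N_ideal).
  - move=> c a [d hd]; exists (c * d).
    by apply: (eqNM iota_central N_ideal) => //; exact: (eqN_iota _ N_ideal).
  - by move=> {}r {}t; exists (Z r t); exact: h.
have [C hC] := choice (fun p : nat * nat => H p.1 p.2).
by exists (fun r t => C (r, t)) => r t; exact: (hC (r, t)).
Qed.
End Scalars.

Section Rearrange.
Variable S : pzRingType.
Existing Instances ncring_ops ncring.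
(** Bookkeeping for [entry_eq]: each summand on the right has as its last factor an element of the
    ideal, hence lies in the ideal. *)
Lemma entry_rearrange (s s' u v d m q p t w W T : S) :
  s * (u * (s * m)) = u * m ->
  u * m - s * v * p - s * (d * W - v * T) =
  s * (u * (s * m - s' * q) - v * (p - t) - d * w)
  + s * u * s' * q + s * d * (w - W) - s * v * (t - T).
Proof.
move=> e; have -> : s * (u * (s * m - s' * q) - v * (p - t) - d * w) =
  s * (u * (s * m)) - s * (u * (s' * q)) - s * (v * (p - t)) - s * (d * w).
  by non_commutative_ring.
rewrite e; non_commutative_ring.
Qed.
Variables (R : pzRingType) (f : {rmorphism R -> S}).
Lemma rmorph_signM n V : f ((-1) ^+ n * V) = (-1) ^+ n * f V.
Proof. by rewrite rmorphM rmorph_sign. Qed.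
Lemma rmorph_rearrange n D W V T :
  f ((-1) ^+ n * (D * W - V * T)) = (-1) ^+ n * (f D * f W - f V * f T).
Proof. by rewrite rmorph_signM rmorphB !rmorphM. Qed.
End Rearrange.

(** Exchanging x and y reverses the sign of both sides, so [f c] solves the equation of [c];
    uniqueness of the solution then gives symmetry. *)
Lemma fixed_by_symmetry (S : comPzRingType) (f : {rmorphism S -> S}) x y w k t c :
  f x = y -> f y = x -> f w = - w -> f k = k -> f t = t ->
  ((y - x) * (x + y) - k * ((y - x) * (x * y))) * c = (x + y) * w - (y - x) * (x * y) * t ->
  ((y - x) * (x + y) - k * ((y - x) * (x * y))) * f c = (x + y) * w - (y - x) * (x * y) * t.
Proof.
move=> fx fy fw fk ft /(congr1 f).
rewrite !(rmorphM, rmorphB, rmorphD) fx fy fw fk ft => e.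
transitivity (- (((x - y) * (y + x) - k * ((x - y) * (y * x))) * f c)); first by ring.
rewrite e; ring.
Qed.

(** * Scalars congruent to the diagonal entries of B(u) B(v) *)

Section Necessity.
Variables (K : fieldType) (A : pzRingType) (iota : {rmorphism K -> A}).
Hypothesis iota_central : forall c a, iota c * a = a * iota c.
Variable N : A -> Prop.
Hypothesis N_ideal : is_left_ideal N.
Hypothesis N_proper : ~ N 1.
Variables (kappa : nat) (par : 'I_kappa -> bool).
Variables (B : 'M[ser A]_kappa) (mu : 'I_kappa -> ser K).
Hypothesis B_refl : forall i j k l r t,
  N ((refl_lhs par B - refl_rhs par B) i j k l r t).
Hypothesis B_unit : forall i q n,
  N ((B * map_mx (@serN A) B) i q n - ((n == 0%N) && (i == q))%:R).
Hypothesis B_hw : highest_weight iota N B mu.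

Local Notation SK := (ser (ser K)).
Local Notation SA := (ser (ser A)).
Local Notation iota2 := (ser_map (ser_map iota)).
Local Notation N2 := (ser2P N).
Local Notation eq2 := (eqN iota2 N2).
Local Notation x := (kx K).
Local Notation y := (ky K).
Local Notation Bx := (map_mx (ser_map (@serC A)) B).
Local Notation By := (map_mx (@serC (ser A)) B).
Local Notation mx f := (ser_map (@serC K) f : SK).
Local Notation my f := (serC f : SK).

Let N2i : is_left_ideal N2 := ser2P_ideal N_ideal.
Let i2c := iota2_central iota_central.

Lemma iota2_x : iota2 x = vx A.
Proof. by rewrite /kx ser_mapX. Qed.
Lemma iota2_y : iota2 y = vy A.
Proof. by rewrite /ky ser_mapC /= ser_mapX. Qed.

Lemma Bx_up (i j : 'I_kappa) : (i < j)%N -> N2 (Bx i j).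
Proof.
move=> ij r t; rewrite mxE /ser_map /serC; case: t => [|t] /=; last exact: N0.
by case: B_hw => + _; apply.
Qed.
Lemma By_up (i j : 'I_kappa) : (i < j)%N -> N2 (By i j).
Proof.
move=> ij r t; rewrite mxE /serC; case: r => [|r] /=; last exact: N0.
by case: B_hw => + _; apply.
Qed.
Lemma iota2_mx f : iota2 (mx f) = ser_map (@serC A) (ser_map iota f).
Proof. by apply: funext => r; rewrite /ser_map /= ser_mapC. Qed.
Lemma iota2_my f : iota2 (my f) = serC (ser_map iota f).
Proof. exact: ser_mapC. Qed.

Lemma Bx_diag i : eq2 (Bx i i) (mx (mu i)).
Proof.
rewrite /eqN /= iota2_mx mxE -rmorphB => r t; rewrite /ser_map /serC; case: t => [|t] /=.
  by case: B_hw => _; apply.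
exact: N0.
Qed.
Lemma By_diag i : eq2 (By i i) (my (mu i)).
Proof.
rewrite /eqN /= iota2_my mxE -rmorphB => r t; rewrite /ser_map /serC; case: r => [|r] /=.
  by case: B_hw => _; apply.
exact: N0.
Qed.

Definition beta i : SA := (Bx * By) i i.
Definition betaT i : SA := (By * Bx) i i.

Lemma betaT_tr i : betaT i = tr (beta i).
Proof.
rewrite /betaT /beta !mxM rmorph_sum; apply: eq_bigr => c _.
by rewrite rmorphM /= !mxE tr_x tr_y.
Qed.

Lemma eq2_tr F C : eq2 F C -> eq2 (tr F) (tr C).
Proof. by move=> h r t; exact: (h t r). Qed.

Lemma beta_split i : exists2 z, N2 z &
  beta i = Bx i i * By i i + \sum_(a : 'I_kappa | (i < a)%N) Bx i a * By a i + z.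
Proof.
exists (\sum_(a : 'I_kappa | (a < i)%N) Bx i a * By a i).
  by apply: (Nsum N2i) => a ai; apply: (NM N2i); exact: By_up.
rewrite /beta mxM (bigD1 i) //= -addrA; congr (_ + _).
rewrite (bigID (fun a : 'I_kappa => (i < a)%N)) /=; congr (_ + _); apply: eq_bigl => a.
  by rewrite -val_eqE /= eq_sym neq_ltn; case: ltngtP.
by rewrite -val_eqE /= neq_ltn; case: ltngtP.
Qed.

Definition Wij i a : SK := mx (mu a) * my (mu i) - my (mu a) * mx (mu i).

Lemma entry_eq (i a : 'I_kappa) (Ca : SK) : (i < a)%N -> eq2 (beta a) Ca ->
  eq2 (iota2 ((y - x) * (x + y)) * (Bx i a * By a i)
       - iota2 (sgn par a * ((y - x) * (x * y))) * beta i)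
      (sgn par a * ((x * y) * (x + y) * Wij i a - (y - x) * (x * y) * tr Ca)).
Proof.
move=> ia hC.
have nia : i != a by rewrite -val_eqE neq_ltn ia.
have h : N2 ((refl_lhs par B - refl_rhs par B) i a a i) by move=> r t; exact: B_refl.
rewrite (refl_entry _ _ nia) in h; have {}h := N_sign N2i h.
have hT : eq2 (betaT a) (tr Ca) by rewrite betaT_tr; exact: eq2_tr.
have hW : eq2 (Bx a a * By i i - By a a * Bx i i) (Wij i a).
  apply: (eqNB N2i); apply: (eqNM i2c N2i);
    by [exact: Bx_diag | exact: By_diag].
rewrite -iota2_x -iota2_y -!rmorphB -!rmorphD -!rmorphM in h.
have hq : N2 (By a i * Bx i a) by apply: (NM N2i); exact: Bx_up.
rewrite /eqN (rmorph_rearrange iota2) (rmorph_signM iota2).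
rewrite (@entry_rearrange _ _ (sgn par i) _ _ _ _ (By a i * Bx i a) _ (betaT a)
  (Bx a a * By i i - By a a * Bx i i)); last first.
  by rewrite [X in _ * X]mulrA commr_sign -mulrA mulrA -expr2 sqrr_sign mul1r.
apply: (NB N2i); first apply: (ND N2i); first apply: (ND N2i).
- exact: (NM N2i) h.
- exact: (NM N2i) hq.
- exact: (NM N2i) hW.
- exact: (NM N2i) hT.
Qed.

Local Notation rh i := (rho1 K par i).

Lemma kc_rho (i : 'I_kappa) : kc (rh i) = \sum_(a : 'I_kappa | (i < a)%N) sgn par a.
Proof.
rewrite /rho1 /rho /kc !rmorph_sum; apply: eq_bigr => a _.
by rewrite /sgn !rmorph_sign.
Qed.

Definition tailC (C : 'I_kappa -> SK) (i : 'I_kappa) : SK :=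
  \sum_(a : 'I_kappa | (i < a)%N) sgn par a * C a.
(** Antisymmetric under exchange of x and y, and unchanged when a scalar multiple of [m] is added to
    [t]. *)
Definition Wpol m t : SK := (y - x) * (mx m * my m) + x * y * (mx t * my m - my t * mx m).

Lemma Wpol_sum (i : 'I_kappa) :
  x * y * (x + y) * \sum_(a : 'I_kappa | (i < a)%N) sgn par a * Wij i a
  = (x + y) * (Wpol (mu i) (tail par mu i) - (y - x) * (mx (mu i) * my (mu i))).
Proof.
have -> : \sum_(a : 'I_kappa | (i < a)%N) sgn par a * Wij i a =
   mx (tail par mu i) * my (mu i) - my (tail par mu i) * mx (mu i).
  rewrite /tail !rmorph_sum !big_distrl -sumrB; apply: eq_bigr => a _ /=.
  rewrite /sgn !rmorphM !rmorph_sign /Wij /=; ring.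
rewrite /Wpol; ring.
Qed.

Lemma lin_factor r : lin (-1) 0 * lin 1 (- r) = (y - x) * (x + y) - kc r * ((y - x) * (x * y)) :> SK.
Proof.
rewrite /lin; have -> : kc (- r) = - kc r :> SK by rewrite /kc !rmorphN.
have -> : kc (-1) = -1 :> SK by rewrite /kc !rmorphN !rmorph1.
have -> : kc 1 = 1 :> SK by rewrite /kc !rmorph1.
have -> : kc 0 = 0 :> SK by rewrite /kc !rmorph0.
ring.
Qed.

(** Summing [entry_eq] over a > i turns the coefficients s_a of [beta i] into rho_i, which completes
    the product of the two [lin] factors. *)
Lemma beta_eq (i : 'I_kappa) (C : 'I_kappa -> SK) :
  (forall a : 'I_kappa, (i < a)%N -> eq2 (beta a) (C a)) ->
  eq2 (iota2 (lin (-1) 0 * lin 1 (- rh i)) * beta i)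
      ((x + y) * Wpol (mu i) (tail par mu i) - (y - x) * (x * y) * tailC (fun a => tr (C a)) i).
Proof.
move=> hC; pose U := (y - x) * (x + y); pose V := (y - x) * (x * y).
have hs := eqN_sum N2i (index_enum _) (fun a ia => entry_eq ia (hC a ia)).
have hd : eq2 (iota2 U * (Bx i i * By i i)) (U * (mx (mu i) * my (mu i))).
  apply: (eqNM i2c N2i); first exact: eqN_iota.
  by apply: (eqNM i2c N2i); [exact: Bx_diag | exact: By_diag].
have [z hz eb] := beta_split i.
have := eqND N2i (eqND N2i hd hs) ((eqN0 _ _ _).2 (NM N2i (iota2 U) hz)).
rewrite addr0; congr (eqN _ _ _ _).
  rewrite sumrB -big_distrl -big_distrr /=.
  have -> : lin (-1) 0 * lin 1 (- rh i) = U - \sum_(a : 'I_kappa | (i < a)%N) sgn par a * V.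
    by rewrite lin_factor kc_rho big_distrl.
  rewrite [in RHS]rmorphB [in RHS]rmorph_sum [in RHS]mulrBl.
  have -> : iota2 U * beta i = iota2 U * (Bx i i * By i i)
      + iota2 U * (\sum_(a : 'I_kappa | (i < a)%N) Bx i a * By a i) + iota2 U * z.
    by rewrite eb !mulrDr.
  rewrite [X in X + _ = _]addrA [LHS]addrAC. reflexivity.
have -> : \sum_(a : 'I_kappa | (i < a)%N)
    sgn par a * (x * y * (x + y) * Wij i a - (y - x) * (x * y) * tr (C a)) =
    x * y * (x + y) * (\sum_(a : 'I_kappa | (i < a)%N) sgn par a * Wij i a) -
    V * tailC (fun a => tr (C a)) i.
  rewrite /tailC !big_distrr -sumrB; apply: eq_bigr => a _ /=; rewrite /V; ring.
rewrite Wpol_sum /U /V; ring.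
Qed.

Lemma ord_down_ind_strong (P : 'I_kappa -> Prop) :
  (forall i : 'I_kappa, (forall a : 'I_kappa, (i < a)%N -> P a) -> P i) -> forall i, P i.
Proof.
move=> h i; have [n] := ubnP (kappa - i); elim: n i => // n IH i hi.
apply: h => a ia; apply: IH; have := ltn_ord a; lia.
Qed.

Lemma beta_scalar : exists C, forall i, eq2 (beta i) (C i).
Proof.
suff h i : exists C, eq2 (beta i) C by have [C hC] := choice h; exists C.
elim/ord_down_ind_strong: i => i IH.
have [C hC] : exists C, forall a : 'I_kappa, (i < a)%N -> eq2 (beta a) (C a).
  have /choice [C hC] : forall a : 'I_kappa, exists c, (i < a)%N -> eq2 (beta a) c.
    move=> a; case: (boolP (i < a)%N) => [/IH [c hc]|]; first by exists c.
    by exists 0.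
  by exists C.
have h := beta_eq hC.
rewrite rmorphM -mulrA in h.
have [D hD] := eq2_solve iota_central N_ideal h.
have [D2 hD2] := eq2_solve iota_central N_ideal hD; by exists D2.
Qed.

Lemma beta_fix C : (forall i, eq2 (beta i) (C i)) -> forall i,
  lin (-1) 0 * lin 1 (- rh i) * C i =
  (x + y) * Wpol (mu i) (tail par mu i) - (y - x) * (x * y) * tailC (fun a => tr (C a)) i.
Proof.
move=> hC i; have h2 := beta_eq (fun (a : 'I_kappa) (_ : (i < a)%N) => hC a).
have h1 := eqNM i2c N2i (eqN_iota iota2 N2i (lin (-1) 0 * lin 1 (- rh i))) (hC i).
exact: (eq2_inj N_ideal N_proper h1 h2).
Qed.

Lemma beta_sym C : (forall i, eq2 (beta i) (C i)) -> forall i, tr (C i) = C i.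
Proof.
move=> hC; elim/ord_down_ind_strong => i IH.
have e := beta_fix hC i.
have tx : tr x = y by rewrite /ky -tr_x ser_mapX.
have ty : tr y = x by rewrite /ky tr_y ser_mapX.
have tW m t : tr (Wpol m t) = - Wpol m t.
  rewrite /Wpol rmorphD !(rmorphM, rmorphB) /= tx ty !(tr_x, tr_y); ring.
have eT : tailC (fun a => tr (C a)) i = tailC C i.
  by apply: eq_bigr => a ia; rewrite IH.
have tT : tr (tailC C i) = tailC C i.
  rewrite -[in RHS]eT /tailC rmorph_sum; apply: eq_bigr => a _.
  by rewrite /sgn (rmorph_signM (@tr K)).
have tc r : tr (kc r) = kc r :> SK by rewrite /kc tr_y ser_mapC.
rewrite eT lin_factor in e.
apply: (@lin_cancel _ (-1) 0); apply: (@lin_cancel _ 1 (- rh i)).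
rewrite ![lin 1 _ * _]mulrCA !mulrA lin_factor e.
exact: fixed_by_symmetry tx ty (tW _ _) (tc _) tT e.
Qed.
End Necessity.

(** * Evaluation on the curve v = c - u *)

Section Evaluation.
Variable K : fieldType.
Local Notation SK := (ser (ser K)).
Local Notation X := (serX : ser K).

Lemma sig0E (f : ser K) n : sig 0 f n = (-1) ^+ n * f n.
Proof.
have -> : sig 0 f n = \sum_(r < n.+1) f r * ((- serX : ser K) ^+ r : ser K) n.
  apply: eq_bigr => r _; congr (_ * (_ ^+ r : ser K) n); apply: funext => -[|k].
    by rewrite /inv_c_minus_u ser_oppE /serX /= oppr0.
  by rewrite /inv_c_minus_u ser_oppE /serX /=; case: k => [|k]; rewrite /= ?expr0 // exprS mul0r.
have h r : forall k, ((- serX : ser K) ^+ r : ser K) k = (-1) ^+ r * (r == k)%:R.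
  elim: r => [|r IH] k; first by rewrite expr0 mul1r ser_oneE eq_sym.
  rewrite exprS mulNr ser_oppE serX_mulE; case: k => [|k]; first by rewrite mulr0 oppr0.
  by rewrite IH exprS mulN1r mulNr eqSS.
rewrite big_ord_recr /= h eqxx mulr1 big1 ?add0r 1?mulrC // => r _.
by rewrite h (ltn_eqF (ltn_ord r)) !mulr0.
Qed.

Lemma evc0E (F : SK) n : evc 0 F n = \sum_(s < n.+1) (-1) ^+ (n - s) * F s (n - s)%N.
Proof. by apply: eq_bigr => s _; rewrite -sig0E. Qed.

Lemma evc_kx (c : K) : evc c (kx K) = X.
Proof. by rewrite /kx -(ser_mapX (@serC K)) evc_x. Qed.
Lemma evc_kc (c d : K) : evc c (kc d) = serC d.
Proof. by rewrite /kc evc_y sig_C. Qed.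
Lemma evc_wronsk (c : K) m t : (1 - serC c * X) * evc c (Wpol m t) = - (X * wronsk c m t).
Proof.
rewrite /Wpol rmorphD !(rmorphM, rmorphB) /= evc_kx !evc_x !evc_y /wronsk.
transitivity (((1 - serC c * X) * sig c X - (1 - serC c * X) * X) * (m * sig c m) +
  X * ((1 - serC c * X) * sig c X) * (t * sig c m - sig c t * m)); first by ring.
rewrite sig_X; ring.
Qed.
(** In the variables x and y the curve u + v = c is x + y = c x y. *)
Lemma evc_lin (c : K) : (1 - serC c * X) * evc c (lin 1 (- c)) = 0.
Proof.
rewrite /lin !(rmorphD, rmorphM) /= evc_kx !evc_kc evc_y rmorph1 rmorphN.
transitivity ((1 - serC c * X) * sig c X + X - serC c * X * (X + (1 - serC c * X) * sig c X)).
  ring.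
rewrite sig_X; ring.
Qed.
Lemma ser_map_serCM (S : pzRingType) (f g : ser S) r t :
  (ser_map (@serC S) f * serC g) r t = f r * g t.
Proof. by rewrite ser_mulCE serC_mulE. Qed.
End Evaluation.

(** * Derivation of the conditions from the scalars *)

Section Necessity.
Variables (K : fieldType) (A : pzRingType) (iota : {rmorphism K -> A}).
Hypothesis iota_central : forall c a, iota c * a = a * iota c.
Variable N : A -> Prop.
Hypothesis N_ideal : is_left_ideal N.
Hypothesis N_proper : ~ N 1.
Variables (kappa : nat) (par : 'I_kappa -> bool).
Variables (B : 'M[ser A]_kappa) (mu : 'I_kappa -> ser K).
Hypothesis B_refl : forall i j k l r t,
  N ((refl_lhs par B - refl_rhs par B) i j k l r t).
Hypothesis B_unit : forall i q n,
  N ((B * map_mx (@serN A) B) i q n - ((n == 0%N) && (i == q))%:R).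
Hypothesis B_hw : highest_weight iota N B mu.

Local Notation SK := (ser (ser K)).
Local Notation iota2 := (ser_map (ser_map iota)).
Local Notation N2 := (ser2P N).
Local Notation eq2 := (eqN iota2 N2).
Local Notation x := (kx K).
Local Notation y := (ky K).
Local Notation rh i := (rho1 K par i).
Local Notation X := (serX : ser K).
Let N2i : is_left_ideal N2 := ser2P_ideal N_ideal.
Let i2c := iota2_central iota_central.

(** At y = -x the series [beta B i] becomes a diagonal entry of B(u) B(-u), known modulo [N] by
    unitarity; a proper [N] determines the scalar. *)
Lemma evc_beta i C : eq2 (beta B i) C -> evc 0 C = 1.
Proof.
move=> hC; apply: funext => n.
apply: (eqN_inj N_ideal N_proper (a := (B * map_mx (@serN A) B) i i n)); last first.
  have := B_unit i i n; rewrite eqxx andbT; congr (N (_ - _)).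
  by rewrite ser_oneE rmorph_nat.
rewrite evc0E.
have -> : (B * map_mx (@serN A) B) i i n =
    \sum_(s < n.+1) (-1) ^+ (n - s) * beta B i s (n - s)%N.
  rewrite mxM ser_sumE.
  transitivity (\sum_(a < kappa) \sum_(s < n.+1) (-1) ^+ (n - s) * (B i a s * B a i (n - s)%N)).
    apply: eq_bigr => a _; rewrite ser_mulE; apply: eq_bigr => s _.
    by rewrite mxE /serN mulrA commr_sign -mulrA.
  rewrite exchange_big; apply: eq_bigr => s _; rewrite -big_distrr; congr (_ * _).
  rewrite /beta mxM !ser_sumE; apply: eq_bigr => a _.
  by rewrite !mxE ser_map_serCM.
apply: (eqN_sum N_ideal) => s _; apply: (eqNM iota_central N_ideal); last exact: hC.
by rewrite -(rmorph_sign iota); exact: (eqN_iota _ N_ideal).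
Qed.

Lemma beta_step C (i j : 'I_kappa) : nat_of_ord j = i.+1 ->
  (forall i, eq2 (beta B i) (C i)) ->
  (x + y) * (Wpol (mu i) (tail par mu i) - Wpol (mu j) (tail par mu i)) =
  lin (-1) 0 * lin 1 (- rh i) * (C i - C j).
Proof.
move=> e hC.
have fixC k : lin (-1) 0 * lin 1 (- rh k) * C k =
    (x + y) * Wpol (mu k) (tail par mu k) - (y - x) * (x * y) * tailC par C k.
  rewrite (beta_fix iota_central N_ideal N_proper B_refl B_hw hC); congr (_ - _ * _).
  by apply: eq_bigr => a _; rewrite (beta_sym iota_central N_ideal N_proper B_refl B_hw hC).
have hi := fixC i; have hj := fixC j.
(* The two tails differ by s_j mu_j, which drops out of the antisymmetric part. *)
have -> : Wpol (mu j) (tail par mu i) = Wpol (mu j) (tail par mu j).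
  rewrite (tail_step _ _ e) /Wpol !(rmorphD, rmorphM) /sgn !rmorph_sign; ring.
have eT : tailC par C i = sgn par j * C j + tailC par C j by exact: big_gt_step.
have er : kc (rh i) = sgn par j + kc (rh j) :> ser (ser K).
  by rewrite /kc (rho1_step _ _ e) rmorphD /sgn !rmorph_sign.
rewrite mulrBr [in RHS]mulrBr hi eT.
rewrite lin_factor er.
rewrite lin_factor in hj.
transitivity ((x + y) * Wpol (mu i) (tail par mu i) -
  ((x + y) * Wpol (mu j) (tail par mu j) - (y - x) * (x * y) * tailC par C j)
  - (y - x) * (x * y) * tailC par C j); first by ring.
rewrite -hj; ring.
Qed.

Lemma necessary_last (i : 'I_kappa) : i.+1 = kappa -> mu i * sig 0 (mu i) = 1.
Proof.
move=> e; transitivity (evc 0 (ser_map (@serC K) (mu i) * serC (mu i))).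
  by rewrite rmorphM /= evc_x evc_y.
apply: (@evc_beta i); have [z hz ->] := beta_split N_ideal B_hw i.
rewrite big_gt_last // addr0 -[X in eqN _ _ _ X]addr0.
have h0 : eq2 z 0 by rewrite /eqN rmorph0 subr0; exact: hz.
apply: (eqND N2i) h0.
have h1 := Bx_diag N_ideal B_hw i; have h2 := By_diag N_ideal B_hw i.
exact: (eqNM i2c N2i h1 h2).
Qed.

Lemma necessary_step (i j : 'I_kappa) : 2%:R != 0 :> K -> nat_of_ord j = i.+1 ->
  Fser par mu i * sig (rh i) (Fser par mu i) = Fser par mu j * sig (rh i) (Fser par mu j).
Proof.
move=> two e; apply/(cond_wronsk par two mu e).
have [C hC] := beta_scalar iota_central N_ideal B_refl B_hw.
have h := beta_step e hC.
have hu := unit_linear (rh i).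
have [r0|r0] := eqVneq (rh i) 0.
  rewrite r0 oppr0 in h *.
  have exy : x + y = lin 1 0 :> ser (ser K).
    by rewrite /lin /kc !rmorph1 !rmorph0 mul1r mul0r addr0 addrC.
  rewrite exy [lin _ _ * lin _ _]mulrC -mulrA in h.
  have := congr1 (evc 0) (lin_cancel h).
  rewrite rmorphM !rmorphB /= !(evc_beta (hC _)) subrr mulr0.
  move/(congr1 (fun f => (1 - serC 0 * X) * f)); rewrite mulr0 mulrBr !evc_wronsk.
  by rewrite opprK addrC => /subr0_eq /serX_cancel.
have l0 : evc (rh i) (lin 1 (- rh i)) = 0.
  by apply: (ser_cancel hu); rewrite evc_lin mulr0.
have := congr1 (evc (rh i)) h.
rewrite !rmorphM rmorphB rmorphD /= l0 mulr0 mul0r evc_kx evc_y => h0.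
(* On the curve (1 - rho_i x)(x + y) equals -rho_i x^2; together with one x from [evc_wronsk] this
   gives the factor rho_i x^3, which can be cancelled as rho_i is nonzero. *)
have : serC (rh i) * (X * (X * (X * (wronsk (rh i) (mu i) (tail par mu i)
   - wronsk (rh i) (mu j) (tail par mu i))))) = serC (rh i) * (X * (X * (X * 0))).
  transitivity ((- (serC (rh i) * X) * X) * (- (X * wronsk (rh i) (mu i) (tail par mu i))
     - - (X * wronsk (rh i) (mu j) (tail par mu i)))); first by ring.
  rewrite -!evc_wronsk; set u := 1 - serC (rh i) * X; set Wi := evc _ _; set Wj := evc _ _.
  transitivity (u * u * ((X + sig (rh i) X) * (Wi - Wj))); last by rewrite h0 !mulr0.
  transitivity ((u * X + u * sig (rh i) X) * (u * (Wi - Wj))); last by ring.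
  rewrite sig_X /u; ring.
have c0 : (serC (rh i) : ser K) 0%N != 0 by [].
by move/(ser_cancel c0)/serX_cancel/serX_cancel/serX_cancel/subr0_eq.
Qed.
End Necessity.

(** * The theorem *)

Section VermaIdeal.
Variables (K : fieldType) (kappa : nat) (par eps : 'I_kappa -> bool).
Variable mu : 'I_kappa -> ser K.
Local Notation A := (FreeAlg K kappa).
Local Notation N := (verma_ideal par eps mu).
Local Notation iota := (GRing.in_alg A).
Local Notation B := (bmat eps (@bgen K kappa)).

Lemma malg_scalar_central (c : K) (a : A) : iota c * a = a * iota c.
Proof.
pose f : {malg K[{fmonom gen_t kappa}]} := a; rewrite mulr_algl.
have -> : iota c = << c *g (mone : {fmonom gen_t kappa}) >> :> {malg K[{fmonom gen_t kappa}]}.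
  by rewrite /= -mul_malgC mulr1.
rewrite -[RHS]/(f * _) -[LHS]/(c *: f) malgM_def fgmulgU malgZ_def /fgscale.
by apply: eq_bigr => k _; rewrite mulm1 mulrC.
Qed.

Lemma gen_left_ideal_ideal (R : pzRingType) (S : R -> Prop) : is_left_ideal (gen_left_ideal S).
Proof.
split=> [J [] //|a b ha hb J hJ hS|a b hb J hJ hS]; case: (hJ) => _ hD hM.
  by apply: hD; [exact: ha | exact: hb].
by apply: hM; exact: hb.
Qed.

Lemma verma_ideal_relator a : tsy_relators par eps a -> N a.
Proof. by move=> ha J hJ; apply; left => J' hJ'; apply. Qed.

(** [B] is the matrix of free generators: its relations hold only modulo [N], which contains the
    two-sided ideal of relators, so no quotient algebra has to be formed. *)
Lemma verma_refl i j k l r t : N ((refl_lhs par B - refl_rhs par B) i j k l r t).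
Proof.
rewrite refl_coefE; have [_ _ hM] := gen_left_ideal_ideal (fun a => tsy_ideal par eps a \/ verma_gens eps mu a).
by apply: hM; apply: verma_ideal_relator; left; do 6 eexists.
Qed.

Lemma verma_unit i q n : N ((B * map_mx (@serN A) B) i q n - ((n == 0%N) && (i == q))%:R).
Proof.
have [_ _ hM] := gen_left_ideal_ideal (fun a => tsy_ideal par eps a \/ verma_gens eps mu a).
have -> : (B * map_mx (@serN A) B) i q n - ((n == 0%N) && (i == q))%:R =
  (-1) ^+ (par i * par q + par q) *
  (unitary_coef par eps (@bgen K kappa) n i q - ((n == 0%N) && (i == q))%:R).
  rewrite unitary_coefE mulrBr mulrA -expr2 sqrr_sign mul1r; congr (_ - _).
    rewrite mxM ser_sumE [RHS]exchange_big; apply: eq_bigr => j _.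
    by rewrite ser_mulE; apply: eq_bigr => r _; rewrite !mxE /serN.
  by have [->|_] := eqVneq i q; rewrite ?andbF ?mulr0 //; case: (par q); rewrite ?mulr1 ?sqrrN ?expr1n ?mul1r.
by apply: hM; apply: verma_ideal_relator; right; do 3 eexists.
Qed.

Lemma verma_highest : highest_weight iota N B mu.
Proof.
split=> [i j r ij|i r] J hJ; apply; right; [left | right].
  by exists i, j, r; rewrite mxE.
by exists i, r; rewrite mxE.
Qed.

Hypothesis nontriv : verma_nontrivial par eps mu.

Lemma necessity_last (i : 'I_kappa) : i.+1 = kappa -> mu i * sig 0 (mu i) = 1.
Proof.
exact: (necessary_last malg_scalar_central (gen_left_ideal_ideal _) nontriv verma_unit verma_highest).
Qed.

Lemma necessity_step (i j : 'I_kappa) : 2%:R != 0 :> K -> nat_of_ord j = i.+1 ->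
  Fser par mu i * sig (rho1 K par i) (Fser par mu i) =
  Fser par mu j * sig (rho1 K par i) (Fser par mu j).
Proof.
exact: (necessary_step malg_scalar_central (gen_left_ideal_ideal _) nontriv
  verma_refl verma_unit verma_highest).
Qed.
End VermaIdeal.

(* C is modelled as R[i] for a realType R (any realType is a model of the reals).
   Indices are 0-based; par i = |i|, eps_i = (-1)^(epsb i),
   mu i r = coefficient of u^-r in mu_i(u). *)
Theorem theorem4p11 (R : realType) (m n : nat)
    (par : 'I_(m + n) -> bool) (hpar : #|[pred i | ~~ par i]| = m)
    (epsb : 'I_(m + n) -> bool) (mu : 'I_(m + n) -> nat -> R[i])
    (hmu0 : forall i, mu i 0%N = (-1) ^+ epsb i) :
  verma_nontrivial par epsb mu <->
  ((forall i : 'I_(m + n), i.+1 = (m + n)%N ->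
       lser_eq (lM (mu_ser mu i) (lsubst 0 (mu_ser mu i))) (l1 _))
   /\
   (forall i j : 'I_(m + n), nat_of_ord j = i.+1 ->
       lser_eq (lM (mu_tilde par mu i) (lsubst (rho par i.+1) (mu_tilde par mu i)))
               (lM (mu_tilde par mu j) (lsubst (rho par i.+1) (mu_tilde par mu j))))).
Proof.
have two : 2%:R != 0 :> R[i] by rewrite pnatr_eq0.
split=> [h|[h1 h2]].
  split=> [i e|i j e].
    by apply/cond_last; exact: (necessity_last h e).
  by apply/cond_step; exact: (necessity_step h two e).
apply: (sufficiency two hmu0) => [i e|i j e].
  by apply/cond_last; exact: h1.
by apply/cond_step; exact: h2.
Qed.
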